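(* Given a set of local data $\mathcal{L}$ (in the sense of the context), there exists a closed Hamiltonian $S^1$-manifold $M_{\mathcal{L}}$ whose associated set of local data $\mathcal{L}_{M_{\mathcal L}}$ is $\mathcal{L}$. Moreover this manifold is unique up to isomorphism. Thus $\mathcal{L}\mapsto M_{\mathcal{L}}$ is a one-to-one association from sets of local data to isomorphism classes of Hamiltonian $S^1$-manifolds; in particular, a closed Hamiltonian $S^1$-manifold $(M,H,\omega)$ is determined up to isomorphism by its local data $\mathcal{L}_M$.
   Context: A Hamiltonian $S^1$-manifold is a triple $(M,H,\omega)$ where $M$ is a connected $2n$-manifold with symplectic form $\omega$ and $H:M\to\mathbb{R}$ generates a semi-free symplectic circle action ($\iota_X\omega=-dH$, $X$ the generating vector field). Semi-free means free off the fixed point set. If $M$ is closed, $H$ is normalized to have minimum $0$. Non-closed manifolds are allowed as pieces; they are thought of as pieces $L^{-1}(\text{interval})$ of closed Hamiltonian $S^1$-manifolds with Hamiltonian $L$, and in particular their Hamiltonian is proper as a map onto the interval which is its image. An isomorphism $(M,H,\omega)\to(M',H',\omega')$ is an equivariant diffeomorphism $f$ with $f^*\omega'=\omega$ and $H'\circ f=H$. Germs. Let $\lambda\in\mathbb{R}$ and $\varepsilon_0>0$. A cobordism at $\lambda$ is a tuple $(Y,H,\epsilon)$ with $0<\epsilon<\varepsilon_0$, where $Y$ is a Hamiltonian $S^1$-manifold whose Hamiltonian $H$ maps $Y$ onto $I_\epsilon=(\lambda-\epsilon,\lambda+\epsilon)$ and $\lambda$ is the only critical value of $H$. For $\epsilon'<\epsilon$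 the restriction $(H^{-1}(I_{\epsilon'}),H,\epsilon')$ is identified with $(Y,H,\epsilon)$. Two cobordisms $(Y,H,\epsilon)$, $(Y',H',\epsilon')$ are equivalent if for some $\epsilon''<\min(\epsilon,\epsilon')$ there is an isomorphism $H^{-1}(I_{\epsilon''})\to (H')^{-1}(I_{\epsilon''})$. A critical germ $G(\lambda,\varepsilon_0)$ is an equivalence class of cobordisms. Minimal germs $m(\lambda,\varepsilon_0)$ (respectively maximal germs $M(\lambda,\varepsilon_0)$) are defined in the same way with $H(Y)=[\lambda,\lambda+\epsilon)$ (respectively $H(Y)=(\lambda-\epsilon,\lambda]$), where $\lambda$ is the minimum (respectively maximum) of $H$ and its only critical value. Germs are considered up to shrinking $\varepsilon_0$. Regular slices. For an open interval $I$, a regular slice is a tuple $(Z,K,I,\omega)$ where $K:Z\to I$ is a surjective moment map for a free $S^1$-action on the symplectic manifold $(Z,\omega)$. Slices are equivalent if they are isomorphic; $F(I)$ denotes an equivalence class. Gluing classes. Let $G(\lambda,\varepsilon)$ be a germ and $F(I)$ a class of regular slices with $I=(\lambda',\lambda)$. For representatives $(Y,H,\epsilon)\in G(\lambda,\varepsilon)$ and $(Z,K,I)\in F(I)$, a gluing map $(\phi,\epsilon)$ is an isomorphism $\phi:H^{-1}(\lambda-\epsilon,\lambda)\to K^{-1}(\lambda-\epsilon,\lambda)$. Gluing maps $(\phi,\epsilon)$ for $(Y,Z)$ and $(\phi',\epsilon')$ for $(Y',Z')$ are equivalent if there are $\epsilon''<\min(\epsilon,\epsilon')$ and isomorphisms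 $f:Y\to Y'$, $g:Z\to Z'$ (after restricting $Y$ and $Y'$ to a common interval) with $g\circ\phi=\phi'\circ f$ on $H^{-1}(\lambda-\epsilon'',\lambda)$. A gluing class $\Phi:G(\lambda,\varepsilon)\to F(I)$ is an equivalence class of gluing maps. Gluing classes for $I=(\lambda,\lambda')$ are defined analogously, using $(\lambda,\lambda+\epsilon)$, and likewise with $G$ replaced by a minimal or maximal germ. A set of local data $\mathcal{L}$ consists of: (1) a collection of critical levels $\mathcal{C}=\{0=\lambda_0<\dots<\lambda_{s+1}\}$; (2) critical germs $G(\lambda_i,\varepsilon_i)$ for $i=1,\dots,s$, a minimal germ $m(\lambda_0,\varepsilon_0)$ and a maximal germ $M(\lambda_{s+1},\varepsilon_{s+1})$; (3) for $j=0,\dots,s$ an equivalence class of regular slices $F(I_j)$ with $I_j=(\lambda_j,\lambda_{j+1})$; (4) gluing classes $\Phi_i^+:G(\lambda_i,\varepsilon_i)\to F(I_i)$ and $\Phi_i^-:G(\lambda_i,\varepsilon_i)\to F(I_{i-1})$ for $i=1,\dots,s$, together with gluing classes from $m(\lambda_0,\varepsilon_0)$ to $F(I_0)$ and from $M(\lambda_{s+1},\varepsilon_{s+1})$ to $F(I_s)$. For a closed Hamiltonian $S^1$-manifold $(M,H,\omega)$ the associated local data $\mathcal{L}_M$ consists of its critical values, the germs defined by neighborhoods $H^{-1}(\lambda-\epsilon,\lambda+\epsilon)$ of the critical levels (one-sided at the minimum and maximum), the regular slices $H^{-1}(\lambda,\lambda')$ for consecutive critical values $\lambda<\lambda'$,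 and the gluing classes given by the identity on the overlaps.
   Formalization: Two sets of local data are equal when one family of germ and slice isomorphisms makes all gluing squares commute at once; comparing each gluing class separately, uniqueness fails. Closed manifolds with trivial action are excluded, as they have only one critical level. *)

(* Defs.v *)
From mathcomp Require Import all_boot all_order all_algebra.
From mathcomp Require Import all_classical all_reals all_analysis.

Set Implicit Arguments.
Unset Strict Implicit.
Unset Printing Implicit Defensive.

Import Order.TTheory GRing.Theory Num.Theory numFieldNormedType.Exports.

Local Open Scope classical_set_scope.
Local Open Scope ring_scope.

Section Smooth.
Context (R : realType).

Fixpoint ndiff_on (V W : normedModType R) (k : nat) (U : set V) (f : V -> W)
    : Prop :=
  if k is k'.+1 then
    (forall x, U x -> differentiable f x) /\
    (forall v, ndiff_on k' U (fun x => 'D_v f x))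
  else True.

(* Used with U open and V finite-dimensional, where it means that f is
   C^infinity on U: a function all of whose iterated directional derivatives
   are Frechet differentiable. *)
Definition smooth_on (V W : normedModType R) (U : set V) (f : V -> W) : Prop :=
  forall k, ndiff_on k U f.

(* chart_fun is meaningful on chart_dom only, and chart_inv on the image of
   chart_dom only. *)
Record chart (m : nat) (T : Type) := Chart {
  chart_dom : set T;
  chart_fun :> T -> 'rV[R]_m;
  chart_inv : 'rV[R]_m -> T }.

Definition chart_img (m : nat) (T : Type) (c : chart m T) : set 'rV[R]_m :=
  c @` chart_dom c.

Definition is_chart (m : nat) (T : topologicalType) (c : chart m T) : Prop :=
  [/\ open (chart_dom c), open (chart_img c),
      (forall x, chart_dom c x -> chart_inv c (c x) = x),
      {within chart_dom c, continuous c} &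
      {within chart_img c, continuous (chart_inv c)}].

(* Smooth m-manifolds without boundary; the atlas need not be maximal. *)
Record manifold (m : nat) := Manifold {
  mf_sort :> topologicalType;
  mf_atlas : set (chart m mf_sort);
  mf_hausdorff : hausdorff_space mf_sort;
  mf_countable : @second_countable mf_sort;
  mf_is_chart : forall c, mf_atlas c -> is_chart c;
  mf_cover : forall x : mf_sort, exists2 c, mf_atlas c & chart_dom c x;
  mf_transition : forall c c', mf_atlas c -> mf_atlas c' ->
    smooth_on (c @` (chart_dom c `&` chart_dom c')) (c' \o chart_inv c) }.

Definition local_rep (m : nat) (S T : Type) (c : chart m S) (c' : chart m T)
  (f : S -> T) : 'rV[R]_m -> 'rV[R]_m := c' \o f \o chart_inv c.

(* Smoothness of f on the open set A; the values of f off A are irrelevant. *)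
Definition smooth_map (m : nat) (M N : manifold m) (A : set M) (f : M -> N)
    : Prop :=
  {within A, continuous f} /\
  forall c c', @mf_atlas m M c -> @mf_atlas m N c' ->
    smooth_on (c @` (chart_dom c `&` A `&` f @^-1` chart_dom c'))
              (local_rep c c' f).

Definition smooth_fun (m : nat) (M : manifold m) (h : M -> R) : Prop :=
  forall c, @mf_atlas m M c -> smooth_on (chart_img c) (h \o chart_inv c).

(* A 2-form is given in each chart c, at the point with coordinates u, by its
   Gram matrix in these coordinates. *)
Definition form_data (m : nat) (M : manifold m) :=
  chart m M -> 'rV[R]_m -> 'M[R]_m.

Definition eval_form (m : nat) (M : manifold m) (om : form_data M)
  (c : chart m M) (u v w : 'rV[R]_m) : R := (v *m om c u *m w^T) 0 0.

(* f^* om' = om at the points of A. *)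
Definition pulls_back (m : nat) (M N : manifold m) (om : form_data M)
    (om' : form_data N) (A : set M) (f : M -> N) : Prop :=
  forall (c : chart m M) (c' : chart m N) (x : M),
    mf_atlas c -> mf_atlas c' -> A x -> chart_dom c x -> chart_dom c' (f x) ->
    forall v w : 'rV[R]_m,
      eval_form om' c' (c' (f x)) ('D_v (local_rep c c' f) (c x))
                                  ('D_w (local_rep c c' f) (c x))
      = eval_form om c (c x) v w.

Record is_symplectic (m : nat) (M : manifold m) (om : form_data M) : Prop := {
  symp_compat : pulls_back om om setT id;
  symp_smooth : forall c, mf_atlas c -> smooth_on (chart_img c) (om c);
  symp_alt : forall c u, mf_atlas c -> chart_img c u ->
    forall v, eval_form om c u v v = 0;
  symp_nondeg : forall c u, mf_atlas c -> chart_img c u ->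
    forall v, (forall w, eval_form om c u v w = 0) -> v = 0;
  symp_closed : forall c u, mf_atlas c -> chart_img c u ->
    forall v1 v2 v3,
      'D_v1 (fun y => eval_form om c y v2 v3) u
    + 'D_v2 (fun y => eval_form om c y v3 v1) u
    + 'D_v3 (fun y => eval_form om c y v1 v2) u = 0 }.

(* The circle is R / 2 pi Z: [act t] is the action of e^{it}, and smoothness of
   S^1 x M -> M is smoothness of its lift to R x M. *)
Record is_smooth_circle_action (m : nat) (M : manifold m) (act : R -> M -> M)
    : Prop := {
  act_zero : forall x, act 0 x = x;
  act_add : forall s t x, act (s + t) x = act s (act t x);
  act_period : forall x, act (2 * pi) x = x;
  act_continuous : continuous (fun p : R * M => act p.1 p.2);
  act_smooth : forall c c' : chart m M, mf_atlas c -> mf_atlas c' ->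
    smooth_on [set p : R * 'rV[R]_m | chart_img c p.2 /\
                 chart_dom c' (act p.1 (chart_inv c p.2))]
              (fun p => c' (act p.1 (chart_inv c p.2))) }.

(* The vector field X generating the action, in the chart c. *)
Definition gen_field (m : nat) (M : manifold m) (act : R -> M -> M)
  (c : chart m M) (x : M) : 'rV[R]_m := derive1 (fun t : R => c (act t x)) 0.

Definition trivial_elt (t : R) : Prop := exists k : int, t = k%:~R * (2 * pi).

Definition fixed_point (T : Type) (act : R -> T -> T) (x : T) : Prop :=
  forall t, act t x = x.

End Smooth.

Section Hamiltonian.
Context (R : realType) (n : nat).

Record ham_manifold := HamManifold {
  hm_mf :> manifold R n.*2;
  hm_form : form_data hm_mf;
  hm_act : R -> hm_mf -> hm_mf;
  hm_ham : hm_mf -> R;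
  hm_connected : connected [set: hm_mf];
  hm_nonempty : [set: hm_mf] !=set0;
  hm_symplectic : is_symplectic hm_form;
  hm_action : is_smooth_circle_action hm_act;
  hm_act_symplectic : forall t, pulls_back hm_form hm_form setT (hm_act t);
  hm_semifree : forall t x,
    hm_act t x = x -> trivial_elt t \/ fixed_point hm_act x;
  hm_ham_smooth : smooth_fun hm_ham;
  (* iota_X om = - dH *)
  hm_moment : forall (c : chart R n.*2 hm_mf) (x : hm_mf),
    mf_atlas c -> chart_dom c x -> forall v,
      eval_form hm_form c (c x) (gen_field hm_act c x) v
      = - 'D_v (hm_ham \o chart_inv c) (c x);
  (* H is proper as a map onto its image; automatic if M is compact. *)
  hm_proper : forall K : set R,
    compact K -> K `<=` range hm_ham -> compact (hm_ham @^-1` K) }.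

Definition closed_ham (M : ham_manifold) : Prop :=
  [/\ compact [set: M],
      (forall x : M, 0 <= hm_ham x), (exists x : M, hm_ham x = 0) &
      (* non-trivial action *)
      exists x : M, ~ fixed_point (@hm_act M) x].

Definition critical_point (M : ham_manifold) (x : M) : Prop :=
  forall c : chart R n.*2 M, mf_atlas c -> chart_dom c x ->
    forall v, 'D_v (@hm_ham M \o chart_inv c) (c x) = 0.

Definition critical_value (M : ham_manifold) (mu : R) : Prop :=
  exists2 x : M, critical_point x & hm_ham x = mu.

(* H^{-1}(a,b) *)
Definition between (M : ham_manifold) (a b : R) : set M :=
  [set x | a < hm_ham x < b].
Arguments between M (a b)%_ring_scope _ : clear implicits.

(* f restricts to an isomorphism of the invariant open subset A of M onto the
   invariant open subset B of N. *)
Record isom_on (M N : ham_manifold) (A : set M) (B : set N) (f : M -> N)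
    : Prop := {
  isom_bij : set_bij A B f;
  isom_smooth : smooth_map A f;
  isom_inv_smooth :
    exists2 g : N -> M, {in A, cancel f g} & smooth_map B g;
  isom_equivariant : forall t x, A x -> f (hm_act t x) = hm_act t (f x);
  isom_form : pulls_back (@hm_form M) (@hm_form N) A f;
  isom_ham : forall x, A x -> hm_ham (f x) = hm_ham x }.

Definition isomorphic (M N : ham_manifold) : Prop :=
  exists f : M -> N, isom_on setT setT f.

Definition cobordism (lam e : R) (Y : ham_manifold) : Prop :=
  [/\ 0 < e, range (@hm_ham Y) = `]lam - e, lam + e[%classic &
      forall mu, critical_value Y mu <-> mu = lam].

Definition min_cobordism (lam e : R) (Y : ham_manifold) : Prop :=
  [/\ 0 < e, range (@hm_ham Y) = `[lam, lam + e[%classic &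
      forall mu, critical_value Y mu <-> mu = lam].

Definition max_cobordism (lam e : R) (Y : ham_manifold) : Prop :=
  [/\ 0 < e, range (@hm_ham Y) = `]lam - e, lam]%classic &
      forall mu, critical_value Y mu <-> mu = lam].

Definition regular_slice (a b : R) (Z : ham_manifold) : Prop :=
  range (@hm_ham Z) = `]a, b[%classic /\
  forall t (z : Z), hm_act t z = z -> trivial_elt t.

Definition gluing_map (a b : R) (Y Z : ham_manifold) (phi : Y -> Z) : Prop :=
  isom_on (between Y a b) (between Z a b) phi.

(* f exhibits the equivalence of two (minimal, maximal or interior) cobordisms
   at lam of widths e and e', after restriction to the width d. *)
Definition germ_iso (lam e e' d : R) (Y Y' : ham_manifold) (f : Y -> Y')
    : Prop :=
  0 < d < Num.min e e' /\
  isom_on (between Y (lam - d) (lam + d)) (between Y' (lam - d) (lam + d)) f.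

Definition slice_iso (Z Z' : ham_manifold) (g : Z -> Z') : Prop :=
  isom_on setT setT g.

(* (f, g) exhibits the equivalence of the gluing maps phi and phi' over the
   interval (a, b). *)
Definition gluing_iso (a b : R) (Y Z Y' Z' : ham_manifold)
    (phi : Y -> Z) (phi' : Y' -> Z') (f : Y -> Y') (g : Z -> Z') : Prop :=
  forall y, between Y a b y -> g (phi y) = phi' (f y).

(* A system of representatives for a set of local data. Only the indices
   i <= s + 1 of levels and germs and j <= s of slices and gluings are
   relevant. The germ at the level i is represented by a single cobordism of
   width ld_eps i, on which both Phi_i^+ = ld_up i and Phi_i^- = ld_down i.-1
   are represented. *)
Record local_data := LocalData {
  ld_s : nat;
  ld_level : nat -> R;
  ld_eps : nat -> R;
  ld_germ : nat -> ham_manifold;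
  ld_slice : nat -> ham_manifold;
  ld_up : forall j, ld_germ j -> ld_slice j;
  ld_down : forall j, ld_germ j.+1 -> ld_slice j;
  ld_level0 : ld_level 0 = 0;
  ld_level_lt : forall j, (j <= ld_s)%N -> ld_level j < ld_level j.+1;
  ld_min : min_cobordism (ld_level 0) (ld_eps 0) (ld_germ 0);
  ld_crit : forall i, (1 <= i <= ld_s)%N ->
    cobordism (ld_level i) (ld_eps i) (ld_germ i);
  ld_max : max_cobordism (ld_level ld_s.+1) (ld_eps ld_s.+1)
                         (ld_germ ld_s.+1);
  ld_regular : forall j, (j <= ld_s)%N ->
    regular_slice (ld_level j) (ld_level j.+1) (ld_slice j);
  ld_upP : forall j, (j <= ld_s)%N ->
    gluing_map (ld_level j) (ld_level j + ld_eps j) (@ld_up j);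
  ld_downP : forall j, (j <= ld_s)%N ->
    gluing_map (ld_level j.+1 - ld_eps j.+1) (ld_level j.+1) (@ld_down j) }.

(* L and L' represent the same set of local data. The isomorphisms f i and g j
   identifying the representatives of the germs and of the slices are the same
   in all the gluing squares: with a separate pair for each gluing class the
   data would not determine the manifold, since an automorphism of a slice need
   not extend over either of the two adjacent germs. *)
Definition same_local_data (L L' : local_data) : Prop :=
  [/\ ld_s L = ld_s L',
      (forall i, (i <= (ld_s L).+1)%N -> ld_level L i = ld_level L' i) &
      exists (d : nat -> R)
             (f : forall i, ld_germ L i -> ld_germ L' i)
             (g : forall j, ld_slice L j -> ld_slice L' j),
        [/\ (forall i, (i <= (ld_s L).+1)%N ->
               germ_iso (ld_level L i) (ld_eps L i) (ld_eps L' i) (d i) (f i)),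
            (forall j, (j <= ld_s L)%N -> slice_iso (g j)),
            (forall j, (j <= ld_s L)%N ->
               gluing_iso (ld_level L j) (ld_level L j + d j)
                 (@ld_up L j) (@ld_up L' j) (f j) (g j)) &
            (forall j, (j <= ld_s L)%N ->
               gluing_iso (ld_level L j.+1 - d j.+1) (ld_level L j.+1)
                 (@ld_down L j) (@ld_down L' j) (f j.+1) (g j))]].

(* L represents the local data of M: [same_local_data], spelled out for L and
   the data whose germs are the open subsets H^{-1}(lam - d, lam + d) of M,
   whose slices are the H^{-1}(lam, lam') and whose gluing maps are identities.
   At the extreme levels H^{-1}(lam - d, lam + d) is one-sided. *)
Definition has_local_data (M : ham_manifold) (L : local_data) : Prop :=
  (forall mu, critical_value M mu <->
     exists2 i, (i <= (ld_s L).+1)%N & mu = ld_level L i) /\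
  exists (d : nat -> R)
         (f : forall i, ld_germ L i -> M)
         (g : forall j, ld_slice L j -> M),
    [/\ (forall i, (i <= (ld_s L).+1)%N ->
           let lam := ld_level L i in
           0 < d i < ld_eps L i /\
           isom_on (between (ld_germ L i) (lam - d i) (lam + d i))
                   (between M (lam - d i) (lam + d i)) (f i)),
        (forall j, (j <= ld_s L)%N ->
           isom_on setT (between M (ld_level L j) (ld_level L j.+1)) (g j)),
        (forall j, (j <= ld_s L)%N ->
           forall y, between (ld_germ L j)
                       (ld_level L j) (ld_level L j + d j) y ->
             g j (ld_up y) = f j y) &
        (forall j, (j <= ld_s L)%N ->
           forall y, between (ld_germ L j.+1)
                       (ld_level L j.+1 - d j.+1) (ld_level L j.+1) y ->
             g j (ld_down y) = f j.+1 y)].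

End Hamiltonian.

(* Main.v *)
(* Uniqueness: an isomorphism of local data gives isomorphisms between the bands
   around the critical levels and between the regular bands, and the gluing
   squares say exactly that these agree on the overlaps, so they patch.

   Existence: the quotient of the disjoint union of the germs and slices by the
   gluing maps is Hausdorff because points with different values of H are
   separated by H, and points with the same value lie in a common piece; it is
   compact because it is covered by the images of finitely many compact bands.

   Surjectivity: the critical points of H are the fixed points of the circle,
   equivalently of its element of order two, and H is locally constant on them,
   so by compactness there are finitely many critical values. The germs and the
   slices must be connected, that is, H^-1(a, b) is connected: this is the
   connectedness theorem of Atiyah and Guillemin-Sternberg. Raising or lowering
   the level, the sublevel sets {H < c} can only change their connectedness
   when passing a critical point of index 1, and there is none. To avoid the
   equivariant Darboux theorem, the critical points are studied through the
   involution g of order two alone: if p is not a local minimum, there is w with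
   dg w = -w on which the Hessian is negative, and the two descending ends
   p + sw and p - sw are joined by half an orbit. *)

Require Import Defs.
From HB Require Import structures.
From mathcomp Require Import all_boot all_order all_algebra.
From mathcomp Require Import all_classical all_reals all_analysis.
From mathcomp Require Import ring lra.

Set Implicit Arguments.
Unset Strict Implicit.
Unset Printing Implicit Defensive.

Import Order.TTheory GRing.Theory Num.Theory numFieldNormedType.Exports.

Local Open Scope classical_set_scope.
Local Open Scope ring_scope.

(** * Calculus of smooth functions *)

Section SmoothCalculus.
Context (R : realType).
Implicit Types V W : normedModType R.

(** Nothing is known beforehand about the fixed points of the involution near a critical point, not
    even that they form a manifold, so all that is said about them comes from estimates. The
    displacement [g u - u] is bounded by a multiple of the generating field, since the half orbit is
    driven by transported copies of that field, and hence by a multiple of the gradient of H, since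
    the form is nondegenerate. This inequality takes the part of Morse-Bott nondegeneracy: H falls
    below its critical value near the point only if the Hessian has a negative direction, and that
    direction can be made anti-invariant because the Hessian vanishes on invariant vectors. Both H
    and -H are treated, through a sign [sig]: a band is obtained by two cuts, one from above with H
    and one from below with -H. A single gluing construction serves twice. It assembles a manifold
    from germs and slices, and with one piece it makes a Hamiltonian manifold of a band of a closed
    one. Its points are chosen representatives in an ambient type, so that equality of points is
    plain equality. *)

Lemma near_eq_differentiable V W (f g : V -> W) (x : V) :
  (\near x, f x = g x) -> differentiable f x -> differentiable g x.
Proof.
move=> fg df.
pose h y := g y - f y.
have -> : g = f + h.
  by apply/funext => y; rewrite -[RHS]/(f y + (g y - f y)) addrC subrK.
apply: differentiableD => //.
have h0 : \forall y \near x, h y = 0.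
  by near=> y; rewrite /h (near fg y)// subrr.
have hx : h x = 0 by exact: nbhs_singleton h0.
have E : h \o shift x = cst (h x) + \0 +o_ 0 id.
  apply/eqaddoE/eqaddoP => e e0; near=> y.
  suff -> : (h \o shift x - (cst (h x) + \0)) y = 0.
    by rewrite normr0 mulr_ge0// ltW.
  rewrite -[LHS]/(h (y + x) - (h x + 0)) hx addr0 subr0.
  near: y; move: h0; rewrite (near_shift 0 x) subr0; exact.
apply/diff_locallyP.
have -> : 'd h x = \0 :> (V -> W).
  by apply: (@diff_unique R V W h \0 x) => //; exact: cst_continuous.
by split => //; exact: cst_continuous.
Unshelve. all: by end_near. Qed.

Lemma deriveZv V W (f : V -> W) x a v : differentiable f x ->
  'D_(a *: v) f x = a *: 'D_v f x.
Proof. by move=> df; rewrite !deriveE// linearZ. Qed.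

Lemma deriveDv V W (f : V -> W) x u v : differentiable f x ->
  'D_(u + v) f x = 'D_u f x + 'D_v f x.
Proof. by move=> df; rewrite !deriveE// linearD. Qed.

Lemma derive_rV m W (f : 'rV[R]_m -> W) x v : differentiable f x ->
  'D_v f x = \sum_(i < m) v 0 i *: 'D_(delta_mx 0 i) f x.
Proof.
move=> df; rewrite deriveE// {1}(row_sum_delta v) linear_sum.
by apply: eq_bigr => i _; rewrite linearZ -deriveE.
Qed.

Lemma derive_comp V W W' (f : V -> W) (g : W -> W') x v :
  differentiable f x -> differentiable g (f x) ->
  'D_v (g \o f) x = 'D_('D_v f x) g (f x).
Proof.
move=> df dg; rewrite !deriveE//; last exact: differentiable_comp.
by rewrite diff_comp.
Qed.

Lemma ndiff_on_sub V W k (U U' : set V) (f : V -> W) :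
  U' `<=` U -> ndiff_on k U f -> ndiff_on k U' f.
Proof.
elim: k f => //= k IH f UU' [df ndf]; split; first by move=> x /UU'; exact: df.
by move=> v; apply: IH.
Qed.

(** [ndiff_on k [set x] f] depends on the germ of [f] at [x] only. Together with [ndiff_on_near]
    this allows smoothness to be checked one point at a time, with a formula and a chart that vary
    with the point. *)
Lemma ndiff_on_point V W k (U : set V) (f : V -> W) :
  (forall x, U x -> ndiff_on k [set x] f) -> ndiff_on k U f.
Proof.
elim: k f => //= k IH f H; split; first by move=> x /H[+ _]; exact.
by move=> v; apply: IH => x /H[_]; exact.
Qed.

Lemma ndiff_on_near V W k (U : set V) (f g : V -> W) :
  (forall x, U x -> \near x, f x = g x) -> ndiff_on k U f -> ndiff_on k U g.
Proof.
elim: k f g => //= k IH f g fg [df ndf]; split => [x Ux|v].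
  by apply: near_eq_differentiable (df x Ux); exact: fg.
apply: IH (ndf v) => x Ux; have := near_join (fg x Ux).
by apply: filterS => y; exact: near_eq_derive.
Qed.

Lemma ndiff_on_eq V W k (U : set V) (f g : V -> W) : open U ->
  (forall x, U x -> f x = g x) -> ndiff_on k U f -> ndiff_on k U g.
Proof.
move=> oU fg; apply: ndiff_on_near => x Ux.
by near=> y; apply: fg; near: y; exact: open_nbhs_nbhs.
Unshelve. all: by end_near. Qed.

Lemma ndiff_onW V W k (U : set V) (f : V -> W) :
  ndiff_on k.+1 U f -> ndiff_on k U f.
Proof. by elim: k f => //= k IH f [df ndf]; split => // v; exact: IH. Qed.

Lemma ndiff_on_cst V W k (U : set V) (a : W) : ndiff_on k U (cst a : V -> W).
Proof.
elim: k a => //= k IH a; split; first by move=> x _; exact: differentiable_cst.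
move=> v; have -> : (fun x => 'D_v (cst a : V -> W) x) = cst 0; last exact: IH.
by apply/funext => x; rewrite derive_cst.
Qed.

Lemma ndiff_onD V W k (U : set V) (f g : V -> W) : open U ->
  ndiff_on k U f -> ndiff_on k U g -> ndiff_on k U (fun x => f x + g x).
Proof.
move=> oU; elim: k f g => //= k IH f g [df ndf] [dg ndg]; split.
  by move=> x Ux; apply: differentiableD; [exact: df|exact: dg].
move=> v; apply: (ndiff_on_eq oU _ (IH _ _ (ndf v) (ndg v))) => x Ux.
by rewrite deriveD//; apply: diff_derivable; [exact: df|exact: dg].
Qed.

Lemma ndiff_on_sum V W k (U : set V) n (f : 'I_n -> V -> W) : open U ->
  (forall i, ndiff_on k U (f i)) -> ndiff_on k U (fun x => \sum_(i < n) f i x).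
Proof.
move=> oU H; elim: n f H => [|n IH] f H.
  apply: (ndiff_on_eq oU _ (ndiff_on_cst k U 0)) => x _.
  by rewrite big_ord0.
apply: (ndiff_on_eq oU _ (ndiff_onD oU (IH _ (fun i => H (widen_ord (leqnSn n) i)))
  (H ord_max))) => x _.
by rewrite big_ord_recr.
Qed.

Lemma scale_is_bilinear W : bilinear_for
    (GRing.Scale.Law.clone _ _ *:%R _) (GRing.Scale.Law.clone _ _ *:%R _)
    (@GRing.scale R W).
Proof.
split=> [u'|u] a x y /=.
- by rewrite scalerDl scalerA.
- by rewrite scalerDr !scalerA mulrC.
Qed.

(** Scaling is a continuous bilinear map, and the product rule is the differential of this map
    composed with the pair of [a] and [f]. *)
Lemma is_diff_scale V W (a : V -> R) (f : V -> W) x :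
  differentiable a x -> differentiable f x ->
  differentiable (fun y => a y *: f y) x /\
  forall v, 'D_v (fun y => a y *: f y) x = 'D_v a x *: f x + a x *: 'D_v f x.
Proof.
move=> da df.
pose bM := bilinear_isBilinear.Build R R W W _ _ _ (scale_is_bilinear W).
pose b : {bilinear R -> W -> W} := HB.pack (@GRing.scale R W) bM.
have cb : continuous (fun p : R * W => b p.1 p.2).
  by move=> p; apply: scale_continuous.
have Hb : is_diff (a x, f x) (fun p : R * W => b p.1 p.2)
    (fun q : R * W => b (a x) q.2 + b q.1 (f x)).
  by apply: DiffDef; [exact: differentiable_bilin|exact: diff_bilin].
have Hp : is_diff x (fun y => (a y, f y)) (fun y => ('d a x y, 'd f x y)).
  by apply: is_diff_pair; exact: differentiableP.
have H : is_diff x (fun y => a y *: f y)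
    (fun y => a x *: 'd f x y + 'd a x y *: f x) := is_diff_comp Hp Hb.
have dH := @ex_diff _ _ _ _ _ _ _ H.
split=> // v; rewrite deriveE// (@diff_val _ _ _ _ _ _ _ H) !deriveE//.
by rewrite addrC.
Qed.

Lemma ndiff_onZ V W k (U : set V) (a : V -> R) (f : V -> W) : open U ->
  ndiff_on k U a -> ndiff_on k U f -> ndiff_on k U (fun x => a x *: f x).
Proof.
move=> oU; elim: k a f => // k IH a f na nf; have [da nda] := na.
have [df ndf] := nf; split.
  by move=> x Ux; apply: (is_diff_scale _ _).1; [exact: da|exact: df].
move=> v; apply: (ndiff_on_eq oU _ (ndiff_onD oU (IH _ _ (nda v) (ndiff_onW nf))
  (IH _ _ (ndiff_onW na) (ndf v)))) => x Ux.
by rewrite (is_diff_scale _ _).2//; [exact: da|exact: df].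
Qed.

Lemma derive_coord V m n (f : V -> 'M[R]_(m, n)) x v i j : differentiable f x ->
  'D_v (fun y => f y i j) x = ('D_v f x) i j.
Proof.
by move=> df; rewrite derive_mx ?mxE//; exact: diff_derivable.
Qed.

Lemma ndiff_on_coord V m n k (U : set V) (f : V -> 'M[R]_(m, n)) i j : open U ->
  ndiff_on k U f -> ndiff_on k U (fun x => f x i j).
Proof.
move=> oU; elim: k f => //= k IH f [df ndf]; split.
  move=> x Ux; apply: (@differentiable_comp _ _ _ _ f (fun M => M i j)).
    exact: df.
  exact: differentiable_coord.
move=> v; apply: (ndiff_on_eq oU _ (IH _ (ndf v))) => x Ux.
by rewrite derive_coord//; exact: df.
Qed.

(** The chain rule writes ['D_v (g \o f)] as a sum of products of coordinates of ['D_v f] with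
    partial derivatives of [g] composed with [f]. The induction runs over all [g] with [f] fixed,
    and is closed by the stability under sums and products. *)
Lemma ndiff_on_comp V W m k (U : set V) (O : set 'rV[R]_m)
    (f : V -> 'rV[R]_m) (g : 'rV[R]_m -> W) : open U ->
  (forall x, U x -> O (f x)) -> ndiff_on k U f -> ndiff_on k O g ->
  ndiff_on k U (g \o f).
Proof.
move=> oU UO; elim: k g => // k IH g nf ng.
have [df ndf] := nf; have [dg ndg] := ng; split.
  by move=> x Ux; apply: differentiable_comp; [exact: df|exact/dg/UO].
move=> v; apply: (@ndiff_on_eq _ _ _ _ (fun x => \sum_(i < m)
    'D_v f x 0 i *: ((fun y => 'D_(delta_mx 0 i) g y) \o f) x)) => //.
  move=> x Ux; rewrite [RHS]derive_comp; [|exact: df|exact/dg/UO].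
  by rewrite [RHS]derive_rV//; exact/dg/UO.
apply: ndiff_on_sum => // i; apply: ndiff_onZ => //.
  by apply: ndiff_on_coord => //; exact: ndf.
by apply: IH; [exact: ndiff_onW|exact: ndg].
Qed.

Lemma derive_affine V V' W (l : {linear V -> V'}) b (f : V' -> W) v x :
  'D_v (fun y => f (l y + b)) x = 'D_(l v) f (l x + b).
Proof.
rewrite /derive; apply: (congr1 (fun F : R -> W => lim (F @ 0^'))); apply/funext => h /=.
by rewrite [l (_ + _)]linearD [l (_ *: _)]linearZ /= addrA.
Qed.

(** Affine substitutions commute with directional derivatives already at the level of difference
    quotients. This serves to freeze the time variable of the action. *)
Lemma ndiff_on_affine V V' W k (l : {linear V -> V'}) b (f : V' -> W)
    (U : set V) (O : set V') : continuous l ->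
  (forall x, U x -> O (l x + b)) -> ndiff_on k O f ->
  ndiff_on k U (fun y => f (l y + b)).
Proof.
move=> cl UO; elim: k f => //= k IH f [df ndf]; split.
  move=> x Ux; apply: (@differentiable_comp _ _ _ _ (fun y => l y + b) f).
    apply: differentiableD; first exact: linear_differentiable.
    exact: differentiable_cst.
  exact/df/UO.
move=> v; rewrite (_ : (fun x => _) = (fun y => 'D_(l v) f (l y + b))).
  exact: (IH (fun z => 'D_(l v) f z)).
by apply/funext => y; exact: derive_affine.
Qed.

Lemma ndiff_on_lin V W k (U : set V) (l : {linear V -> W}) :
  continuous l -> ndiff_on k U l.
Proof.
move=> cl; case: k => //= k; split.
  by move=> x _; exact: linear_differentiable.
move=> v; have -> : (fun x => 'D_v l x) = cst (l v); last exact: ndiff_on_cst.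
by apply/funext => x; rewrite deriveE ?diff_lin//; exact: linear_differentiable.
Qed.

End SmoothCalculus.

(** * Hessian form and second order Taylor formula *)

Section SecondOrder.
Context (R : realType) (m : nat).
Local Notation E := 'rV[R]_m.
Implicit Types (f : E -> R) (x y w p v : E).

Lemma coord_norm_le (w : E) i : `|w 0 i| <= `|w|.
Proof. by rewrite [leRHS]/Num.norm/= mx_normrE (le_trans _ (le_bigmax _ _ (0, i))). Qed.

Lemma norm_coord_le (w : E) (a : R) : 0 <= a -> (forall i, `|w 0 i| <= a) ->
  `|w| <= a.
Proof.
move=> a0 H; rewrite [leLHS]/Num.norm/= mx_normrE bigmax_le// => -[i j] _ /=.
by rewrite ord1.
Qed.

(** The Hessian as a quadratic form, spelled out with partial derivatives so that it is visibly a
    polynomial in [w]: bounds uniform in [w] reduce to finitely many coefficients. *)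
Definition qf f x w : R :=
  \sum_(i < m) \sum_(j < m)
    w 0 i * w 0 j * 'D_(delta_mx 0 i) ('D_(delta_mx 0 j) f) x.

Lemma derive2_qf f (U : set E) x w : open U -> ndiff_on 2 U f -> U x ->
  'D_w ('D_w f) x = qf f x w.
Proof.
move=> oU [df ndf] Ux; have [d2f _] := ndf w.
rewrite derive_rV; last exact: d2f.
apply: eq_bigr => i _.
have -> : 'D_(delta_mx 0 i) ('D_w f) x =
    'D_(delta_mx 0 i) (fun y => \sum_(j < m) w 0 j *: 'D_(delta_mx 0 j) f y) x.
  apply: near_eq_derive; near=> y; apply: derive_rV; apply: df.
  by near: y; exact: open_nbhs_nbhs.
have -> : (fun y => \sum_(j < m) w 0 j *: 'D_(delta_mx 0 j) f y) =
    \sum_(j < m) (w 0 j \*: 'D_(delta_mx 0 j) f).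
  by apply/funext => y; rewrite fct_sumE.
rewrite derive_sum; last first.
  move=> j; apply: derivableZ; apply: diff_derivable.
  by have [+ _] := ndf (delta_mx 0 j); exact.
rewrite scaler_sumr; apply: eq_bigr => j _.
rewrite deriveZ ?scalerA//; apply: diff_derivable.
by have [+ _] := ndf (delta_mx 0 j); exact.
Unshelve. all: by end_near. Qed.

Lemma qfZ f x (a : R) w : qf f x (a *: w) = a ^+ 2 * qf f x w.
Proof.
rewrite /qf mulr_sumr; apply: eq_bigr => i _; rewrite mulr_sumr.
by apply: eq_bigr => j _; rewrite !mxE; ring.
Qed.

Lemma qf_parallelogram f x v w :
  qf f x (v + w) + qf f x (v - w) = 2 * (qf f x v + qf f x w).
Proof.
rewrite /qf -!big_split mulr_sumr /=; apply: eq_bigr => i _.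
rewrite -!big_split mulr_sumr /=; apply: eq_bigr => j _.
by rewrite !mxE; ring.
Qed.

Lemma is_derive_line (V W : normedModType R) (f : V -> W) (x w : V) (t : R) :
  differentiable f (t *: w + x) ->
  is_derive t 1 (fun t : R => f (t *: w + x)) ('D_w f (t *: w + x)).
Proof.
move=> df.
have lin : linear ( *:%R^~ w : R -> V).
  by move=> a b c; rewrite scalerDl scalerA.
pose lM := GRing.isLinear.Build _ _ _ _ _ lin.
pose l : {linear R -> V} := HB.pack ( *:%R ^~ w : R -> V) lM.
split; last by rewrite (derive_affine l) /= scale1r.
apply: diff_derivable; apply: (@differentiable_comp _ _ _ _ (fun t : R => t *: w + x) f t).
  apply: differentiableD; last exact: differentiable_cst.
  exact: (@ex_diff _ _ _ _ _ _ _ (is_diff_scalel t w)).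
exact: df.
Qed.

Lemma line_continuous (V W : normedModType R) (f : V -> W) (x w : V) (t : R) :
  differentiable f (t *: w + x) ->
  {for t, continuous (fun t : R => f (t *: w + x))}.
Proof.
move=> /is_derive_line H; apply: differentiable_continuous.
by apply/derivable1_diffP; exact: ex_derive.
Qed.

Lemma mean_value f x w :
  (forall t : R, 0 <= t <= 1 -> differentiable f (t *: w + x)) ->
  exists2 b, 0 < b < 1 & f (w + x) = f x + 'D_w f (b *: w + x).
Proof.
move=> df; pose F t := f (t *: w + x).
have [||b b01 E1] := @MVT R F (fun t => 'D_w f (t *: w + x)) 0 1 ltr01.
- move=> t; rewrite in_itv/= => /andP[t0 t1].
  by apply: is_derive_line; apply: df; rewrite !ltW.
- apply: continuous_in_subspaceT => t; rewrite inE/= in_itv/= => t01.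
  by apply: line_continuous; exact: df.
exists b; first by rewrite in_itv in b01.
by move: E1; rewrite /F scale1r scale0r add0r subr0 mulr1 => <-; rewrite subrKC.
Qed.

Lemma taylor2 f (U : set E) x w : open U -> ndiff_on 2 U f ->
  (forall t : R, 0 <= t <= 1 -> U (t *: w + x)) ->
  exists2 b, 0 < b < 1 &
    f (w + x) = f x + 'D_w f x + 2^-1 * qf f (b *: w + x) w.
Proof.
move=> oU nf seg; have [df ndf] := nf; have [d2f _] := ndf w.
(* [K] makes [G] vanish at 0 and at 1. Rolle gives a zero [a] of [G'], which also vanishes at 0;
   Rolle again on [[0, a]] gives a zero [b] of the second derivative, and there [2 * K] is the
   Hessian form. *)
pose F t := f (t *: w + x); pose K := F 1 - F 0 - 'D_w f x.
pose G t := F t - F 0 - t * 'D_w f x - t ^+ 2 * K.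
pose G' t := 'D_w f (t *: w + x) - 'D_w f x - 2 * t * K.
have dG (t : R) : 0 <= t <= 1 -> is_derive t 1 G (G' t).
  move=> t01; have dF := is_derive_line (df _ (seg t t01)).
  rewrite -[G]/(fun t => F t - F 0 - t * 'D_w f x - t ^+ 2 * K).
  have -> : G' t = 'D_w f (t *: w + x) - 0 - 'D_w f x - 2 * t * K by rewrite subr0.
  have -> : (fun t => F t - F 0 - t * 'D_w f x - t ^+ 2 * K) =
     F - cst (F 0) - ('D_w f x \*: id) - (K \*: (fun t : R => t ^+ 2)).
    apply/funext => s; rewrite !fctE /= ; congr (_ - _ - _); first by rewrite mulrC.
    by rewrite mulrC.
  apply: is_deriveB; last first.
    apply: is_derive_eq. rewrite -[LHS]/(K * (t * 1 + t * 1)); ring.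
  apply: is_deriveB; last by apply: is_derive_eq; rewrite /GRing.scale/= mulr1.
have cG (t : R) : 0 <= t <= 1 -> {for t, continuous G}.
  by move=> /dG dGt; apply: differentiable_continuous; apply/derivable1_diffP.
have G0 : G 0 = 0 by rewrite /G expr0n/= !mul0r !subr0 subrr.
have G1 : G 1 = 0 by rewrite /G expr1n /K !mul1r subrr.
have [| | |a a01 Ga] := @Rolle R G 0 1 ltr01.
- by move=> t; rewrite in_itv/= => /andP[t0 t1]; apply: (@ex_derive _ _ _ _ _ _ _ (dG t _)); rewrite !ltW.
- by apply: continuous_in_subspaceT => t; rewrite inE/= in_itv/=; exact: cG.
- by rewrite G0 G1.
have {a01} /andP[a0 a1] : 0 < a < 1 by rewrite in_itv in a01.
have G'a : G' a = 0.
  rewrite -(@derive_val _ _ _ _ _ _ _ Ga); symmetry; apply: derive_val.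
  by apply: dG; rewrite !ltW.
have dG' (t : R) : 0 <= t <= 1 -> is_derive t 1 G' ('D_w ('D_w f) (t *: w + x) - 2 * K).
  move=> t01; have dF := is_derive_line (d2f _ (seg t t01)).
  rewrite -['D_w ('D_w f) _]subr0.
  have -> : G' = (fun t => 'D_w f (t *: w + x)) - cst ('D_w f x) - ((2 * K) \*: id).
    by apply/funext => s; rewrite !fctE /= /G' mulrAC.
  apply: is_deriveB; last by apply: is_derive_eq; rewrite /GRing.scale/= mulr1.
have G'0 : G' 0 = 0 by rewrite /G' scale0r add0r subrr mulr0 mul0r subr0.
have [| | |b b0a Gb] := @Rolle R G' 0 a a0.
- move=> t; rewrite in_itv/= => /andP[t0 ta].
  by apply: (@ex_derive _ _ _ _ _ _ _ (dG' t _)); rewrite !ltW//= (lt_trans ta).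
- apply: continuous_in_subspaceT => t; rewrite inE/= in_itv/= => /andP[t0 ta].
  apply: differentiable_continuous; apply/derivable1_diffP.
  by apply: (@ex_derive _ _ _ _ _ _ _ (dG' t _)); rewrite t0 (le_trans ta)// ltW.
- by rewrite G'0 G'a.
have {b0a} /andP[b0 ba] : 0 < b < a by rewrite in_itv in b0a.
have b1 : b < 1 := lt_trans ba a1.
have b01 : 0 <= b <= 1 by rewrite !ltW.
exists b; first by rewrite b0.
have := @derive_val _ _ _ _ _ _ _ Gb.
rewrite (@derive_val _ _ _ _ _ _ _ (dG' b b01)) (derive2_qf _ oU nf (seg b b01)).
move/eqP; rewrite subr_eq0 => /eqP ->; rewrite /K /F scale1r scale0r add0r; lra.
Qed.

End SecondOrder.

(** * Uniform bounds on the Hessian form *)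

Section QuadraticBounds.
Context (R : realType) (m : nat).
Local Notation E := 'rV[R]_m.
Implicit Types (f : E -> R) (x y w p v : E).

Lemma smooth_on_D (V W : normedModType R) (U : set V) (f : V -> W) (v : V) :
  @smooth_on R V W U f -> smooth_on U ('D_v f).
Proof. by move=> sf k; have [_ +] := sf k.+1; exact. Qed.

Lemma smooth_on_diff (V W : normedModType R) (U : set V) (f : V -> W) (x : V) :
  @smooth_on R V W U f -> U x -> differentiable f x.
Proof. by move=> sf Ux; have [+ _] := sf 1%N; exact. Qed.

Lemma smooth_on_cont (V W : normedModType R) (U : set V) (f : V -> W) (x : V) :
  @smooth_on R V W U f -> U x -> {for x, continuous f}.
Proof. by move=> sf Ux; exact/differentiable_continuous/(smooth_on_diff sf). Qed.

Lemma smooth_on_sub (V W : normedModType R) (A B : set V) (f : V -> W) :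
  A `<=` B -> smooth_on B f -> smooth_on A f.
Proof. by move=> AB sf k; apply: ndiff_on_sub (sf k). Qed.

Lemma qf_joint_continuous f (U : set E) p v : smooth_on U f -> U p ->
  (fun z : E * E => qf f z.1 z.2) @ (p, v) --> qf f p v.
Proof.
move=> sf Up; apply: cvg_big => [|i _]; first exact: add_continuous.
apply: cvg_big => [|j _]; first exact: add_continuous.
have c2 (k : 'I_m) : (fun z : E * E => z.2 0 k) @ (p, v) --> v 0 k.
  apply: (@cvg_comp _ _ _ snd (fun z : E => z 0 k)); first exact: cvg_snd.
  exact: coord_continuous.
apply: cvgM; first by apply: cvgM; exact: c2.
apply: (@cvg_comp _ _ _ fst ('D_(delta_mx 0 i) ('D_(delta_mx 0 j) f))).
  exact: cvg_fst.
exact: (smooth_on_cont (smooth_on_D _ (smooth_on_D _ sf)) Up).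
Qed.

Lemma qf_near f (U : set E) p (e : R) : smooth_on U f -> U p -> 0 < e ->
  \forall y \near p, forall w, `|qf f y w - qf f p w| <= e * `|w| ^+ 2.
Proof.
move=> sf Up e0.
pose d i j := 'D_(delta_mx 0 i) ('D_(delta_mx 0 j) f).
(* The form has [m ^ 2] coefficients; the added 1 keeps the denominator positive when [m] is 0. *)
pose e' := e / (m%:R ^+ 2 + 1).
have m0 : 0 < m%:R ^+ 2 + 1 :> R by rewrite ltr_wpDl// sqr_ge0.
have e'0 : 0 < e' by rewrite divr_gt0.
have H : \forall y \near p, forall i j, `|d i j p - d i j y| < e'.
  pose P (i : 'I_m) := [set y | forall j, `|d i j p - d i j y| < e']; apply: (@filter_forall _ _ P (nbhs p)) => i; apply: (@filter_forall _ _ (fun j y => `|d i j p - d i j y| < e') (nbhs p)) => j.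
  have : {for p, continuous (d i j)} :=
    smooth_on_cont (smooth_on_D _ (smooth_on_D _ sf)) Up.
  by move/cvgrPdist_lt; exact.
apply: filterS H => y H w.
rewrite /qf -sumrB (le_trans (ler_norm_sum _ _ _))//.
have step i : `|\sum_(j < m) w 0 i * w 0 j * d i j y -
    \sum_(j < m) w 0 i * w 0 j * d i j p| <= m%:R * (e' * `|w| ^+ 2).
  rewrite -sumrB (le_trans (ler_norm_sum _ _ _))//.
  apply: (@le_trans _ _ (\sum_(j < m) e' * `|w| ^+ 2)); last first.
    by rewrite sumr_const card_ord mulr_natl.
  apply: ler_sum => j _; rewrite -mulrBr normrM mulrC distrC.
  apply: ler_pM => //; first exact/ltW/H.
  by rewrite normrM expr2 ler_pM// coord_norm_le.
apply: (@le_trans _ _ (\sum_(i < m) m%:R * (e' * `|w| ^+ 2))).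
  by apply: ler_sum => i _; exact: step.
rewrite sumr_const card_ord -[X in X <= _]mulr_natl mulrA -expr2 mulrA.
rewrite ler_wpM2r ?sqr_ge0// /e' mulrCA ger_pMr//.
by rewrite ler_pdivrMr// mul1r lerDl.
Qed.

Lemma qf_bound f p : exists2 C, 0 < C & forall w, `|qf f p w| <= C * `|w| ^+ 2.
Proof.
exists (\sum_(i < m) \sum_(j < m)
    `|'D_(delta_mx 0 i) ('D_(delta_mx 0 j) f) p| + 1) => [|w].
  by rewrite ltr_wpDl// sumr_ge0// => i _; rewrite sumr_ge0.
apply: (@le_trans _ _ ((\sum_(i < m) \sum_(j < m)
    `|'D_(delta_mx 0 i) ('D_(delta_mx 0 j) f) p|) * `|w| ^+ 2)); last first.
  by rewrite ler_wpM2r ?sqr_ge0// lerDl.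
rewrite /qf (le_trans (ler_norm_sum _ _ _))// mulr_suml ler_sum// => i _.
rewrite (le_trans (ler_norm_sum _ _ _))// mulr_suml ler_sum// => j _.
rewrite normrM mulrC ler_wpM2l// normrM expr2 ler_pM// coord_norm_le//.
Qed.

Lemma qf_near_bound f (U : set E) p : smooth_on U f -> U p ->
  exists2 C, 0 < C & \forall y \near p, forall w, `|qf f y w| <= C * `|w| ^+ 2.
Proof.
move=> sf Up; have [C C0 HC] := qf_bound f p; exists (C + 1); first by lra.
apply: filterS (qf_near sf Up ltr01) => y H w.
by rewrite -(subrK (qf f p w) (qf f y w)) (le_trans (ler_normD _ _))//
  addrC mulrDl lerD.
Qed.

Lemma ball_segment p (r : R) x y (t : R) : ball p r x -> ball p r y ->
  0 <= t <= 1 -> ball p r (t *: (y - x) + x).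
Proof.
rewrite -!ball_normE /= => px py /andP[t0 t1].
have -> : p - (t *: (y - x) + x) = (1 - t) *: (p - x) + t *: (p - y).
  apply/rowP => i; rewrite !mxE; ring.
rewrite (le_lt_trans (ler_normD _ _))// !normrZ ger0_norm ?subr_ge0// (ger0_norm t0).
have [->|t0'] := eqVneq t 0; first by rewrite subr0 mul1r mul0r addr0.
have : t * `|p - y| < t * r by rewrite ltr_pM2l// lt_def t0' t0.
have : (1 - t) * `|p - x| <= (1 - t) * r by rewrite ler_wpM2l ?subr_ge0// ltW.
lra.
Qed.

Lemma taylor2_ball f p (r : R) x y : smooth_on (ball p r) f ->
  ball p r x -> ball p r y ->
  exists2 z, ball p r z &
    f y = f x + 'D_(y - x) f x + 2^-1 * qf f z (y - x).
Proof.
move=> sf px py.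
have [|b /andP[b0 b1] H] := taylor2 (x := x) (w := y - x) (ball_open p r) (sf 2).
  by move=> t; exact: ball_segment.
exists (b *: (y - x) + x); first by apply: ball_segment => //; rewrite !ltW.
by rewrite -H subrK.
Qed.

Lemma midpoint_arith (a b u C t : R) : 0 <= C * t -> a <= C * (2^-1 ^+ 2 * t) ->
  b <= C * (2^-1 ^+ 2 * t) -> u <= a + b -> 4^-1 * u <= C * t.
Proof. by rewrite expr2; lra. Qed.

(** Expand [f] at the midpoint towards both ends: the linear terms cancel, and each quadratic term
    is bounded by the square of half the distance. Applied to the coordinates of the displacement of
    the involution, this is what produces fixed points. *)
Lemma midpoint_near f (U : set E) p : smooth_on U f -> nbhs p U ->
  exists2 C, 0 < C & \forall r \near 0^'+, forall x y, ball p r x -> ball p r y ->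
    `|f (2^-1 *: (x + y)) - 2^-1 * (f x + f y)| <= C * `|x - y| ^+ 2.
Proof.
move=> sf pU; have [C C0 /filterI /(_ pU) /nbhs_ballP[r0 /= r00 H]] :=
  qf_near_bound sf (nbhs_singleton pU).
exists C => //; near=> r; move=> x y px py.
have rr0 : r <= r0 by near: r; exact: nbhs_right_le.
have sr : smooth_on (ball p r) f.
  by move=> k; apply: (ndiff_on_sub _ (sf k)) => z /(le_ball rr0)/H[].
pose c := 2^-1 *: (x + y).
have cE : c = 2^-1 *: (y - x) + x by apply/rowP => i; rewrite !mxE; field.
have pc : ball p r c.
  by rewrite cE; apply: ball_segment => //; apply/andP; split; lra.
have [z1 pz1 E1] := taylor2_ball sr pc px.
have [z2 pz2 E2] := taylor2_ball sr pc py.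
have -> : f c - 2^-1 * (f x + f y) =
   - (2^-1 * ('D_(x - c) f c + 'D_(y - c) f c)
     + 4^-1 * (qf f z1 (x - c) + qf f z2 (y - c))).
  move: E1 E2; move: (f c) (f x) (f y) ('D_(x - c) f c) ('D_(y - c) f c)
    (qf f z1 (x - c)) (qf f z2 (y - c)) => a a1 a2 b1 b2 c1 c2 -> ->.
  by field.
rewrite -deriveDv; last exact: (smooth_on_diff sr pc).
have -> : x - c + (y - c) = 0 by apply/rowP => i; rewrite /c !mxE; field.
have q0 : 0 <= 4^-1 :> R by rewrite invr_ge0.
rewrite derive0 mulr0 add0r normrN normrM (ger0_norm q0).
have n1 : `|x - c| = 2^-1 * `|x - y|.
  have -> : x - c = 2^-1 *: (x - y) by apply/rowP => i; rewrite /c !mxE; field.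
  by rewrite normrZ ger0_norm//; lra.
have n2 : `|y - c| = 2^-1 * `|x - y|.
  have -> : y - c = - (2^-1 *: (x - y)) by apply/rowP => i; rewrite /c !mxE; field.
  by rewrite normrN normrZ ger0_norm//; lra.
have [B1 _] := H _ (le_ball rr0 pz1); have [B2 _] := H _ (le_ball rr0 pz2).
have D1 := B1 (x - c); have D2 := B2 (y - c).
rewrite n1 exprMn in D1; rewrite n2 exprMn in D2.
apply: midpoint_arith D1 D2 (ler_normD _ _).
by rewrite mulr_ge0 ?sqr_ge0// ltW.
Unshelve. all: by end_near. Qed.

End QuadraticBounds.

Lemma small_geometric (R : realType) (a B q : R) : 0 <= q < 1 -> 0 <= B ->
  (forall k, `|a| <= B * q ^+ k) -> a = 0.
Proof.
move=> /andP[q0 q1] B0 H; apply/eqP; rewrite -normr_le0.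
have cv : geometric B q k @[k --> \oo] --> 0.
  by apply: cvg_geometric; rewrite ger0_norm.
by apply: (cvgr_to_ge cv); near=> k; exact: H.
Unshelve. all: by end_near. Qed.

(** * Expansion at a critical point along approximate lines *)

Section SecondOrderCritical.
Context (R : realType) (m : nat).
Local Notation E := 'rV[R]_m.

(** The point [u + p] need not lie on a line through [p]: an error [d * s] is allowed, because the
    form is continuous in point and vector jointly. This covers images under the involution and
    fixed points whose position is known only approximately. *)
Lemma critical_expansion (h : E -> R) (U : set E) (p v : E) (e : R) :
  open U -> smooth_on U h -> U p -> (forall w, 'D_w h p = 0) -> 0 < e ->
  exists2 d, 0 < d & forall s u, 0 < s < d -> `|u - s *: v| <= d * s ->
    `|h (u + p) - h p - 2^-1 * s ^+ 2 * qf h p v| <= e * s ^+ 2.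
Proof.
move=> oU sh Up cr e0.
have := qf_joint_continuous (v := v) sh Up.
move/cvgrPdist_lt/(_ _ e0) => /nbhs_ballP[r1 /= r10 H1].
have [r2 /= r20 H2] : nbhs_ball p U by apply/nbhs_ballP; exact: open_nbhs_nbhs.
pose r := Num.min r1 r2; have r0 : 0 < r by rewrite lt_min r10.
have rr1 : r <= r1 by rewrite ge_min lexx.
have rr2 : r <= r2 by rewrite ge_min lexx orbT.
have a0 : 0 < `|v| + r + 1 by rewrite ltr_wpDl// addr_ge0// ltW.
(* With [u = s *: w], the first bound keeps [w] within [r] of [v]. The second keeps [u] itself
   shorter than [r], its length being at most [s] times the sum of [d] and the norm of [v]. *)
pose d := Num.min (r / 2) (r / (`|v| + r + 1)).
have d0 : 0 < d by rewrite lt_min !divr_gt0.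
exists d => // s u /andP[s0 sd] us.
have dr : d < r by rewrite (@le_lt_trans _ _ (r / 2)) ?ge_min ?lexx//; lra.
have dr' : d * (`|v| + r + 1) <= r by rewrite -ler_pdivlMr// ge_min lexx orbT.
have un : `|u| < r.
  have : `|u| <= `|u - s *: v| + `|s *: v|.
    by rewrite -{1}(subrK (s *: v) u) ler_normD.
  rewrite normrZ gtr0_norm// => uu.
  have : s * (`|v| + d) < r.
    apply: lt_le_trans dr'; apply: ltr_pM => //; rewrite ?addr_ge0// ?ltW//.
    lra.
  lra.
have pu : ball p r (u + p).
  by rewrite -ball_normE /= opprD addrCA subrr addr0 normrN.
have sr : smooth_on (ball p r) h.
  by move=> k; apply: (ndiff_on_sub _ (sh k)) => z /(le_ball rr2)/H2.
have [z pz ->] := taylor2_ball sr (ballxx p r0) pu.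
rewrite addrK cr addr0 [h p + _]addrC addrK.
have [w uE] : exists w, u = s *: w.
  by exists (s^-1 *: u); rewrite scalerA divff ?scale1r// gt_eqF.
have vw : `|w - v| < r.
  apply: le_lt_trans dr; rewrite -(ler_pM2r s0); apply: le_trans us.
  by rewrite uE -scalerBr normrZ gtr0_norm// mulrC.
have : `|qf h z w - qf h p v| < e.
  rewrite distrC; apply: (H1 (z, w)); split => /=; first exact: (le_ball rr1).
  by apply: (le_ball rr1); rewrite -ball_normE /= distrC.
rewrite uE qfZ; move: (qf h z w) (qf h p v) => X Y /ltW XY.
have -> : 2^-1 * (s ^+ 2 * X) - 2^-1 * s ^+ 2 * Y = 2^-1 * s ^+ 2 * (X - Y).
  by ring.
have s2 : 0 <= s ^+ 2 by rewrite sqr_ge0.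
rewrite normrM ger0_norm; last by rewrite mulr_ge0//; lra.
have := ler_wpM2r s2 XY; have := mulr_ge0 s2 (normr_ge0 (X - Y)); lra.
Qed.

Lemma first_order (g : E -> E) (p v : E) (e : R) : differentiable g p -> 0 < e ->
  exists2 d, 0 < d & forall s, 0 < s < d ->
    `|g (s *: v + p) - g p - s *: 'D_v g p| <= e * s.
Proof.
move=> dg e0.
have /cvgrPdist_le/(_ _ e0) := @diff_derivable _ _ _ _ _ v dg.
rewrite near_withinE => /nbhs_ballP[d /= d0 H].
exists d => // s /andP[s0 sd].
have := H s; rewrite /ball /= sub0r normrN gtr0_norm// => /(_ sd).
rewrite gt_eqF// => /(_ isT).
rewrite -(ler_pM2r s0) => /le_trans H'.
rewrite distrC; apply: le_trans (H' _ (lexx _)).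
set X := g _ - g p.
have -> : s *: 'D_v g p - X = s *: ('D_v g p - s^-1 *: X).
  by rewrite scalerBr scalerA divff ?scale1r// gt_eqF.
by rewrite normrZ gtr0_norm// mulrC.
Qed.

End SecondOrderCritical.

(** * Functions invariant under a local involution *)

Section Involution.
Context (R : realType) (m : nat).
Local Notation E := 'rV[R]_m.
Context (p : E) (U : set E) (g : E -> E).
Hypotheses (oU : open U) (Up : U p) (sg : smooth_on U g).
Hypotheses (gp : g p = p) (gg : forall u, U u -> g (g u) = u).

Local Notation D := (fun u => g u - u).

Lemma displacement_smooth : smooth_on U D.
Proof.
move=> k; apply: (@ndiff_onD R E E k U g (fun u => - u)) => //.
have lin : linear (fun u : E => - u).
  by move=> a b c; rewrite opprD scalerN.
pose lM := GRing.isLinear.Build _ _ _ _ _ lin.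
pose l : {linear E -> E} := HB.pack (fun u : E => - u) lM.
by apply: (@ndiff_on_lin R E E k U l) => x; exact: opp_continuous.
Qed.

Lemma displacement_midpoint : exists2 C, 0 < C & \forall r \near 0^'+,
  forall x y, ball p r x -> ball p r y ->
    `|D (2^-1 *: (x + y)) - 2^-1 *: (D x + D y)| <= C * `|x - y| ^+ 2.
Proof.
have pU : nbhs p U by exact: open_nbhs_nbhs.
have H (i : 'I_m) := midpoint_near
  (fun k => ndiff_on_coord 0 i oU (displacement_smooth k)) pU.
pose C i := projT1 (cid2 (H i)).
have C0 i : 0 < C i by rewrite /C; case: cid2.
have CP i : \forall r \near 0^'+, forall x y, ball p r x -> ball p r y ->
    `|D (2^-1 *: (x + y)) 0 i - 2^-1 * (D x 0 i + D y 0 i)| <= C i * `|x - y| ^+ 2.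
  by rewrite /C; case: cid2.
exists (\sum_i C i + 1); first by rewrite ltr_wpDl// sumr_ge0// => i _; rewrite ltW.
have : \forall r \near (0 : R)^'+, forall i x y, ball p r x -> ball p r y ->
    `|D (2^-1 *: (x + y)) 0 i - 2^-1 * (D x 0 i + D y 0 i)| <= C i * `|x - y| ^+ 2.
  exact: (@filter_forall _ _ (fun i r => forall x y, ball p r x -> ball p r y ->
    `|D (2^-1 *: (x + y)) 0 i - 2^-1 * (D x 0 i + D y 0 i)| <= C i * `|x - y| ^+ 2)
    ((0 : R)^'+)).
apply: filterS => r Hr x y px py.
have t0 : 0 <= `|x - y| ^+ 2 by rewrite sqr_ge0.
have S0 : 0 <= \sum_i C i + 1 by rewrite addr_ge0// sumr_ge0// => i _; rewrite ltW.
apply: norm_coord_le => [|i]; first by rewrite mulr_ge0.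
have := Hr i x y px py; rewrite !mxE => /le_trans; apply.
rewrite ler_wpM2r// (bigD1 i)//= -addrA lerDl addr_ge0// sumr_ge0// => j _.
by rewrite ltW.
Qed.

Lemma displacement_small (e : R) : 0 < e -> \forall r \near 0^'+,
  forall u, ball p r u -> `|D u| <= e.
Proof.
move=> e0.
have := smooth_on_cont displacement_smooth Up.
move/cvgrPdist_le/(_ _ e0) => /nbhs_ballP[r0 /= r00 H].
near=> r; move=> u pu; rewrite -normrN -[X in `|X|]add0r.
have -> : 0 = D p by rewrite gp subrr.
apply: H; apply: le_ball pu; near: r; exact: nbhs_right_le.
Unshelve. all: by end_near. Qed.

Lemma subset_ball_near : \forall r \near (0 : R)^'+, ball p r `<=` U.
Proof.
have [r0 /= r00 H] : nbhs_ball p U by apply/nbhs_ballP; exact: open_nbhs_nbhs.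
near=> r; apply: subset_trans H; apply: le_ball.
by near: r; exact: nbhs_right_le.
Unshelve. all: by end_near. Qed.

Lemma ballN (c x : E) (r : R) : ball c r x <-> `|x - c| < r.
Proof. by rewrite -ball_normE /= distrC. Qed.

(* Minimise [|D z| + |z - c|]: at a minimiser w which is not fixed, the average
   of w and g w would do better, since its displacement is quadratically small. *)
Lemma fixed_point_near (rho : R) : 0 < rho -> \forall r \near 0^'+,
  forall c, ball p r c ->
  exists z, [/\ ball p rho z, g z = z & `|z - c| <= `|D c|].
Proof.
move=> rho0; have [C C0 HC] := displacement_midpoint.
have [r1 [[HC1 r1U] r1rho r10]] : exists r1, [/\
    (forall x y, ball p r1 x -> ball p r1 y ->
     `|D (2^-1 *: (x + y)) - 2^-1 *: (D x + D y)| <= C * `|x - y| ^+ 2) /\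
    ball p r1 `<=` U, r1 <= rho & 0 < r1].
  near (0 : R)^'+ => r1; exists r1; split => //; last first.
    by near: r1; exact: nbhs_right_le.
  split; near: r1; [exact: HC|exact: subset_ball_near].
(* The first bound keeps the averaged point inside the compact ball [K]; the second makes [C] times
   the squared displacement of the minimiser at most a quarter of its displacement. *)
pose e := Num.min (r1 / 4) (4 * C)^-1.
have e0 : 0 < e by rewrite lt_min !divr_gt0// invr_gt0 mulr_gt0.
have er : e <= r1 / 4 by rewrite ge_min lexx.
have eC : e * (4 * C) <= 1.
  by rewrite -ler_pdivlMr ?mulr_gt0// mul1r ge_min lexx orbT.
near=> r; move=> c pc.
have cD : `|D c| <= e by move: c pc; near: r; exact: displacement_small.
have rr : r <= r1 / 4 by near: r; apply: nbhs_right_le; rewrite divr_gt0.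
have cp : `|c - p| < r by apply/ballN.
pose K := closed_ball_ Num.norm c (r1 / 4).
have KP z : K z <-> `|z - c| <= r1 / 4 by rewrite /K /closed_ball_ /= distrC.
have KU z : K z -> ball p r1 z.
  move/KP => zc; apply/ballN; have := ler_normD (z - c) (c - p).
  by rewrite addrA subrK; lra.
have cK : compact K.
  apply: bounded_closed_compact; last exact: closed_closed_ball_.
  exists (`|c| + r1); split; first exact: num_real.
  move=> M HM z /KP zc; have := ler_normD (z - c) c.
  by rewrite subrK /=; lra.
have Kc : K c by apply/KP; rewrite subrr normr0 divr_ge0// ltW.
pose F z := `|D z| + `|z - c|.
have cF : {within K, continuous F}.
  apply: continuous_in_subspaceT => z; rewrite inE => /KU/r1U Uz.
  apply: (@continuousD R R E (fun z => `|D z|) (fun z => `|z - c|)).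
    apply: (@continuous_comp _ _ _ D Num.norm); last exact: norm_continuous.
    exact: smooth_on_cont displacement_smooth Uz.
  apply: (@continuous_comp E E R (fun z : E => z - c) Num.norm z); last exact: norm_continuous.
  by apply: continuousB; [exact: cvg_id|exact: cst_continuous].
have [w] := EVT_min_rV (ex_intro _ c Kc) cK cF.
rewrite inE => Kw Hw.
have Fw : `|D w| + `|w - c| <= `|D c|.
  have := Hw c; rewrite inE => /(_ Kc).
  by rewrite /F subrr normr0 addr0.
have nD := normr_ge0 (D w); have nw := normr_ge0 (w - c).
exists w; split; [exact: le_ball (KU _ Kw)| |lra].
apply/eqP; rewrite -subr_eq0; apply/negPn/negP => Dw0.
have Dw : 0 < `|D w| by rewrite normr_gt0.
have pw := KU _ Kw; have Uw := r1U _ pw.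
have pgw : ball p r1 (g w).
  apply/ballN; have := ler_normD (D w) (w - c); rewrite addrA subrK => H1.
  have := ler_normD (g w - c) (c - p); rewrite addrA subrK; lra.
pose w' := 2^-1 *: (w + g w).
have w'w : w' - w = 2^-1 *: D w by apply/rowP => i; rewrite /w' !mxE; field.
have nw'w : `|w' - w| = 2^-1 * `|D w| by rewrite w'w normrZ ger0_norm//; lra.
have E0 : g w - w + (w - g w) = 0 by apply/rowP => i; rewrite !mxE; ring.
(* [g] exchanges [w] and [g w], so their displacements are opposite and average to 0: only the
   quadratic error of the midpoint estimate is left. *)
have := HC1 _ _ pw pgw.
rewrite /= gg// E0 scaler0 subr0 -/w' -normrN opprB -[`|w - g w|]normrN opprB => Dw'.
rewrite -normrN opprB in Dw'.
have w'c : `|w' - c| <= 2^-1 * `|D w| + `|w - c|.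
  by rewrite -nw'w; have := ler_normD (w' - w) (w - c); rewrite addrA subrK.
have Kw' : K w' by apply/KP; lra.
have := Hw w'; rewrite inE => /(_ Kw'); rewrite /F.
have : C * `|D w| ^+ 2 <= 4^-1 * `|D w|.
  rewrite expr2 mulrA ler_wpM2r//.
  have : C * `|D w| <= C * e by rewrite (ler_wpM2l (ltW C0))//; lra.
  lra.
lra.
Unshelve. all: by end_near. Qed.

End Involution.

(** * Constancy of an invariant function on nearby fixed points *)

Section InvariantFunction.
Context (R : realType) (m : nat).
Local Notation E := 'rV[R]_m.
Context (p : E) (U : set E) (g : E -> E) (h : E -> R) (C0 : R).
Hypotheses (oU : open U) (Up : U p) (sg : smooth_on U g) (sh : smooth_on U h).
Hypotheses (gp : g p = p) (gg : forall u, U u -> g (g u) = u).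
Hypothesis hg : forall u, U u -> h (g u) = h u.
Hypothesis crit : forall u, U u -> g u = u -> forall v, 'D_v h u = 0.
Hypothesis C00 : 0 < C0.
Hypothesis loj : forall u, U u -> g u <> u ->
  exists i, `|g u - u| <= C0 * `|'D_(delta_mx 0 i) h u|.

(* Between two nearby fixed points there is one close to their midpoint, while
   [h] varies quadratically between them: subdivide. *)
Lemma fixed_point_level : \forall r \near 0^'+,
  forall u, ball p r u -> g u = u -> h u = h p.
Proof.
have [C Cpos HC] := displacement_midpoint oU Up sg.
have [B Bpos HB] := qf_near_bound sh Up.
have /nbhs_ballP[r0 /= r00 H0] := HB.
have [r1 [r10 r1U HBr HCr]] : exists r1, [/\ 0 < r1, ball p r1 `<=` U,
    (forall y, ball p r1 y -> forall w, `|qf h y w| <= B * `|w| ^+ 2) &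
    (forall x y, ball p r1 x -> ball p r1 y -> `|g (2^-1 *: (x + y)) -
      2^-1 *: (x + y) - 2^-1 *: (g x - x + (g y - y))| <= C * `|x - y| ^+ 2)].
  near (0 : R)^'+ => r1; exists r1; split => //.
  - by near: r1; exact: subset_ball_near.
  - by move=> y py; apply: H0; apply: le_ball py; near: r1; exact: nbhs_right_le.
  - by near: r1; exact: HC.
have [r2 [r20 r21 F2]] : exists r2, [/\ 0 < r2, r2 <= r1 &
   forall c, ball p r2 c -> exists z, [/\ ball p r1 z, g z = z &
     `|z - c| <= `|g c - c|]].
  near (0 : R)^'+ => r2; exists r2; split => //.
  - by near: r2; exact: nbhs_right_le.
  - by near: r2; exact: (fixed_point_near oU Up sg gp gg r10).
(* This bound puts a fixed point [z] within a tenth of the distance of [x] and [y] from their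
   midpoint, hence within 3/5 of that distance from both. The two halves then contribute the factor
   2 * (3/5)^2 = 18/25, which is less than 1. *)
pose rho := Num.min r2 (20 * C)^-1.
have rho0 : 0 < rho by rewrite lt_min r20 invr_gt0 mulr_gt0.
have rho2 : rho <= r2 by rewrite ge_min lexx.
have rhoC : rho * (20 * C) <= 1.
  by rewrite -ler_pdivlMr ?mulr_gt0// mul1r ge_min lexx orbT.
have sr1 : smooth_on (ball p r1) h by exact: smooth_on_sub sh.
have nrm (a b c : E) : `|a - c| <= `|a - b| + `|b - c|.
  by have := ler_normD (a - b) (b - c); rewrite addrA subrK.
have q0 : 0 <= 18 / 25 :> R by lra.
have scale (s t : R) k : 0 <= s -> s <= 3 / 5 * t ->
    B * s ^+ 2 * (18 / 25) ^+ k <= B * (9 / 25 * t ^+ 2) * (18 / 25) ^+ k.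
  move=> s0 st; apply: ler_wpM2r; first exact: exprn_ge0.
  by apply: (ler_wpM2l (ltW Bpos)); nra.
(* The factor 5/2 makes the condition hereditary: after passing to [z] at most 3/5 + 5/2 * 3/5 =
   21/10 of the old distance is required. *)
have claim k x y : g x = x -> g y = y ->
    `|x - p| + 5 / 2 * `|x - y| < rho -> `|y - p| + 5 / 2 * `|x - y| < rho ->
    `|h x - h y| <= B * `|x - y| ^+ 2 * (18 / 25) ^+ k.
  elim: k x y => [|k IH] x y gx gy xr yr.
    have nxy := normr_ge0 (x - y).
    have px : ball p r1 x by apply/ballN; lra.
    have py : ball p r1 y by apply/ballN; lra.
    have [z pz ->] := taylor2_ball sr1 py px.
    rewrite (crit (r1U _ py) gy) addr0 [h y + _]addrC addrK expr0 mulr1.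
    rewrite normrM ger0_norm; last by lra.
    have := HBr _ pz (x - y).
    have : 0 <= B * `|x - y| ^+ 2 by rewrite mulr_ge0 ?sqr_ge0// ltW.
    move: (qf _ _ _) => a; have := normr_ge0 a; lra.
  have nxy := normr_ge0 (x - y).
  have xy : `|x - y| < 2 * rho / 5.
    have := normr_ge0 (x - p); lra.
  pose c := 2^-1 *: (x + y).
  have xc : `|x - c| = 2^-1 * `|x - y|.
    have -> : x - c = 2^-1 *: (x - y) by apply/rowP => i; rewrite /c !mxE; field.
    by rewrite normrZ ger0_norm//; lra.
  have yc : `|c - y| = 2^-1 * `|x - y|.
    have -> : c - y = 2^-1 *: (x - y) by apply/rowP => i; rewrite /c !mxE; field.
    by rewrite normrZ ger0_norm//; lra.
  have px : ball p r1 x by apply/ballN; lra.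
  have py : ball p r1 y by apply/ballN; lra.
  have pc : ball p r2 c.
    apply/ballN; have := nrm c x p; rewrite [`|c - x|]distrC xc; lra.
  have [z [pz gz zc]] := F2 _ pc.
  have zc' : `|z - c| <= 10^-1 * `|x - y|.
    apply: (le_trans zc); have := HCr _ _ px py.
    rewrite gx gy !subrr addr0 scaler0 subr0 -/c => /le_trans; apply.
    rewrite expr2 mulrA ler_wpM2r//.
    have : C * `|x - y| <= C * (2 * rho / 5) by rewrite (ler_wpM2l (ltW Cpos))// ltW.
    lra.
  have xz : `|x - z| <= 3 / 5 * `|x - y|.
    by have := nrm x c z; rewrite xc [`|c - z|]distrC; lra.
  have zy : `|z - y| <= 3 / 5 * `|x - y|.
    by have := nrm z c y; rewrite yc; lra.
  have zp : `|z - p| <= `|x - p| + 3 / 5 * `|x - y|.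
    by have := nrm z x p; rewrite [`|z - x|]distrC; lra.
  have H1 := IH x z gx gz _ _; have H2 := IH z y gz gy _ _.
  have {}H1 : `|h x - h z| <= B * (9 / 25 * `|x - y| ^+ 2) * (18 / 25) ^+ k.
    by apply: le_trans (H1 _ _) _; [lra|lra|exact: scale].
  have {}H2 : `|h z - h y| <= B * (9 / 25 * `|x - y| ^+ 2) * (18 / 25) ^+ k.
    by apply: le_trans (H2 _ _) _; [lra|lra|exact: scale].
  have := ler_normD (h x - h z) (h z - h y); rewrite addrA subrK => /le_trans; apply.
  rewrite (exprS (18 / 25)); move: H1 H2; move: ((18 / 25) ^+ k) (`|h x - h z|) (`|h z - h y|) => a b c' H1 H2.
  have -> : B * `|x - y| ^+ 2 * (18 / 25 * a) =
     B * (9 / 25 * `|x - y| ^+ 2) * a + B * (9 / 25 * `|x - y| ^+ 2) * a by field.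
  exact: lerD.
near=> r; move=> u pu gu; apply/eqP; rewrite -subr_eq0; apply/eqP.
have up : `|u - p| < r by apply/ballN.
have rr : r <= rho / 4 by near: r; apply: nbhs_right_le; rewrite divr_gt0.
have nu := normr_ge0 (u - p).
apply: (@small_geometric _ _ (B * `|u - p| ^+ 2) (18 / 25)).
- by apply/andP; split; lra.
- by rewrite mulr_ge0 ?sqr_ge0// ltW.
- by move=> k; apply: claim => //; [lra|rewrite subrr normr0; lra].
Unshelve. all: by end_near. Qed.

End InvariantFunction.

(** * The Hessian under the differential of the involution *)

Section InvariantFunction2.
Context (R : realType) (m : nat).
Local Notation E := 'rV[R]_m.
Context (p : E) (U : set E) (g : E -> E) (h : E -> R) (C0 : R).
Hypotheses (oU : open U) (Up : U p) (sg : smooth_on U g) (sh : smooth_on U h).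
Hypotheses (gp : g p = p) (gg : forall u, U u -> g (g u) = u).
Hypothesis hg : forall u, U u -> h (g u) = h u.
Hypothesis crit : forall u, U u -> g u = u -> forall v, 'D_v h u = 0.
Hypothesis C00 : 0 < C0.
Hypothesis loj : forall u, U u -> g u <> u ->
  exists i, `|g u - u| <= C0 * `|'D_(delta_mx 0 i) h u|.

Local Notation G := (fun v => 'D_v g p).

Lemma small_eq0 (a : R) : (forall e, 0 < e -> `|a| <= e) -> a = 0.
Proof.
move=> H; apply/eqP; rewrite -normr_le0; apply/ler_addgt0Pr => e e0.
by rewrite add0r; exact: H.
Qed.

Lemma differential_involutive v : G (G v) = v.
Proof.
have gU : U (g p) by rewrite gp.
have dg := smooth_on_diff sg Up.
have : 'D_v (g \o g) p = v.
  rewrite -[RHS](derive_id p v); apply: near_eq_derive.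
  by near=> u; apply: gg; near: u; exact: open_nbhs_nbhs.
rewrite derive_comp//; first by rewrite gp.
by rewrite gp.
Unshelve. all: by end_near. Qed.

(** [h] takes the same values at [s *: v + p] and at its image under [g]. Seen from [p] the two
    curves are tangent to [v] and [G v], so the second order terms must agree as [s] tends to 0. *)
Lemma qf_differential v : qf h p (G v) = qf h p v.
Proof.
apply/eqP; rewrite -subr_eq0; apply/eqP/small_eq0 => e e0.
have e4 : 0 < e / 4 by rewrite divr_gt0.
have [d1 d10 H1] := critical_expansion (G v) oU sh Up (crit Up gp) e4.
have [d2 d20 H2] := critical_expansion v oU sh Up (crit Up gp) e4.
have [d3 d30 H3] := first_order v (smooth_on_diff sg Up) d10.
have [d4 d40 HU] : exists2 d, 0 < d & forall s, 0 < s < d -> U (s *: v + p).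
  have H0 : (fun s : R => s *: v + p) @ (0 : R) --> 0 *: v + p.
    by apply: cvgD; [exact: scalel_continuous|exact: cvg_cst].
  rewrite scale0r add0r in H0.
  have /H0 : nbhs p U by exact: open_nbhs_nbhs.
  move=> /nbhs_ballP[d d0 H]; exists d => // s /andP[s0 sd]; apply: H.
  by rewrite /ball/= sub0r normrN gtr0_norm.
pose s := Num.min (Num.min d1 d2) (Num.min d3 d4) / 2.
have M0 : 0 < Num.min (Num.min d1 d2) (Num.min d3 d4) by rewrite !lt_min d10 d20 d30.
have s0 : 0 < s by rewrite divr_gt0.
have sM : s < Num.min (Num.min d1 d2) (Num.min d3 d4) by rewrite /s; lra.
move: sM; rewrite !lt_min => /andP[/andP[sd1 sd2] /andP[sd3 sd4]].
have := H1 s (g (s *: v + p) - p); rewrite s0 sd1 => /(_ isT).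
have := H3 s; rewrite s0 sd3 gp => /(_ isT) H /(_ H){H}.
rewrite subrK hg; last by apply: HU; rewrite s0.
have := H2 s (s *: v); rewrite s0 sd2 => /(_ isT).
rewrite subrr normr0 => /(_ (mulr_ge0 (ltW d20) (ltW s0))).
have s2 : 0 < s ^+ 2 by rewrite exprn_gt0.
move: (h _ - h p) (qf h p v) (qf h p (G v)) => x a b Ha Hb.
rewrite -(ler_pM2r s2).
have -> : `|b - a| * s ^+ 2 = 2 * `|(x - 2^-1 * s ^+ 2 * a) - (x - 2^-1 * s ^+ 2 * b)|.
  have -> : x - 2^-1 * s ^+ 2 * a - (x - 2^-1 * s ^+ 2 * b) =
     (b - a) * (2^-1 * s ^+ 2) by ring.
  rewrite normrM [X in _ = _ * (_ * X)]ger0_norm; last by rewrite mulr_ge0 ?ltW//; lra.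
  by field.
have := ler_normB (x - 2^-1 * s ^+ 2 * a) (x - 2^-1 * s ^+ 2 * b); lra.
Qed.

(** [g] moves [s *: v + p] by [o(s)] only, so a true fixed point lies at distance [o(s)] from it.
    There [h] has the value [h p], which leaves no second order term. *)
Lemma qf_fixed v : G v = v -> qf h p v = 0.
Proof.
move=> Gv; apply: small_eq0 => e e0.
have e2 : 0 < e / 2 by rewrite divr_gt0.
have [d1 d10 H1] := critical_expansion v oU sh Up (crit Up gp) e2.
have [d3 d30 H3] := first_order v (smooth_on_diff sg Up) d10.
have [r [r0 Hr]] : exists r, 0 < r /\ forall u, ball p r u -> g u = u -> h u = h p.
  near (0 : R)^'+ => r; exists r; split => //; near: r.
  exact: (fixed_point_level oU Up sg sh gp gg crit).
have [r1 [r10 Hr1]] : exists r1, 0 < r1 /\ forall c, ball p r1 c ->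
    exists z, [/\ ball p r z, g z = z & `|z - c| <= `|g c - c|].
  near (0 : R)^'+ => r1; exists r1; split => //; near: r1.
  exact: (fixed_point_near oU Up sg gp gg r0).
pose b := r1 / (`|v| + 1).
have b0 : 0 < b by rewrite divr_gt0// ltr_wpDl.
pose s := Num.min (Num.min d1 b) d3 / 2.
have M0 : 0 < Num.min (Num.min d1 b) d3 by rewrite !lt_min d10 b0 d30.
have s0 : 0 < s by rewrite divr_gt0.
have sM : s < Num.min (Num.min d1 b) d3 by rewrite /s; lra.
move: sM; rewrite !lt_min => /andP[/andP[sd1 sb] sd3].
have pc : ball p r1 (s *: v + p).
  apply/ballN; rewrite addrK normrZ gtr0_norm//.
  move: sb; rewrite /b ltr_pdivlMr ?ltr_wpDl// => sb.
  by apply: le_lt_trans sb; rewrite ler_pM2l// lerDl.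
have [z [pz gz zc]] := Hr1 _ pc.
have := H1 s (z - p); rewrite s0 sd1 => /(_ isT).
rewrite subrK (Hr _ pz gz) subrr sub0r.
have dz : `|z - p - s *: v| <= d1 * s.
  have := H3 s; rewrite s0 sd3 gp Gv => /(_ isT); apply: le_trans.
  have eqv (a : E) : a - (s *: v + p) = a - p - s *: v by rewrite opprD addrA addrAC.
  by rewrite -!eqv.
move=> /(_ dz).
have s2 : 0 < s ^+ 2 by rewrite exprn_gt0.
rewrite normrN normrM ger0_norm; last by rewrite mulr_ge0 ?ltW//; lra.
rewrite -[_ <= e](ler_pM2r s2); lra.
Unshelve. all: by end_near. Qed.

(** Split [v] into an invariant part [a] and an anti-invariant part [w]. The form agrees on
    [v = a + w] and [G v = a - w] and vanishes on [a], so by the parallelogram law its value on [w]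
    is its value on [v]. *)
Lemma negative_direction v : qf h p v < 0 ->
  exists2 w, G w = - w & qf h p w < 0.
Proof.
move=> v0; have dg := smooth_on_diff sg Up.
pose a := 2^-1 *: (v + G v); pose w := 2^-1 *: (v - G v).
have Ga : G a = a.
  rewrite /a (deriveZv _ _ dg) (deriveDv _ _ dg) differential_involutive.
  by congr (_ *: _); rewrite addrC.
have Gw : G w = - w.
  rewrite /w (deriveZv _ _ dg) -[- G v](scaleN1r (G v)) (deriveDv _ _ dg).
  rewrite (deriveZv _ _ dg) differential_involutive !scaleN1r -scalerN.
  by congr (_ *: _); rewrite opprB.
exists w => //.
have vE : v = a + w by apply/rowP => i; rewrite /a /w !mxE; field.
have GvE : G v = a - w by apply/rowP => i; rewrite /a /w !mxE; field.
have := qf_parallelogram h p a w; rewrite -vE -GvE qf_differential.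
rewrite (qf_fixed Ga); lra.
Qed.

Lemma psd_lower_bound (x1 x2 a b : R) :
  0 <= x1 -> `|x2 - x1| <= a -> a <= b -> - b <= x2.
Proof. by rewrite ler_norml => x10 /andP[]; lra. Qed.

Lemma descent_contradiction (x a b c hu hu' hp : R) :
  c <= - x -> a <= x -> - x <= b -> hu' = hu + c + 2^-1 * a -> hu < hp ->
  hu' = hp + 0 + 2^-1 * b -> False.
Proof. lra. Qed.

Lemma delta_norm (i : 'I_m) : `|delta_mx 0 i : E| <= 1.
Proof.
apply: norm_coord_le => // j; rewrite mxE eqxx /=; case: eqP => _.
  by rewrite normr1.
by rewrite normr0.
Qed.

(* If h had smaller values near p, a step of proportional length in a
   descending coordinate direction would beat the lower bound given by the
   semi-definite quadratic form at p. *)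
Lemma local_minimum : (forall v, 0 <= qf h p v) -> \forall u \near p, h p <= h u.
Proof.
move=> psd.
have [C Cpos HC] := qf_near_bound sh Up.
(* By [loj] some partial derivative at [u] is at least [K * t] in absolute value, [t] being the
   distance from [u] to a nearby fixed point [z]. A step of length [eta * t] gains [eta * K * t^2]
   and loses at most half of it to curvature. The tolerance [e] makes the possible drop below [h z],
   over the distance [(1 + eta) * t], equal to the other half, so the two estimates force
   [h p <= h u]. *)
pose K := C0^-1; have Kpos : 0 < K by rewrite invr_gt0.
pose eta := K / C; have etapos : 0 < eta by rewrite divr_gt0.
pose e := eta * K / (1 + eta) ^+ 2.
have eta1 : 0 < (1 + eta) ^+ 2 by rewrite exprn_gt0// addr_gt0.
have epos : 0 < e by rewrite divr_gt0// mulr_gt0.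
have /nbhs_ballP[r1 /= r10 H1] := HC.
have /nbhs_ballP[r2 /= r20 H2] := qf_near sh Up epos.
have [r [r0 Hr rU rr1 rr2]] : exists r, [/\ 0 < r,
    (forall u, ball p r u -> g u = u -> h u = h p), ball p r `<=` U, r <= r1 & r <= r2].
  near (0 : R)^'+ => r; exists r; split => //; near: r.
  - exact: (fixed_point_level oU Up sg sh gp gg crit).
  - exact: subset_ball_near.
  - exact: nbhs_right_le.
  - exact: nbhs_right_le.
pose rho := r / (2 + 2 * eta).
have rho0 : 0 < rho by rewrite divr_gt0// addr_gt0// mulr_gt0.
have rhoE : rho * (2 + 2 * eta) = r.
  by rewrite /rho divfK// gt_eqF// addr_gt0// mulr_gt0.
have [r3 [r30 r3rho Hr3]] : exists r3, [/\ 0 < r3, r3 <= rho & forall c, ball p r3 c ->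
    exists z, [/\ ball p rho z, g z = z & `|z - c| <= `|g c - c|]].
  near (0 : R)^'+ => r3; exists r3; split => //; near: r3.
    exact: nbhs_right_le.
  exact: (fixed_point_near oU Up sg gp gg rho0).
have sr : smooth_on (ball p r) h by exact: smooth_on_sub sh.
apply/nbhs_ballP; exists r3 => //= u pu; rewrite leNgt; apply/negP => hu.
have eta_rho : 0 < eta * rho by rewrite mulr_gt0.
have up : `|u - p| < r3 by apply/ballN.
have pru : ball p r u by apply/ballN; lra.
have Uu := rU _ pru.
have gu : g u <> u by move=> gu; move: hu; rewrite (Hr _ pru gu) ltxx.
have [z [pz gz zu]] := Hr3 _ pu.
have zp : `|z - p| < rho by apply/ballN.
have prz : ball p r z by apply/ballN; lra.
have [i Hi] := loj Uu gu.
pose t := `|z - u|; pose b := 'D_(delta_mx 0 i) h u.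
have t0 : 0 <= t by exact: normr_ge0.
have tb : K * t <= `|b|.
  rewrite -(ler_pM2l C00) mulrA mulfV ?gt_eqF// mul1r.
  exact: le_trans zu Hi.
have t2 : t < 2 * rho.
  have := ler_normD (z - p) (p - u); rewrite addrA subrK [`|p - u|]distrC -/t; lra.
pose c := - (eta * t * Num.sg b); pose u' := c *: delta_mx 0 i + u.
have nsg : `|Num.sg b| <= 1.
  by rewrite normr_sg; case: (b == 0).
have et0 : 0 <= eta * t by rewrite mulr_ge0// ltW.
have cn : `|c| <= eta * t.
  by rewrite normrN normrM (ger0_norm et0) ler_piMr.
have u'u : `|u' - u| <= eta * t.
  by rewrite addrK normrZ -[X in _ <= X]mulr1 ler_pM// delta_norm.
have et : eta * t < 2 * (eta * rho).
  by rewrite mulrCA ltr_pM2l.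
have pru' : ball p r u'.
  apply/ballN; have := ler_normD (u' - u) (u - p); rewrite addrA subrK; lra.
have [y py E1] := taylor2_ball sr pru pru'.
have [y' py' E2] := taylor2_ball sr prz pru'.
have cb : c * b = - (eta * t * `|b|) by rewrite /c normrEsg; ring.
have D1 : 'D_(u' - u) h u <= - (eta * t * (K * t)).
  rewrite addrK deriveZv; last exact: (smooth_on_diff sr).
  rewrite -[_ *: _]/(c * b) cb lerN2 ler_wpM2l// mulr_ge0// ltW.
have Q1 : qf h y (u' - u) <= C * (eta * t) ^+ 2.
  have := H1 _ (le_ball rr1 py) (u' - u); move/(le_trans (ler_norm _)).
  move/le_trans; apply; rewrite (ler_wpM2l (ltW Cpos))//.
  by rewrite ler_sqr ?nnegrE.
have Q2 : - (e * ((1 + eta) * t) ^+ 2) <= qf h y' (u' - z).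
  have := H2 _ (le_ball rr2 py') (u' - z); have := psd (u' - z).
  have : e * `|u' - z| ^+ 2 <= e * ((1 + eta) * t) ^+ 2.
    have e1t : 0 <= (1 + eta) * t by rewrite mulr_ge0// addr_ge0// ltW.
    rewrite (ler_wpM2l (ltW epos))// ler_sqr ?nnegrE//.
    have := ler_normD (u' - u) (u - z); rewrite addrA subrK [`|u - z|]distrC -/t.
    by move/le_trans; apply; rewrite mulrDl mul1r addrC lerD2l.
  by move=> H3 H4 H5; exact: psd_lower_bound H4 H5 H3.
have hz : h z = h p by exact: Hr.
have eE : e * ((1 + eta) * t) ^+ 2 = eta * K * t ^+ 2.
  by rewrite exprMn mulrA /e divfK// gt_eqF.
have CE : C * (eta * t) ^+ 2 = eta * K * t ^+ 2.
  have CK : C * eta = K by rewrite /eta mulrC divfK// gt_eqF.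
  have -> : C * (eta * t) ^+ 2 = C * eta * eta * t ^+ 2 by ring.
  by rewrite CK [K * _]mulrC.
move: E2; rewrite (crit (rU _ prz) gz) hz; rewrite eE in Q2; rewrite CE in Q1.
move: D1 Q1 Q2 E1 hu.
have -> : eta * t * (K * t) = eta * K * t ^+ 2 by ring.
exact: descent_contradiction.
Unshelve. all: by end_near. Qed.

(* The anti-invariant w replaces the fact that the index of a critical point is
   even: an isolated negative line cannot occur, as g exchanges its two ends. *)
Lemma minimum_or_negative : (\forall u \near p, h p <= h u) \/
  exists2 w, G w = - w & qf h p w < 0.
Proof.
have [psd|/existsNP[v /negP]] := pselect (forall v, 0 <= qf h p v).
  by left; exact: local_minimum.
by rewrite -ltNge => /negative_direction; right.
Qed.

End InvariantFunction2.

(** * Charts and smooth maps *)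

Section Charts.
Context (R : realType) (m : nat).
Implicit Types M N P : manifold R m.

Lemma open_continuous_preimage (S T : topologicalType) (A : set S) (V : set T)
    (f : S -> T) :
  open A -> (forall x, A x -> {for x, continuous f}) -> open V ->
  open (A `&` f @^-1` V).
Proof.
move=> oA cf oV; rewrite openE => x [Ax Vx]; apply: filterI.
  exact: open_nbhs_nbhs.
by apply: (cf x Ax); exact: open_nbhs_nbhs.
Qed.

Lemma within_continuousE (S T : topologicalType) (A : set S) (f : S -> T) :
  open A -> {within A, continuous f} <-> (forall x, A x -> {for x, continuous f}).
Proof.
move=> oA; rewrite continuous_open_subspace//; split => H x.
  by move=> Ax; apply: H; rewrite inE.
by rewrite inE; exact: H.
Qed.

Section OneChart.
Context (T : topologicalType) (c : chart R m T).
Hypothesis cc : is_chart c.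

Lemma chart_dom_open : open (chart_dom c). Proof. by case: cc. Qed.
Lemma chart_img_open : open (chart_img c). Proof. by case: cc. Qed.
Lemma chartK x : chart_dom c x -> chart_inv c (c x) = x.
Proof. by case: cc => _ _ + _ _; exact. Qed.
Lemma chart_cont x : chart_dom c x -> {for x, continuous c}.
Proof. by case: cc => od _ _ /(within_continuousE _ od) + _; exact. Qed.
Lemma chart_inv_cont u : chart_img c u -> {for u, continuous (chart_inv c)}.
Proof. by case: cc => _ oi _ _; rewrite within_continuousE//; exact. Qed.
Lemma chart_imgP x : chart_dom c x -> chart_img c (c x).
Proof. by move=> dx; exists x. Qed.
Lemma chart_inv_dom u : chart_img c u -> chart_dom c (chart_inv c u).
Proof. by case=> x dx <-; rewrite chartK. Qed.
Lemma chart_invK u : chart_img c u -> c (chart_inv c u) = u.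
Proof. by case=> x dx <-; rewrite chartK. Qed.

Lemma chart_imageE (A : set T) :
  c @` (chart_dom c `&` A) = chart_img c `&` chart_inv c @^-1` A.
Proof.
apply/seteqP; split => [_ [x [dx Ax] <-]|u [cu Au]].
  by split; [exact: chart_imgP|rewrite /= chartK].
by exists (chart_inv c u); [split => //; exact: chart_inv_dom|exact: chart_invK].
Qed.

Lemma chart_image_open (A : set T) : open A -> open (c @` (chart_dom c `&` A)).
Proof.
move=> oA; rewrite chart_imageE; apply: open_continuous_preimage => //.
  exact: chart_img_open.
exact: chart_inv_cont.
Qed.

Lemma chart_dom_near x : chart_dom c x -> \forall u \near c x,
  chart_img c u.
Proof. by move=> dx; apply: open_nbhs_nbhs; split; [exact: chart_img_open|exact: chart_imgP]. Qed.

Lemma chart_inv_near x (A : set T) : chart_dom c x -> nbhs x A ->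
  \forall u \near c x, A (chart_inv c u).
Proof.
move=> dx nA; have := @chart_inv_cont (c x) (chart_imgP dx).
by rewrite /prop_for /continuous_at chartK//; exact.
Qed.

End OneChart.

Lemma smooth_map_cont M N (A : set M) (f : M -> N) x : open A ->
  smooth_map A f -> A x -> {for x, continuous f}.
Proof. by move=> oA [+ _]; rewrite within_continuousE//; exact. Qed.

Lemma smooth_map_preimage_open M N (A : set M) (V : set N) (f : M -> N) :
  open A -> smooth_map A f -> open V -> open (A `&` f @^-1` V).
Proof.
by move=> oA sf; apply: open_continuous_preimage => // x; exact: smooth_map_cont.
Qed.

Lemma smooth_map_rep M N (A : set M) (f : M -> N) c c' x :
  smooth_map A f -> mf_atlas c -> mf_atlas c' -> A x -> chart_dom c x ->
  chart_dom c' (f x) -> differentiable (local_rep c c' f) (c x).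
Proof.
move=> [_ /(_ c c') +] ac ac' => /(_ ac ac') sf Ax dx dfx.
by apply: (smooth_on_diff sf); exists x.
Qed.

Lemma smooth_map_sub M N (A B : set M) (f : M -> N) : open A -> open B ->
  A `<=` B -> smooth_map B f -> smooth_map A f.
Proof.
move=> oA oB AB sf; split.
  by rewrite within_continuousE// => x /AB; exact: smooth_map_cont.
move=> c c' ac ac'; apply: smooth_on_sub (sf.2 _ _ ac ac').
by move=> _ [x [[dx Ax] dfx] <-]; exists x => //; split => //; split => //; exact: AB.
Qed.

(** A map defined by cases may be replaced near each point by the formula valid there; the maps
    patched from bands are treated in this way. *)
Lemma smooth_map_near M N (A : set M) (f : M -> N) : open A ->
  (forall x, A x -> exists B (g : M -> N),
     [/\ open B, B x, smooth_map B g & forall y, B y -> f y = g y]) ->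
  smooth_map A f.
Proof.
move=> oA H; split.
  rewrite within_continuousE// => x Ax; have [B [g [oB Bx sg fg]]] := H x Ax.
  have cg := smooth_map_cont oB sg Bx.
  have E : \near x, g x = f x.
    by near=> y; apply/esym/fg; near: y; exact: open_nbhs_nbhs.
  rewrite /prop_for /continuous_at (fg x Bx).
  exact: cvg_trans (near_eq_cvg E) cg.
move=> c c' ac ac' k; apply: ndiff_on_point => _ [x [[dx Ax] dfx] <-].
have [B [g [oB Bx sg fg]]] := H x Ax.
have cc := mf_is_chart ac.
have : ndiff_on k [set c x] (local_rep c c' g).
  apply: ndiff_on_sub (sg.2 _ _ ac ac' k) => _ ->.
  by exists x => //; split => //; rewrite /= -fg.
apply: ndiff_on_near => _ ->.
have := chart_inv_near cc dx (open_nbhs_nbhs (conj oB Bx)).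
by apply: filterS => u Bu; rewrite /local_rep /= fg.
Unshelve. all: by end_near. Qed.

Lemma local_rep_comp_near M N P (A : set M) (f : M -> N) (g : N -> P)
    (c : chart R m M) (c' : chart R m N) (c'' : chart R m P) x :
  open A -> smooth_map A f -> mf_atlas c -> mf_atlas c' -> A x ->
  chart_dom c x -> chart_dom c' (f x) ->
  \forall u \near c x,
    local_rep c c'' (g \o f) u = (local_rep c' c'' g \o local_rep c c' f) u.
Proof.
move=> oA sf ac ac' Ax dx dfx; have cc := mf_is_chart ac.
have cc' := mf_is_chart ac'.
have oV : open (A `&` f @^-1` chart_dom c').
  by apply: smooth_map_preimage_open => //; exact: chart_dom_open.
have := chart_inv_near cc dx (open_nbhs_nbhs (conj oV (conj Ax dfx))).
by apply: filterS => u [_ dfu]; rewrite /local_rep /= (chartK cc').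
Qed.

(** The chart [c'] in the middle depends on the point, hence the reduction to single points; near
    [c x] the representative of the composite factors through [c']. *)
Lemma smooth_map_comp M N P (A : set M) (B : set N) (f : M -> N) (g : N -> P) :
  open A -> open B -> (forall x, A x -> B (f x)) ->
  smooth_map A f -> smooth_map B g -> smooth_map A (g \o f).
Proof.
move=> oA oB AB sf sg; split.
  rewrite within_continuousE// => x Ax; apply: continuous_comp.
    exact: smooth_map_cont sf Ax.
  exact: smooth_map_cont sg (AB _ Ax).
move=> c c'' ac ac'' k; apply: ndiff_on_point => _ [x [[dx Ax] dgfx] <-].
have [c' ac' dfx] := mf_cover (f x).
have [cc cc' cc''] := And3 (mf_is_chart ac) (mf_is_chart ac') (mf_is_chart ac'').
pose O := c' @` (chart_dom c' `&` B `&` g @^-1` chart_dom c'').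
pose V := A `&` f @^-1` (chart_dom c' `&` (B `&` g @^-1` chart_dom c'')).
have oV : open V.
  apply: smooth_map_preimage_open => //; apply: openI; first exact: chart_dom_open.
  by apply: smooth_map_preimage_open => //; exact: chart_dom_open.
pose W := c @` (chart_dom c `&` V).
have oW : open W by exact: chart_image_open.
have Wx : W (c x) by exists x => //; split => //; split => //; split => //; split => //; exact: AB.
have H : ndiff_on k W (local_rep c' c'' g \o local_rep c c' f).
  apply: (@ndiff_on_comp _ _ _ _ _ W O) => //.
  - move=> _ [y [dy [Ay [dfy [Bfy dgfy]]]] <-]; exists (f y) => //.
    by rewrite /local_rep /= (chartK cc).
  - apply: ndiff_on_sub (sf.2 _ _ ac ac' k) => _ [y [dy [Ay [dfy _]]] <-].
    by exists y.
  - exact: sg.2.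
apply: (@ndiff_on_near _ _ _ _ _ (local_rep c' c'' g \o local_rep c c' f)).
  move=> _ ->; have := @local_rep_comp_near _ _ _ A f g c c' c'' x oA sf ac ac' Ax dx dfx.
  by apply: filterS => u ->.
by apply: ndiff_on_sub H => _ ->.
Qed.

Lemma derive_rep_comp M N P (A : set M) (B : set N) (f : M -> N) (g : N -> P)
    (c : chart R m M) (c' : chart R m N) (c'' : chart R m P) x v :
  open A -> (forall x, A x -> B (f x)) -> smooth_map A f -> smooth_map B g ->
  mf_atlas c -> mf_atlas c' -> mf_atlas c'' -> A x ->
  chart_dom c x -> chart_dom c' (f x) -> chart_dom c'' (g (f x)) ->
  'D_v (local_rep c c'' (g \o f)) (c x) =
  'D_('D_v (local_rep c c' f) (c x)) (local_rep c' c'' g) (c' (f x)).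
Proof.
move=> oA AB sf sg ac ac' ac'' Ax dx dfx dgfx.
have cc := mf_is_chart ac.
have fE : local_rep c c' f (c x) = c' (f x) by rewrite /local_rep /= (chartK cc).
have dg : differentiable (local_rep c' c'' g) (local_rep c c' f (c x)).
  by rewrite fE; apply: smooth_map_rep sg ac' ac'' _ dfx dgfx; exact: AB.
rewrite (near_eq_derive _ (local_rep_comp_near g c'' oA sf ac ac' Ax dx dfx)).
by rewrite (derive_comp _ (smooth_map_rep sf ac ac' Ax dx dfx) dg) fE.
Qed.

Lemma smooth_map_id M (A : set M) : open A -> smooth_map A id.
Proof.
move=> oA; split; first by rewrite within_continuousE// => x _; exact: cvg_id.
move=> c c' ac ac'; apply: smooth_on_sub (mf_transition ac ac').
by move=> _ [x [[dx Ax] dfx] <-]; exists x.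
Qed.

Lemma derive_rep_eq_id M (f : M -> M) (c : chart R m M) x v :
  mf_atlas c -> chart_dom c x -> (\forall y \near x, f y = y) ->
  'D_v (local_rep c c f) (c x) = v.
Proof.
move=> ac dx fx; have cc := mf_is_chart ac.
rewrite -[RHS](derive_id (c x) v); apply: near_eq_derive.
have := chart_inv_near cc dx fx; have := chart_dom_near cc dx.
apply: filterS2 => u cu fu; rewrite /local_rep /= fu.
exact: (chart_invK cc).
Qed.

Lemma pulls_back_sub M N (om : form_data M) (om' : form_data N) A B (f : M -> N) :
  A `<=` B -> pulls_back om om' B f -> pulls_back om om' A f.
Proof. by move=> AB pf c c' x ac ac' /AB; exact: pf. Qed.

Lemma derive_rep_near M N (f g : M -> N) (c : chart R m M) (c' : chart R m N) x v :
  mf_atlas c -> chart_dom c x -> (\forall y \near x, f y = g y) ->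
  'D_v (local_rep c c' f) (c x) = 'D_v (local_rep c c' g) (c x).
Proof.
move=> ac dx fg; apply: near_eq_derive.
have := chart_inv_near (mf_is_chart ac) dx fg.
by apply: filterS => u E; rewrite /local_rep /= E.
Qed.

Lemma pulls_back_near M N (om : form_data M) (om' : form_data N) A (f : M -> N) :
  (forall x, A x -> exists B (g : M -> N),
     [/\ open B, B x, pulls_back om om' B g & forall y, B y -> f y = g y]) ->
  pulls_back om om' A f.
Proof.
move=> H c c' x ac ac' Ax dx dfx v w.
have [B [g [oB Bx pg fg]]] := H x Ax.
have E : \forall y \near x, f y = g y.
  by near=> y; apply: fg; near: y; exact: open_nbhs_nbhs.
rewrite !(derive_rep_near _ _ ac dx E) fg//; apply: pg => //.
by rewrite -fg.
Unshelve. all: by end_near. Qed.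

Lemma pulls_back_comp M N P om om' om'' (A : set M) (B : set N) (f : M -> N)
    (g : N -> P) : open A -> (forall x, A x -> B (f x)) ->
  smooth_map A f -> smooth_map B g -> @pulls_back R m M N om om' A f ->
  @pulls_back R m N P om' om'' B g -> pulls_back om om'' A (g \o f).
Proof.
move=> oA AB sf sg pf pg c c'' x ac ac'' Ax dx dgfx v w.
have [c' ac' dfx] := mf_cover (f x).
rewrite -(pf c c' x ac ac' Ax dx dfx) -(pg c' c'' (f x) ac' ac'' (AB x Ax) dfx dgfx).
by rewrite !(derive_rep_comp _ oA AB sf sg ac ac' ac'' Ax dx dfx dgfx).
Qed.

(** The composite [f \o g] is the identity near [y], so its derivative in a chart is the identity,
    and the hypothesis on [f] at [g y] can be read backwards. *)
Lemma pulls_back_inv M N om om' (A : set M) (B : set N) (f : M -> N)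
    (g : N -> M) : open A -> open B -> (forall y, B y -> A (g y)) ->
  (forall y, B y -> f (g y) = y) -> smooth_map A f -> smooth_map B g ->
  @pulls_back R m M N om om' A f -> pulls_back om' om B g.
Proof.
move=> oA oB BA fg sf sg pf c' c y ac' ac By dy dgy v w.
have dfgy : chart_dom c' (f (g y)) by rewrite fg.
rewrite -(pf c c' (g y) ac ac' (BA y By) dgy dfgy).
rewrite -!(derive_rep_comp _ oB BA sg sf ac' ac ac' By dy dgy dfgy) fg//.
have E : \forall z \near y, (f \o g) z = z.
  by near=> z; apply: fg; near: z; exact: open_nbhs_nbhs.
by rewrite !derive_rep_eq_id.
Unshelve. all: by end_near. Qed.

End Charts.

(** * Continuity and invariance of the Hamiltonian *)

Section Isomorphisms.
Context (R : realType) (n : nat).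
Implicit Types M N P : ham_manifold R n.

Lemma zero_derive_locally_const (f : R -> R) (a r : R) :
  (forall t, `|t - a| < r -> is_derive t (1 : R) f 0) ->
  forall t, `|t - a| < r -> f t = f a.
Proof.
move=> H t ta.
have r0 : 0 < r by exact: le_lt_trans ta.
have cf s : `|s - a| < r -> {for s, continuous f}.
  by move=> /H ?; apply: differentiable_continuous; apply/derivable1_diffP.
have aux u v : u < v -> `|u - a| < r -> `|v - a| < r -> f u = f v.
  move=> uv; rewrite !ltr_distl => /andP[u1 u2] /andP[v1 v2].
  have sub s : u <= s <= v -> `|s - a| < r.
    by move=> /andP[us sv]; rewrite ltr_distl; apply/andP; split; lra.
  have [||c _] := @MVT R f (fun=> 0) u v uv.
  - move=> s; rewrite in_itv /= => /andP[us sv]; apply: H; apply: sub.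
    by rewrite !ltW.
  - apply: continuous_in_subspaceT => s; rewrite inE /= in_itv /= => us.
    exact/cf/sub.
  by rewrite mul0r => /eqP; rewrite subr_eq0 => /eqP.
have [ta'|at'|->//] := ltgtP t a.
  by apply: aux => //; rewrite subrr normr0.
by symmetry; apply: aux => //; rewrite subrr normr0.
Qed.

Lemma zero_derive_const (f : R -> R) :
  (forall t, is_derive t (1 : R) f 0) -> forall t, f t = f 0.
Proof.
move=> H t; apply: (@zero_derive_locally_const f 0 (`|t| + 1)).
by rewrite subr0 ltrDl.
Qed.

Lemma ham_rep_diff M (c : chart R n.*2 M) x : mf_atlas c -> chart_dom c x ->
  differentiable (@hm_ham _ _ M \o chart_inv c) (c x).
Proof.
by move=> ac dx; apply: smooth_on_diff (hm_ham_smooth ac) _; exists x.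
Qed.

Lemma ham_continuous M : continuous (@hm_ham _ _ M).
Proof.
move=> x; have [c ac dx] := mf_cover x; have cc := mf_is_chart ac.
have H := differentiable_continuous (ham_rep_diff ac dx).
have Hc := chart_cont cc dx.
have := continuous_comp Hc H.
rewrite /prop_for /continuous_at /= (chartK cc dx) => H'.
apply: cvg_trans H'; apply: near_eq_cvg; near=> y.
rewrite /= (chartK cc)//; near: y.
by apply: open_nbhs_nbhs; split => //; exact: chart_dom_open.
Unshelve. all: by end_near. Qed.

Lemma between_open M a b : open (@between R n M a b).
Proof.
rewrite (_ : between a b = @hm_ham _ _ M @^-1` `]a, b[%classic); last first.
  by apply/seteqP; split => x; rewrite /between /= in_itv.
apply: open_comp; last exact: itv_open.
by move=> x _; exact: ham_continuous.
Qed.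

Lemma act_rep_smooth M (c c' : chart R n.*2 M) : mf_atlas c -> mf_atlas c' ->
  forall t x, chart_dom c x -> chart_dom c' (hm_act t x) ->
  differentiable (fun p : R * 'rV[R]_n.*2 => c' (hm_act p.1 (chart_inv c p.2)))
    (t, c x).
Proof.
move=> ac ac' t x dx dtx; apply: smooth_on_diff (act_smooth (hm_action M) ac ac') _.
by split => /=; [exists x|rewrite (chartK (mf_is_chart ac))].
Qed.

Lemma act_cont M t : continuous (@hm_act _ _ M t).
Proof.
move=> x; have := @act_continuous _ _ _ _ (hm_action M) (t, x).
move=> H; apply: (@cvg_comp _ _ _ (fun y : M => (t, y))
   (fun p : R * M => hm_act p.1 p.2) _ _ _ _ H).
exact: (@cvg_pair _ _ _ (nbhs x) (nbhs t) (nbhs x) _ _ _ (fun=> t) id (cvg_cst t) cvg_id).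
Qed.

Lemma act_orbit_cont M (x : M) : continuous (fun t => hm_act t x).
Proof.
move=> t; have := @act_continuous _ _ _ _ (hm_action M) (t, x).
move=> H; apply: (@cvg_comp _ _ _ (fun s : R => (s, x))
   (fun p : R * M => hm_act p.1 p.2) _ _ _ _ H).
exact: (@cvg_pair _ _ _ (nbhs t) (nbhs t) (nbhs x) _ _ _ id (fun=> x) cvg_id (cvg_cst x)).
Qed.

Lemma actK M t : cancel (@hm_act _ _ M t) (hm_act (- t)).
Proof.
move=> x; rewrite -(act_add (hm_action M)) addNr.
exact: act_zero (hm_action M) x.
Qed.

Lemma actNK M t : cancel (@hm_act _ _ M (- t)) (hm_act t).
Proof. by move=> x; rewrite -{1}(opprK t) actK. Qed.

Lemma orbit_is_derive M (c : chart R n.*2 M) x : mf_atlas c -> chart_dom c x ->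
  is_derive (0 : R) 1 (fun t => c (hm_act t x)) (gen_field (@hm_act _ _ M) c x).
Proof.
move=> ac dx; have ax0 := act_zero (hm_action M) x.
have cc := mf_is_chart ac.
have d0 : chart_dom c (hm_act 0 x) by rewrite ax0.
have := act_rep_smooth ac ac dx d0.
set F := fun p => _ => dF.
have lE (t : R) : t *: (1, 0) + (0, c x) = (t, c x) :> R * 'rV[R]_n.*2.
  by congr pair; rewrite /= ?addr0 ?scaler0 ?add0r// /GRing.scale /= mulr1.
have := @is_derive_line R (R * 'rV[R]_n.*2)%type 'rV[R]_n.*2 F (0, c x) (1, 0) 0.
rewrite lE => /(_ dF) H.
have E : (fun t : R => F (t *: (1, 0) + (0, c x))) = (fun t => c (hm_act t x)).
  by apply/funext => t; rewrite lE /F /= (chartK cc).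
rewrite E in H; rewrite /gen_field derive1E.
by rewrite (@derive_val _ _ _ _ _ _ _ H).
Qed.

(** The derivative of H along an orbit is, up to sign, the form evaluated on the generating field
    twice, which is 0. The group law moves the base point to [hm_act s x], so the derivative is
    computed at time 0 only. *)
Lemma ham_invariant M t (x : M) : hm_ham (hm_act t x) = hm_ham x.
Proof.
have H : forall s : R, is_derive s 1 (fun t : R => hm_ham (hm_act t x)) 0.
  move=> s; pose y := hm_act s x; have [c ac dy] := mf_cover y.
  have cc := mf_is_chart ac.
  have dc := orbit_is_derive ac dy.
  have c0 : c (hm_act 0 y) = c y by rewrite (act_zero (hm_action M)).
  have dh : differentiable (@hm_ham _ _ M \o chart_inv c) (c (hm_act 0 y)).
    by rewrite c0; exact: ham_rep_diff.
  have dcd : differentiable (fun t => c (hm_act t y)) (0 : R).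
    by apply/derivable1_diffP; exact: ex_derive.
  have D0 : is_derive (0 : R) 1 (fun t => hm_ham (hm_act t y)) 0.
    apply: (@near_eq_is_derive _ _ _ ((@hm_ham _ _ M \o chart_inv c) \o
      (fun t => c (hm_act t y)))).
      near=> u; rewrite /= (chartK cc)//; near: u.
      have := @act_orbit_cont _ y 0; rewrite /prop_for /continuous_at.
      rewrite (act_zero (hm_action M)); apply.
      by apply: open_nbhs_nbhs; split => //; exact: chart_dom_open.
    split; first by apply: diff_derivable; exact: differentiable_comp.
    rewrite derive_comp// (@derive_val _ _ _ _ _ _ _ dc) c0.
    have := hm_moment ac dy (gen_field (@hm_act _ _ M) c y).
    rewrite (symp_alt (hm_symplectic M))//; last by exists y.
    by move/eqP; rewrite eq_sym oppr_eq0 => /eqP.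
  have E : (fun t => hm_ham (hm_act t x)) = (fun t => hm_ham (hm_act t y)) \o shift (- s).
    apply/funext => u /=; rewrite -(act_add (hm_action M)).
    by rewrite subrK.
  rewrite E.
  have := @is_derive_line R R R (fun t => hm_ham (hm_act t y)) (- s) 1 s.
  rewrite /GRing.scale /= mulr1 subrr.
  have -> : (fun t : R => hm_ham (hm_act (t * 1 + - s) y)) =
     (fun t => hm_ham (hm_act t y)) \o shift (- s).
    by apply/funext => u /=; rewrite mulr1.
  rewrite (@derive_val _ _ _ _ _ _ _ D0); apply.
  by apply/derivable1_diffP; exact: ex_derive.
by rewrite (zero_derive_const H) (act_zero (hm_action M)).
Unshelve. all: by end_near. Qed.

Lemma between_act M a b t (x : M) : between a b x -> between a b (hm_act t x).
Proof. by rewrite /between /= ham_invariant. Qed.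

End Isomorphisms.

(** * Isomorphisms *)

Section IsomTheory.
Context (R : realType) (n : nat).
Implicit Types M N P : ham_manifold R n.

Definition act_invariant M (A : set M) := forall t x, A x -> A (hm_act t x).

Lemma isom_fun M N (A : set M) (B : set N) f : isom_on A B f ->
  forall x, A x -> B (f x).
Proof. by move=> /isom_bij[]. Qed.

Lemma isom_inj M N (A : set M) (B : set N) f : isom_on A B f ->
  forall x y, A x -> A y -> f x = f y -> x = y.
Proof. by move=> /isom_bij[_ + _] x y Ax Ay; apply; rewrite inE. Qed.

Lemma isom_surj M N (A : set M) (B : set N) f : isom_on A B f ->
  forall y, B y -> exists2 x, A x & f x = y.
Proof. by move=> /isom_bij[_ _ +] y By => /(_ y By). Qed.

Lemma set_bijI M N (A : set M) (B : set N) (f : M -> N) :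
  (forall x, A x -> B (f x)) ->
  (forall x y, A x -> A y -> f x = f y -> x = y) ->
  (forall y, B y -> exists2 x, A x & f x = y) -> set_bij A B f.
Proof.
move=> H1 H2 H3; split => [x Ax|x y|y By]; first exact: H1.
  by rewrite !inE => Ax Ay; exact: H2.
by have [x Ax xy] := H3 y By; exists x.
Qed.

(** [isom_on] supplies a smooth left inverse; the invariance of [A] lets equivariance pass to it. *)
Lemma isom_inv M N (A : set M) (B : set N) f : open A -> open B ->
  act_invariant A -> isom_on A B f ->
  exists g : N -> M, [/\ isom_on B A g, (forall x, A x -> g (f x) = x) &
    (forall y, B y -> f (g y) = y)].
Proof.
move=> oA oB iA If; have [g gf sg] := isom_inv_smooth If.
have {}gf x : A x -> g (f x) = x by move=> Ax; apply: gf; rewrite inE.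
have gA y : B y -> A (g y) by move=> /(isom_surj If)[x Ax <-]; rewrite gf.
have fg y : B y -> f (g y) = y by move=> /(isom_surj If)[x Ax <-]; rewrite gf.
exists g; split => //; split => //.
- apply: set_bijI => //.
    by move=> x y Bx By E; rewrite -(fg x Bx) -(fg y By) E.
  by move=> x Ax; exists (f x); [exact: isom_fun If x Ax|exact: gf].
- exists f; last exact: isom_smooth If.
  by move=> y; rewrite inE; exact: fg.
- move=> t y By.
  have -> : hm_act t y = f (hm_act t (g y)).
    by rewrite (isom_equivariant If) ?fg//; exact: gA.
  by rewrite gf//; apply: iA; exact: gA.
- exact: (pulls_back_inv oA oB gA fg (isom_smooth If) sg (isom_form If)).
- by move=> y By; rewrite -{2}(fg y By) (isom_ham If)//; exact: gA.
Qed.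

Lemma isom_comp M N P (A : set M) (B : set N) (C : set P) f g :
  open A -> open B -> open C ->
  isom_on A B f -> isom_on B C g -> isom_on A C (g \o f).
Proof.
move=> oA oB oC If Ig; have [f' ff' sf'] := isom_inv_smooth If.
have [g' gg' sg'] := isom_inv_smooth Ig.
have AB := isom_fun If; have BC := isom_fun Ig.
split.
- apply: set_bijI => [x Ax|x y Ax Ay /= E|z Cz]; first exact/BC/AB.
    by apply: (isom_inj If) => //; apply: (isom_inj Ig) => //; exact: AB.
  have [y By <-] := isom_surj Ig Cz; have [x Ax <-] := isom_surj If By.
  by exists x.
- exact: smooth_map_comp oA oB AB (isom_smooth If) (isom_smooth Ig).
- exists (f' \o g').
    move=> x; rewrite inE => Ax /=; rewrite gg' ?ff' ?inE//; exact: AB.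
  apply: smooth_map_comp oC oB _ sg' sf' => z Cz.
  by have [y By <-] := isom_surj Ig Cz; rewrite gg' ?inE.
- by move=> t x Ax /=; rewrite (isom_equivariant If)// (isom_equivariant Ig)//; exact: AB.
- exact: pulls_back_comp oA AB (isom_smooth If) (isom_smooth Ig) (isom_form If) (isom_form Ig).
- by move=> x Ax /=; rewrite (isom_ham Ig) ?(isom_ham If)//; exact: AB.
Qed.

Lemma isom_sub M N (A A' : set M) (B B' : set N) f :
  open A -> open B -> open A' -> open B' ->
  A' `<=` A -> B' `<=` B -> (forall x, A x -> (A' x <-> B' (f x))) ->
  isom_on A B f -> isom_on A' B' f.
Proof.
move=> oA oB oA' oB' sA sB AB If; split.
- apply: set_bijI => [x A'x|x y A'x A'y|y B'y].
  + by apply/AB => //; exact: sA.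
  + by apply: (isom_inj If); exact: sA.
  + have [x Ax E] := isom_surj If (sB y B'y); exists x => //.
    by apply/AB => //; rewrite E.
- exact: smooth_map_sub oA' oA sA (isom_smooth If).
- have [g gf sg] := isom_inv_smooth If; exists g.
    by move=> x; rewrite inE => /sA Ax; apply: gf; rewrite inE.
  exact: smooth_map_sub oB' oB sB sg.
- by move=> t x /sA; exact: (isom_equivariant If).
- exact: pulls_back_sub sA (isom_form If).
- by move=> x /sA; exact: (isom_ham If).
Qed.

Lemma isom_id M (A : set M) : open A -> isom_on A A id.
Proof.
move=> oA; split => //.
- by apply: set_bijI => // y By; exists y.
- exact: smooth_map_id.
- by exists id => //; exact: smooth_map_id.
- by apply: pulls_back_sub (symp_compat (hm_symplectic M)).
Qed.

(** Serves as the transition between pieces that do not meet. *)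
Lemma isom_set0 M N (f : M -> N) : isom_on set0 set0 f.
Proof.
have H (M1 N1 : manifold R n.*2) (h : M1 -> N1) : smooth_map set0 h.
  split; first by rewrite within_continuousE//; exact: open0.
  by move=> c c' _ _ k; apply: ndiff_on_point => y [x [[_ []]]].
split => //; first by apply: set_bijI => // y [].
by have [y _] := hm_nonempty M; exists (fun=> y) => // x; rewrite inE.
Qed.

Lemma between_invariant M a b : act_invariant (@between _ _ M a b).
Proof. by move=> t x; exact: between_act. Qed.

Lemma isom_between_sub M N (A : set M) (B : set N) a b f :
  open A -> open B -> isom_on A B f -> between a b `<=` A ->
  between a b `<=` B -> isom_on (between a b) (between a b) f.
Proof.
move=> oA oB If sA sB; have hf := isom_ham If; apply: isom_sub If => //; try exact: between_open.
by move=> x Ax; rewrite /between /= hf.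
Qed.

(** Near [f x] the Hamiltonian of [N] is that of [M] composed with the inverse [g], and the chain
    rule carries the vanishing derivatives over. *)
Lemma isom_critical M N (A : set M) (B : set N) f x : open A -> open B ->
  act_invariant A -> isom_on A B f -> A x -> critical_point x ->
  critical_point (f x).
Proof.
move=> oA oB iA If Ax crx; have [g [Ig gf fg]] := isom_inv oA oB iA If.
move=> c' ac' dfx v; have [c ac dx] := mf_cover x.
have cc := mf_is_chart ac; have cc' := mf_is_chart ac'.
have Bfx := isom_fun If Ax.
have dgf : chart_dom c (g (f x)) by rewrite gf.
have dg := smooth_map_rep (isom_smooth Ig) ac' ac Bfx dfx dgf.
have gE : local_rep c' c g (c' (f x)) = c x by rewrite /local_rep /= (chartK cc')// gf.
have dh : differentiable (@hm_ham _ _ M \o chart_inv c) (local_rep c' c g (c' (f x))).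
  by rewrite gE; exact: ham_rep_diff.
have E : \forall u \near c' (f x), (@hm_ham _ _ N \o chart_inv c') u =
    ((@hm_ham _ _ M \o chart_inv c) \o local_rep c' c g) u.
  have oV : open (B `&` g @^-1` chart_dom c).
    by apply: smooth_map_preimage_open (isom_smooth Ig) _ => //; exact: chart_dom_open.
  have := chart_inv_near cc' dfx (open_nbhs_nbhs (conj oV (conj Bfx dgf))).
  apply: filterS => u [Bu du]; rewrite /local_rep /= (chartK cc)//.
  by rewrite (isom_ham Ig).
by rewrite (near_eq_derive _ E) derive_comp// gE crx.
Qed.

(* The f i preserve the Hamiltonians, so injectivity and surjectivity can be
   checked one band at a time. *)
Lemma isom_glue M N (I : Type) (a b : I -> R) (f : I -> M -> N) (F : M -> N) :
  (forall i, isom_on (between (a i) (b i)) (between (a i) (b i)) (f i)) ->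
  (forall i x, between (a i) (b i) x -> F x = f i x) ->
  (forall x : M, exists i, between (a i) (b i) x) ->
  (forall y : N, exists i, between (a i) (b i) y) ->
  isom_on setT setT F.
Proof.
move=> If Ff cM cN.
have oM i := @between_open R n M (a i) (b i).
have oN i := @between_open R n N (a i) (b i).
have hF x : hm_ham (F x) = hm_ham x.
  by have [i xi] := cM x; rewrite (Ff i)// (isom_ham (If i)).
have Finj x y : F x = F y -> x = y.
  move=> E; have [i xi] := cM x.
  have yi : between (a i) (b i) y by rewrite /between /= -hF -E hF.
  by apply: (isom_inj (If i)) => //; rewrite -!Ff.
have Fsurj y : exists x, F x = y.
  have [i yi] := cN y; have [x xi <-] := isom_surj (If i) yi.
  by exists x; exact: Ff.
pose G y := projT1 (cid (Fsurj y)).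
have FG y : F (G y) = y by rewrite /G; case: cid.
have GF x : G (F x) = x by exact/Finj/FG.
split => //.
- by apply: set_bijI => // [x y _ _|y _]; [exact: Finj|exists (G y)].
- apply: smooth_map_near => [|x _]; first exact: openT.
  have [i xi] := cM x; exists (between (a i) (b i)), (f i); split => //.
    exact: isom_smooth (If i).
  exact: Ff.
- exists G => //; apply: smooth_map_near => [|y _]; first exact: openT.
  have [i yi] := cN y.
  have [g [Ig gf fg]] := isom_inv (oM i) (oN i) (@between_invariant _ _ _) (If i).
  exists (between (a i) (b i)), g; split => //; first exact: isom_smooth Ig.
  move=> z zi; apply: Finj; rewrite FG (Ff i); last exact: isom_fun Ig _ zi.
  by rewrite fg.
- move=> t x _; have [i xi] := cM x; rewrite !(Ff i)//; last exact: between_act.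
  exact: (isom_equivariant (If i)).
- apply: pulls_back_near => x _; have [i xi] := cM x.
  exists (between (a i) (b i)), (f i); split => //; first exact: isom_form (If i).
  exact: Ff.
Qed.

End IsomTheory.

(** * Patching isomorphisms along levels *)

Section Levels.
Context (R : realType) (s : nat) (l : nat -> R).
Hypothesis lS : forall j, (j <= s)%N -> l j < l j.+1.

Lemma level_lt i k : (i < k <= s.+1)%N -> l i < l k.
Proof.
elim: k => // k IH /andP[ik ks]; move: ik; rewrite ltnS leq_eqVlt => /orP[/eqP->|ik].
  exact: lS.
by apply: lt_trans (lS ks); apply: IH; rewrite ik ltnW.
Qed.

Lemma level_inj i k : (i <= s.+1)%N -> (k <= s.+1)%N -> l i = l k -> i = k.
Proof.
move=> iS kS E; apply/eqP; case: (ltngtP i k) => // H.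
  by have := @level_lt i k; rewrite H kS E ltxx => /(_ isT).
by have := @level_lt k i; rewrite H iS E ltxx => /(_ isT).
Qed.

Lemma level_le i k : (i <= k <= s.+1)%N -> l i <= l k.
Proof.
move=> /andP[]; rewrite leq_eqVlt => /orP[/eqP->//|ik] ks.
by apply/ltW/level_lt; rewrite ik.
Qed.

Lemma gap_uniq j k (v : R) : (j <= s)%N -> (k <= s)%N ->
  l j < v < l j.+1 -> l k < v < l k.+1 -> j = k.
Proof.
move=> js ks /andP[jv vj] /andP[kv vk]; apply/eqP.
case: (ltngtP j k) => // H.
  by have := @level_le j.+1 k; rewrite H ltnW// => /(_ isT); lra.
by have := @level_le k.+1 j; rewrite H ltnW// => /(_ isT); lra.
Qed.

Lemma gap_not_level j i (v : R) : (j <= s)%N -> (i <= s.+1)%N ->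
  l j < v < l j.+1 -> v <> l i.
Proof.
move=> js iS /andP[jv vj] E; case: (leqP i j) => H.
  by have := @level_le i j; rewrite H ltnW// => /(_ isT); lra.
by have := @level_le j.+1 i; rewrite H iS => /(_ isT); lra.
Qed.

Lemma level_or_gap (v : R) : l 0%N <= v <= l s.+1 ->
  (exists2 i, (i <= s.+1)%N & v = l i) \/ (exists2 j, (j <= s)%N & l j < v < l j.+1).
Proof.
move=> /andP[v0 vs].
have H k : (k <= s.+1)%N -> v <= l k ->
    (exists2 i, (i <= s.+1)%N & v = l i) \/ (exists2 j, (j <= s)%N & l j < v < l j.+1).
  elim: k => [_ vk|k IH ks vk].
    by left; exists 0%N => //; apply/eqP; rewrite eq_le v0 vk.
  have [vk'|kv] := leP v (l k); first by apply: IH => //; exact: ltnW.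
  move: vk; rewrite le_eqVlt => /orP[/eqP->|vk]; first by left; exists k.+1.
  by right; exists k => //; rewrite kv.
exact: H vs.
Qed.

End Levels.

(** Both enumerations are strictly sorted lists with the same elements, hence equal lists. So the
    critical values of a manifold determine the number of levels and the levels. *)
Lemma increasing_enum_unique (R : realType) (s s' : nat) (l l' : nat -> R) :
  (forall j, (j <= s)%N -> l j < l j.+1) ->
  (forall j, (j <= s')%N -> l' j < l' j.+1) ->
  (forall v, (exists2 i, (i <= s.+1)%N & v = l i) <->
             (exists2 i, (i <= s'.+1)%N & v = l' i)) ->
  s = s' /\ forall i, (i <= s.+1)%N -> l i = l' i.
Proof.
move=> lS lS' E.
have srt k (h : nat -> R) : (forall j, (j <= k)%N -> h j < h j.+1) ->
    sorted <%O [seq h i | i <- iota 0 k.+2].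
  move=> hS; rewrite sorted_map; apply/(sortedP 0%N) => i.
  rewrite size_iota => ik; rewrite !nth_iota//; last exact: ltnW.
  by rewrite !add0n; apply: hS.
have mem k (h : nat -> R) v : (v \in [seq h i | i <- iota 0 k.+2]) <->
    (exists2 i, (i <= k.+1)%N & v = h i).
  split=> [/mapP[i]|[i ik ->]].
    by rewrite mem_iota add0n ltnS => /andP[_ ik] ->; exists i.
  by apply: map_f; rewrite mem_iota add0n ltnS.
have EE : [seq l i | i <- iota 0 s.+2] = [seq l' i | i <- iota 0 s'.+2].
  apply: lt_sorted_eq; [exact: srt|exact: srt|] => v.
  by apply/idP/idP => /mem/E/mem.
have ss : s = s'.
  by have := congr1 size EE; rewrite !size_map !size_iota => -[].
split=> // i iS; rewrite -ss in EE.
have := congr1 (nth 0 ^~ i) EE.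
by rewrite !(nth_map 0%N) ?size_iota// nth_iota.
Qed.

Section Patch.
Context (R : realType) (n : nat).
Implicit Types M N : ham_manifold R n.

(** The value of H selects the map: [phi i] at the level [l i] itself, [psi j] strictly between
    levels. Compatibility then shows that the result agrees with [phi i] on the whole band around
    [l i], and the bands cover both manifolds. *)
Lemma isom_patch M N (s : nat) (l d : nat -> R) (phi psi : nat -> M -> N) :
  (forall j, (j <= s)%N -> l j < l j.+1) ->
  (forall i, (i <= s.+1)%N -> 0 < d i) ->
  (forall j, (j <= s)%N -> l j + d j <= l j.+1) ->
  (forall j, (j <= s)%N -> l j <= l j.+1 - d j.+1) ->
  (forall x : M, l 0%N <= hm_ham x <= l s.+1) ->
  (forall y : N, l 0%N <= hm_ham y <= l s.+1) ->
  (forall i, (i <= s.+1)%N ->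
    isom_on (between (l i - d i) (l i + d i)) (between (l i - d i) (l i + d i)) (phi i)) ->
  (forall j, (j <= s)%N ->
    isom_on (between (l j) (l j.+1)) (between (l j) (l j.+1)) (psi j)) ->
  (forall j, (j <= s)%N -> forall x, between (l j) (l j + d j) x -> phi j x = psi j x) ->
  (forall j, (j <= s)%N -> forall x, between (l j.+1 - d j.+1) (l j.+1) x ->
    phi j.+1 x = psi j x) ->
  isomorphic M N.
Proof.
move=> lS d0 du dd rM rN iphi ipsi cu cd.
have [y0 _] := hm_nonempty N.
pose onlev (x : M) := exists2 i, (i <= s.+1)%N & hm_ham x = l i.
pose ongap (x : M) := exists2 j, (j <= s)%N & l j < hm_ham x < l j.+1.
(* [y0] is a default that is never reached: the bounds on H put every point on a level or in a
   gap. *)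
pose F (x : M) : N := match pselect (onlev x) with
  | left e => phi (projT1 (cid2 e)) x
  | right _ => match pselect (ongap x) with
    | left e => psi (projT1 (cid2 e)) x
    | right _ => y0 end end.
have Flev i x : (i <= s.+1)%N -> hm_ham x = l i -> F x = phi i x.
  move=> iS xi; rewrite /F; case: pselect => [e|]; last by case; exists i.
  case: (cid2 e) => k ks xk /=; congr (phi _ x).
  by apply: (level_inj lS) => //; rewrite -xi.
have Fgap j x : (j <= s)%N -> l j < hm_ham x < l j.+1 -> F x = psi j x.
  move=> js xj; rewrite /F; case: pselect => [e|_].
    by have [i iS xi] := e; case: (gap_not_level lS js iS xj xi).
  case: pselect => [e|]; last by case; exists j.
  case: (cid2 e) => k ks xk /=; congr (psi _ x).
  exact: (gap_uniq lS _ _ xk xj).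
exists F.
pose I := ('I_s.+2 + 'I_s.+1)%type.
pose a (i : I) := match i with inl i => l i - d i | inr j => l j end.
pose b (i : I) := match i with inl i => l i + d i | inr j => l j.+1 end.
pose f (i : I) := match i with inl i => phi i | inr j => psi j end.
have cover (P : ham_manifold R n) : (forall x : hm_mf P, l 0%N <= hm_ham x <= l s.+1) ->
    forall x : P, exists i, between (a i) (b i) x.
  move=> rP x; have [[i iS xi]|[j js xj]] := level_or_gap (rP x).
    have iS2 : (i < s.+2)%N := iS; exists (inl (Ordinal iS2)); rewrite /between /= xi.
    by have := d0 i iS; lra.
  by have js2 : (j < s.+1)%N := js; exists (inr (Ordinal js2)); rewrite /between.
apply: (@isom_glue _ _ M N I a b f F).
- by case=> [i|j]; [apply: iphi; rewrite -ltnS|apply: ipsi; rewrite -ltnS].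
- case=> [i|j] x /=; last by apply: Fgap; rewrite -ltnS.
  rewrite /between /= => /andP[x1 x2].
  have iS : (i <= s.+1)%N by rewrite -ltnS.
  (* Below its level the point lies in the gap [i.-1], above it in the gap [i]. The bounds on H
     exclude the first case for [i = 0] and the second for [i = s.+1]. *)
  have [xi|ix|] := ltgtP (hm_ham x) (l i); last exact: Flev.
  + have [i0|i0] := posnP i.
      by have /andP[r1 r2] := rM x; have li0 : l i = l 0%N := congr1 l i0; exfalso; lra.
    have js : (i.-1 <= s)%N by rewrite -ltnS prednK.
    have := cd _ js; have := dd _ js; rewrite prednK// => H H'.
    rewrite (H' x); last by rewrite /between /= x1.
    by apply: Fgap => //; rewrite prednK// xi andbT; lra.
  + have [iS'|js] := leqP s.+1 i.
      have E : s.+1 = i by apply/eqP; rewrite eqn_leq iS iS'.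
      by have /andP[r1 r2] := rM x; rewrite E in r2; exfalso; lra.
    rewrite (cu _ js); last by rewrite /between /= ix.
    by apply: Fgap => //; rewrite ix /=; have := du _ js; lra.
- exact: cover.
- exact: cover.
Qed.

End Patch.

(** * Local data determine the manifold *)

Section LocalDataOfClosed.
Context (R : realType) (n : nat).
Implicit Types (M N P : ham_manifold R n) (L : local_data R n).

Lemma extremum_critical M (x : M) :
  (forall y : M, hm_ham x <= hm_ham y) \/ (forall y : M, hm_ham y <= hm_ham x) ->
  critical_point x.
Proof.
move=> ex c ac dx v; have cc := mf_is_chart ac.
pose h := @hm_ham _ _ M \o chart_inv c.
have hx : h (c x) = hm_ham x by rewrite /h /= (chartK cc).
have [r /= r0 Hr] : nbhs_ball (c x) (chart_img c).
  by apply/nbhs_ballP; exact: chart_dom_near.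
pose e := r / (`|v| + 1).
have e0 : 0 < e by rewrite divr_gt0// ltr_wpDl.
have img (t : R) : t \in `](- e), e[ -> chart_img c (t *: v + c x).
  rewrite in_itv /= -ltr_norml => te; apply: Hr; apply/ballN.
  rewrite addrK normrZ; move: te; rewrite /e ltr_pdivlMr ?ltr_wpDl// => te.
  by apply: le_lt_trans te; rewrite ler_wpM2l// lerDl.
have dh (t : R) : t \in `](- e), e[ -> is_derive t 1 (fun t => h (t *: v + c x)) ('D_v h (t *: v + c x)).
  by move=> /img it; apply: is_derive_line; apply: smooth_on_diff (hm_ham_smooth ac) it.
have e0' : - e <= e by lra.
have in0 : (0 : R) \in `](- e), e[ by rewrite in_itv /=; lra.
have D0 : is_derive (0 : R) 1 (fun t => h (t *: v + c x)) 0.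
  have dd (t : R) : t \in `](- e), e[ -> derivable (fun t : R => h (t *: v + c x)) t (1 : R).
    by move=> /dh ?; exact: ex_derive.
  case: ex => ex; [apply: (derive1_at_min e0' dd in0)|apply: (derive1_at_max e0' dd in0)];
    by move=> t _; rewrite scale0r add0r hx; exact: ex.
have := @derive_val _ _ _ _ _ _ _ (dh 0 in0).
by rewrite (@derive_val _ _ _ _ _ _ _ D0) scale0r add0r => <-.
Qed.

(** The maximum of H on a compact manifold is attained at a critical point, so it is one of the
    levels and at most the last one. *)
Lemma closed_range M L : closed_ham M -> has_local_data M L ->
  forall x : M, ld_level L 0 <= hm_ham x <= ld_level L (ld_s L).+1.
Proof.
move=> [cM h0 _ _] [crit _] x; rewrite ld_level0 h0 /=.
have [y0 _] := hm_nonempty M.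
have cH : {within [set: M], continuous (@hm_ham _ _ M)}.
  by apply: continuous_subspaceT; exact: ham_continuous.
have [y _ ymax] := compact_EVT_max (ex_intro _ y0 I) cM cH.
have {}ymax (z : M) : hm_ham z <= hm_ham y by apply: ymax; rewrite inE.
have /crit[i iS E] : critical_value M (hm_ham y).
  by exists y => //; apply: extremum_critical; right.
apply: le_trans (ymax x) _; rewrite E.
by apply: (level_le (@ld_level_lt _ _ L)); rewrite iS /=.
Qed.

Lemma eps_gt0 L i : (i <= (ld_s L).+1)%N -> 0 < ld_eps L i.
Proof.
case: i => [_|i]; first by case: (ld_min L).
rewrite ltnS leq_eqVlt => /orP[/eqP->|iS]; first by case: (ld_max L).
by have [] := @ld_crit _ _ L i.+1 iS.
Qed.

Lemma germ_above L j v : (j <= ld_s L)%N ->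
  ld_level L j <= v < ld_level L j + ld_eps L j ->
  exists y : ld_germ L j, hm_ham y = v.
Proof.
case: j => [_|j js] vj.
  have [_ rY _] := ld_min L.
  have : range (@hm_ham _ _ (ld_germ L 0)) v by rewrite rY /= in_itv.
  by case=> y _ <-; exists y.
have [e0 rY _] := @ld_crit _ _ L j.+1 js.
have : range (@hm_ham _ _ (ld_germ L j.+1)) v by rewrite rY /= in_itv /=; lra.
by case=> y _ <-; exists y.
Qed.

Lemma germ_below L j v : (j <= ld_s L)%N ->
  ld_level L j.+1 - ld_eps L j.+1 < v <= ld_level L j.+1 ->
  exists y : ld_germ L j.+1, hm_ham y = v.
Proof.
rewrite leq_eqVlt => /orP[/eqP->|js] vj.
  have [_ rY _] := ld_max L.
  have : range (@hm_ham _ _ (ld_germ L (ld_s L).+1)) v by rewrite rY /= in_itv.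
  by case=> y _ <-; exists y.
have [e0 rY _] := @ld_crit _ _ L j.+1 js.
have : range (@hm_ham _ _ (ld_germ L j.+1)) v by rewrite rY /= in_itv /=; lra.
by case=> y _ <-; exists y.
Qed.

Lemma slice_ham L j (z : ld_slice L j) : (j <= ld_s L)%N ->
  ld_level L j < hm_ham z < ld_level L j.+1.
Proof.
move=> js; have [rZ _] := @ld_regular _ _ L j js.
have : range (@hm_ham _ _ (ld_slice L j)) (hm_ham z) by exists z.
by rewrite rZ /= in_itv.
Qed.

(** Otherwise the germ would contain a point at the height of the next level. Its image in the slice
    would have that height too, which lies outside the open interval of heights of the slice. *)
Lemma gap_up L j : (j <= ld_s L)%N ->
  ld_level L j + ld_eps L j <= ld_level L j.+1.
Proof.
move=> js; rewrite leNgt; apply/negP => H.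
have lj := ld_level_lt js.
have [|y yE] := @germ_above L j (ld_level L j.+1) js; first by rewrite H ltW.
have yb : between (ld_level L j) (ld_level L j + ld_eps L j) y by rewrite /between /= yE lj.
have := isom_ham (ld_upP js) yb; have /andP[_] := slice_ham (ld_up y) js.
by rewrite yE => /[swap] ->; rewrite ltxx.
Qed.

Lemma gap_down L j : (j <= ld_s L)%N ->
  ld_level L j <= ld_level L j.+1 - ld_eps L j.+1.
Proof.
move=> js; rewrite leNgt; apply/negP => H.
have lj := ld_level_lt js.
have [|y yE] := @germ_below L j (ld_level L j) js; first by rewrite H ltW.
have yb : between (ld_level L j.+1 - ld_eps L j.+1) (ld_level L j.+1) y.
  by rewrite /between /= yE lj andbT.
have := isom_ham (ld_downP js) yb; have /andP[+ _] := slice_ham (ld_down y) js.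
by rewrite yE => /[swap] ->; rewrite ltxx.
Qed.

Lemma same_local_data_refl L : same_local_data L L.
Proof.
(* Half the width, since [germ_iso] asks for a restriction strictly narrower than both
   cobordisms. *)
split => //; exists (fun i => ld_eps L i / 2), (fun i => id), (fun j => id).
split => // [i iS|j js].
- have e0 := eps_gt0 iS; split; first by rewrite minxx; lra.
  by apply: isom_id; exact: between_open.
- by apply: isom_id; exact: openT.
Qed.

Local Notation band_iso a b f := (isom_on (between a b) (between a b) f).

Lemma band_iso_sub M N (a b a' b' : R) (f : M -> N) :
  band_iso a b f -> a <= a' -> b' <= b -> band_iso a' b' f.
Proof.
move=> If aa bb.
have sub P : @between R n P a' b' `<=` between a b.
  by move=> x; rewrite /between /= => /andP[ax xb]; lra.
by apply: (isom_between_sub _ _ If (sub M) (sub N)); exact: between_open.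
Qed.

Lemma band_iso_comp M N P (a b : R) (f : M -> N) (g : N -> P) :
  band_iso a b f -> band_iso a b g -> band_iso a b (g \o f).
Proof. by apply: isom_comp; exact: between_open. Qed.

Lemma band_iso_inv M N (a b : R) (f : M -> N) : band_iso a b f ->
  exists g : N -> M, [/\ band_iso a b g,
    (forall x, between a b x -> g (f x) = x) &
    (forall y, between a b y -> f (g y) = y)].
Proof.
by apply: isom_inv; [exact: between_open|exact: between_open|exact: between_invariant].
Qed.

Lemma slice_setT L j : (j <= ld_s L)%N ->
  [set: ld_slice L j] = between (ld_level L j) (ld_level L j.+1).
Proof. by move=> js; apply/seteqP; split => // z _; exact: slice_ham. Qed.

(** Each band map goes from [M] back to a representative by the inverse of [f1] or [g1], across by
    [f] or [g], and into [M'] by [f2] or [g2]. On an overlap the gluing squares of [M], of the two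
    sets of data and of [M'] are chased in turn. *)
Lemma same_local_data_isomorphic L L' M M' : closed_ham M -> closed_ham M' ->
  has_local_data M L -> has_local_data M' L' -> same_local_data L L' ->
  isomorphic M M'.
Proof.
move=> clM clM' hL hL' [sE lE [d [f [g [Hf Hg Hu Hd]]]]].
have rM := closed_range clM hL; have rM' := closed_range clM' hL'.
have [_ [d1 [f1 [g1 [Hf1 Hg1 Hu1 Hd1]]]]] := hL.
have [_ [d2 [f2 [g2 [Hf2 Hg2 Hu2 Hd2]]]]] := hL'.
pose l := ld_level L; pose s := ld_s L.
have S' i : (i <= s.+1)%N -> (i <= (ld_s L').+1)%N by rewrite -sE.
have J' j : (j <= s)%N -> (j <= ld_s L')%N by rewrite -sE.
have s1 j : (j <= s)%N -> (j <= s.+1)%N by exact: leqW.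
have lE' i : (i <= s.+1)%N -> ld_level L' i = l i by move=> iS; rewrite /l lE.
pose del i := Num.min (d i) (Num.min (d1 i) (d2 i)).
have del0 i : (i <= s.+1)%N -> 0 < del i.
  move=> iS; rewrite !lt_min; have [/andP[-> _] _] := Hf i iS.
  have [/andP[-> _] _] := Hf1 i iS.
  by have [/andP[-> _] _] := Hf2 i (S' i iS).
have deld i : del i <= d i by rewrite ge_min lexx.
have deld1 i : del i <= d1 i by rewrite !ge_min lexx orbT.
have deld2 i : del i <= d2 i by rewrite !ge_min lexx !orbT.
have dele i : (i <= s.+1)%N -> del i < ld_eps L i.
  by move=> iS; apply: le_lt_trans (deld1 i) _; have [/andP[_ ->]] := Hf1 i iS.
have up j : (j <= s)%N -> l j + del j <= l j.+1.
  by move=> js; have := gap_up js; have := dele _ (s1 _ js); rewrite -/l; lra.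
have down j : (j <= s)%N -> l j <= l j.+1 - del j.+1.
  by move=> js; have := gap_down js; have := dele j.+1 js; rewrite -/l; lra.
(* A constant map is taken for irrelevant indices, so that the inverses form a family indexed by all
   of [nat]. *)
have F1 i : exists fi : M -> ld_germ L i, (i <= s.+1)%N ->
    band_iso (l i - del i) (l i + del i) fi /\
    forall y, between (l i - del i) (l i + del i) y -> fi (f1 i y) = y.
  have [iS|iS] := boolP (i <= s.+1)%N; last first.
    by have [y _] := hm_nonempty (ld_germ L i); exists (fun=> y).
  have [_ If] := Hf1 i iS; have Ld := deld1 i.
  have [||fi [Ifi Kfi _]] := band_iso_inv (@band_iso_sub _ _ _ _
    (l i - del i) (l i + del i) _ If _ _); [by rewrite -/l; lra..|].
  by exists fi.
pose phi1 i := projT1 (cid (F1 i)); have Hphi1 i := projT2 (cid (F1 i)).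
have G1 j : exists gj : M -> ld_slice L j, (j <= s)%N ->
    band_iso (l j) (l j.+1) gj /\ forall y, gj (g1 j y) = y.
  have [js|js] := boolP (j <= s)%N; last first.
    by have [y _] := hm_nonempty (ld_slice L j); exists (fun=> y).
  have := Hg1 j js; rewrite slice_setT// => /band_iso_inv[gj [Igj Kgj _]].
  by exists gj; split => // y; apply: Kgj; exact: slice_ham.
pose psi1 j := projT1 (cid (G1 j)); have Hpsi1 j := projT2 (cid (G1 j)).
pose phi i := f2 i \o f i \o phi1 i.
pose psi j := g2 j \o g j \o psi1 j.
apply: (@isom_patch _ _ M M' s l del phi psi) => //.
- exact: ld_level_lt.
- by move=> y; have := rM' y; rewrite -sE !lE'.
- move=> i iS; have [If1 _] := Hphi1 i iS.
  have Ld := deld i; have Ld2 := deld2 i.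
  apply: band_iso_comp If1 _; apply: band_iso_comp.
    by have [_ If] := Hf i iS; apply: band_iso_sub If _ _; rewrite -/l; lra.
  have [_] := Hf2 i (S' i iS); rewrite lE'// => If.
  by apply: band_iso_sub If _ _; lra.
- move=> j js; have [Ig1 _] := Hpsi1 j js.
  apply: band_iso_comp Ig1 _; apply: band_iso_comp.
    have := Hg j js; rewrite /slice_iso slice_setT// slice_setT ?J'//.
    by rewrite !lE'// ?s1.
  by have := Hg2 j (J' j js); rewrite slice_setT ?J'// !lE'// ?s1.
- move=> j js x xj; have jS := s1 _ js.
  have [If1 K1] := Hphi1 j jS; have [Ig1 KG1] := Hpsi1 j js.
  have xb : between (l j - del j) (l j + del j) x.
    by move: xj; rewrite /between /=; have := del0 j jS; lra.
  have [_ If] := Hf1 j jS.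
  have If' : band_iso (l j - del j) (l j + del j) (f1 j).
    by have Ld := deld1 j; apply: band_iso_sub If _ _; rewrite -/l; lra.
  have [y yb yx] := isom_surj If' xb.
  have hy : between (l j) (l j + del j) y.
    by move: xj; rewrite -yx /between /= (isom_ham If').
  have hyd : between (l j) (l j + d j) y.
    by move: hy; have := deld j; rewrite /between /=; lra.
  have hyd1 : between (l j) (l j + d1 j) y.
    by move: hy; have := deld1 j; rewrite /between /=; lra.
  have phiy : phi1 j x = y by rewrite -yx; exact: K1.
  have psiy : psi1 j x = ld_up y by rewrite -yx -(Hu1 j js y hyd1); exact: KG1.
  rewrite /phi /psi /= phiy psiy (Hu j js y hyd) Hu2 ?J'//.
  have [_ Ifj] := Hf j jS.
  have hyd' : between (l j - d j) (l j + d j) y.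
    by move: hyd; have [/andP[dj0 _] _] := Hf j jS; rewrite /between /=; lra.
  have := deld2 j; move: hy; rewrite /between /= lE'// -(isom_ham Ifj hyd'); lra.
- move=> j js x xj; have jS : (j.+1 <= s.+1)%N := js.
  have [If1 K1] := Hphi1 j.+1 jS; have [Ig1 KG1] := Hpsi1 j js.
  have xb : between (l j.+1 - del j.+1) (l j.+1 + del j.+1) x.
    by move: xj; rewrite /between /=; have := del0 j.+1 jS; lra.
  have [_ If] := Hf1 j.+1 jS.
  have If' : band_iso (l j.+1 - del j.+1) (l j.+1 + del j.+1) (f1 j.+1).
    by have Ld := deld1 j.+1; apply: band_iso_sub If _ _; rewrite -/l; lra.
  have [y yb yx] := isom_surj If' xb.
  have hy : between (l j.+1 - del j.+1) (l j.+1) y.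
    by move: xj; rewrite -yx /between /= (isom_ham If').
  have hyd : between (l j.+1 - d j.+1) (l j.+1) y.
    by move: hy; have := deld j.+1; rewrite /between /=; lra.
  have hyd1 : between (l j.+1 - d1 j.+1) (l j.+1) y.
    by move: hy; have := deld1 j.+1; rewrite /between /=; lra.
  have phiy : phi1 j.+1 x = y by rewrite -yx; exact: K1.
  have psiy : psi1 j x = ld_down y by rewrite -yx -(Hd1 j js y hyd1); exact: KG1.
  rewrite /phi /psi /= phiy psiy (Hd j js y hyd) Hd2 ?J'//.
  have [_ Ifj] := Hf j.+1 jS.
  have hyd' : between (l j.+1 - d j.+1) (l j.+1 + d j.+1) y.
    by move: hyd; have [/andP[dj0 _] _] := Hf j.+1 jS; rewrite /between /=; lra.
  have := deld2 j.+1; move: hy; rewrite /between /= lE'// -(isom_ham Ifj hyd'); lra.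
Qed.

End LocalDataOfClosed.

(** * Isomorphic manifolds have the same local data *)

Section IsomorphicData.
Context (R : realType) (n : nat).
Implicit Types (M N P : ham_manifold R n) (L : local_data R n).
Local Notation band_iso a b f := (isom_on (between a b) (between a b) f).

Lemma act_invariantT M : act_invariant [set: M].
Proof. by []. Qed.

Lemma isomorphic_sym M N : isomorphic M N -> isomorphic N M.
Proof.
case=> f If; have [||g [Ig _ _]] := isom_inv _ _ (@act_invariantT M) If.
- exact: openT.
- exact: openT.
- by exists g.
Qed.

Lemma isomorphic_critical_value M N : isomorphic M N ->
  forall mu, critical_value M mu -> critical_value N mu.
Proof.
case=> f If mu [x crx <-]; exists (f x); last exact: (isom_ham If).
by apply: (isom_critical _ _ (@act_invariantT M) If) => //; exact: openT.
Qed.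

(** The levels are recovered from the critical values. All germ and slice maps are conjugates of one
    isomorphism [F], which is why the same family serves in every gluing square. *)
Lemma isomorphic_same_local_data L L' M M' :
  has_local_data M L -> has_local_data M' L' -> isomorphic M M' ->
  same_local_data L L'.
Proof.
move=> hL hL' iso.
have [cr [d1 [f1 [g1 [Hf1 Hg1 Hu1 Hd1]]]]] := hL.
have [cr' [d2 [f2 [g2 [Hf2 Hg2 Hu2 Hd2]]]]] := hL'.
have [sE lE] : ld_s L = ld_s L' /\
    forall i, (i <= (ld_s L).+1)%N -> ld_level L i = ld_level L' i.
  apply: increasing_enum_unique; [exact: ld_level_lt|exact: ld_level_lt|] => v.
  split=> [/cr/(isomorphic_critical_value iso)/cr'//|].
  by move=> /cr'/(isomorphic_critical_value (isomorphic_sym iso))/cr.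
have [F IF] := iso.
have bandF a b : band_iso a b F.
  by apply: (isom_between_sub _ _ IF) => //; exact: openT.
pose l := ld_level L; pose s := ld_s L.
have S' i : (i <= s.+1)%N -> (i <= (ld_s L').+1)%N by rewrite -sE.
have J' j : (j <= s)%N -> (j <= ld_s L')%N by rewrite -sE.
have s1 j : (j <= s)%N -> (j <= s.+1)%N by exact: leqW.
have lE' i : (i <= s.+1)%N -> ld_level L' i = l i by move=> iS; rewrite /l lE.
pose d i := Num.min (d1 i) (d2 i).
have d0 i : (i <= s.+1)%N -> 0 < d i.
  move=> iS; rewrite lt_min; have [/andP[-> _] _] := Hf1 i iS.
  by have [/andP[-> _] _] := Hf2 i (S' i iS).
have dd1 i : d i <= d1 i by rewrite ge_min lexx.
have dd2 i : d i <= d2 i by rewrite ge_min lexx orbT.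
have I1 i : (i <= s.+1)%N -> band_iso (l i - d i) (l i + d i) (f1 i).
  by move=> iS; have [_ If] := Hf1 i iS; have := dd1 i => dd;
    apply: band_iso_sub If _ _; rewrite -/l; lra.
have I2 i : (i <= s.+1)%N -> band_iso (l i - d i) (l i + d i) (f2 i).
  by move=> iS; have [_ If] := Hf2 i (S' i iS); have := dd2 i => dd;
    apply: band_iso_sub If _ _; rewrite lE'//; lra.
have F2 i : exists fi : M' -> ld_germ L' i, (i <= s.+1)%N ->
    band_iso (l i - d i) (l i + d i) fi /\
    forall y, between (l i - d i) (l i + d i) y -> f2 i (fi y) = y.
  have [iS|iS] := boolP (i <= s.+1)%N; last first.
    by have [y _] := hm_nonempty (ld_germ L' i); exists (fun=> y).
  by have [fi [Ifi _ Kfi]] := band_iso_inv (I2 i iS); exists fi.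
pose phi2 i := projT1 (cid (F2 i)); have Hphi2 i :
  (i <= s.+1)%N -> band_iso (l i - d i) (l i + d i) (phi2 i) /\
    forall y, between (l i - d i) (l i + d i) y -> f2 i (phi2 i y) = y :=
  projT2 (cid (F2 i)).
have G2 j : exists gj : M' -> ld_slice L' j, (j <= s)%N ->
    band_iso (l j) (l j.+1) gj /\ forall y, gj (g2 j y) = y.
  have [js|js] := boolP (j <= s)%N; last first.
    by have [y _] := hm_nonempty (ld_slice L' j); exists (fun=> y).
  have := Hg2 j (J' j js); rewrite slice_setT ?J'// => /band_iso_inv[gj].
  rewrite (lE' j (s1 j js)) (lE' j.+1 js) => -[Igj Kgj _].
  exists gj; split => // y; apply: Kgj.
  by have := slice_ham y (J' j js); rewrite (lE' j (s1 j js)) (lE' j.+1 js).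
pose psi2 j := projT1 (cid (G2 j)); have Hpsi2 j :
  (j <= s)%N -> band_iso (l j) (l j.+1) (psi2 j) /\ forall y, psi2 j (g2 j y) = y :=
  projT2 (cid (G2 j)).
split => //; exists d, (fun i => phi2 i \o F \o f1 i), (fun j => psi2 j \o F \o g1 j).
split => [i iS|j js|j js y yj|j js y yj].
- split; first rewrite d0//= lt_min.
    apply/andP; split.
      by apply: le_lt_trans (dd1 i) _; have [/andP[_ ->]] := Hf1 i iS.
    by apply: le_lt_trans (dd2 i) _; have [/andP[_ ->]] := Hf2 i (S' i iS).
  have [Ip _] := Hphi2 i iS.
  by apply: band_iso_comp (I1 i iS) _; apply: band_iso_comp (bandF _ _) Ip.
- have [Ip _] := Hpsi2 j js.
  rewrite /slice_iso slice_setT// slice_setT ?J'// (lE' j (s1 j js)) (lE' j.+1 js).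
  have := Hg1 j js; rewrite slice_setT// => Ig.
  by apply: band_iso_comp Ig _; apply: band_iso_comp (bandF _ _) Ip.
- have jS := s1 _ js.
  have [Ip Kp] := Hphi2 j jS; have [_ Kps] := Hpsi2 j js.
  have yb1 : between (l j) (l j + d1 j) y.
    by move: yj; have := dd1 j; rewrite /between /= -/l; lra.
  have yb : between (l j - d j) (l j + d j) y.
    by move: yj; have := d0 j jS; rewrite /between /= -/l; lra.
  rewrite /= Hu1//; set z := F (f1 j y).
  have zb : between (l j - d j) (l j + d j) z.
    by apply: (isom_fun (bandF _ _)); exact: isom_fun (I1 j jS) _ yb.
  rewrite -{1}(Kp z zb) -Hu2 ?J'// ?Kps//.
  have : hm_ham (phi2 j z) = hm_ham y.
    by rewrite (isom_ham Ip zb) (isom_ham IF)// (isom_ham (I1 j jS)).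
  by move: yj; have := dd2 j; rewrite /between /= lE'// -/l => dd + ->; lra.
- have jS : (j.+1 <= s.+1)%N := js.
  have [Ip Kp] := Hphi2 j.+1 jS; have [_ Kps] := Hpsi2 j js.
  have yb1 : between (l j.+1 - d1 j.+1) (l j.+1) y.
    by move: yj; have := dd1 j.+1; rewrite /between /= -/l; lra.
  have yb : between (l j.+1 - d j.+1) (l j.+1 + d j.+1) y.
    by move: yj; have := d0 j.+1 jS; rewrite /between /= -/l; lra.
  rewrite /= Hd1//; set z := F (f1 j.+1 y).
  have zb : between (l j.+1 - d j.+1) (l j.+1 + d j.+1) z.
    by apply: (isom_fun (bandF _ _)); exact: isom_fun (I1 j.+1 jS) _ yb.
  rewrite -{1}(Kp z zb) -Hd2 ?J'// ?Kps//.
  have : hm_ham (phi2 j.+1 z) = hm_ham y.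
    by rewrite (isom_ham Ip zb) (isom_ham IF)// (isom_ham (I1 j.+1 jS)).
  by move: yj; have := dd2 j.+1; rewrite /between /= lE'// -/l => dd + ->; lra.
Qed.

End IsomorphicData.

(** * Gluing Hamiltonian manifolds *)

(* The glued manifold is the subset of gl_U covered by the images of the pieces
   gl_A i. With gl_U = gl_P i and gl_j = id for a single i, this turns an open
   subset into a manifold. gl_sep concerns only points that the Hamiltonian
   does not separate. *)
Record gluing (R : realType) (n : nat) := Gluing {
  gl_I : countType;
  gl_P : gl_I -> ham_manifold R n;
  gl_A : forall i, set (gl_P i);
  gl_U : Type;
  gl_j : forall i, gl_P i -> gl_U;
  gl_nonempty : exists i, @gl_A i !=set0;
  gl_open : forall i, open (@gl_A i);
  gl_inv : forall i, act_invariant (@gl_A i);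
  gl_inj : forall i (x y : gl_P i),
    @gl_A i x -> @gl_A i y -> gl_j x = gl_j y -> x = y;
  gl_trans : forall i k, exists tau : gl_P i -> gl_P k,
    let B := @gl_A i `&` [set x | exists2 y, @gl_A k y & gl_j y = gl_j x] in
    let B' := @gl_A k `&` [set y | exists2 x, @gl_A i x & gl_j x = gl_j y] in
    [/\ open B, act_invariant B, isom_on B B' tau & forall x, B x -> gl_j (tau x) = gl_j x];
  gl_sep : forall i k (x : gl_P i) (y : gl_P k),
    @gl_A i x -> @gl_A k y -> hm_ham x = hm_ham y ->
    exists l (x' y' : gl_P l),
      [/\ @gl_A l x', @gl_A l y', gl_j x' = gl_j x & gl_j y' = gl_j y] }.

Arguments gl_A {R n} g i _.
Arguments gl_P {R n} g i.

Section GlueTopology.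
Context (R : realType) (n : nat) (G : gluing R n).
Local Notation I := (gl_I G).
Local Notation P := (gl_P G).
Local Notation A := (gl_A G).

(** Points to be identified have equal images under [gl_j], so a subset of [gl_U] takes the place of
    the quotient. *)
Definition glue_space : Type :=
  {u : gl_U G | exists i (x : P i), A i x /\ gl_j x = u}.

HB.instance Definition _ := gen_eqMixin glue_space.
HB.instance Definition _ := gen_choiceMixin glue_space.

Lemma glue_val_inj (s t : glue_space) : sval s = sval t -> s = t.
Proof. exact: eq_sig_hprop => ? ? ?; exact: Prop_irrelevance. Qed.

Lemma glue_inhabited : exists t : glue_space, True.
Proof.
have [i [x Ax]] := gl_nonempty G.
by exists (exist _ (gl_j x) (ex_intro _ i (ex_intro _ x (conj Ax erefl)))).
Qed.

Definition glue_inj i (x : P i) : glue_space :=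
  match pselect (exists k (y : P k), A k y /\ gl_j y = gl_j x) with
  | left e => exist _ (gl_j x) e
  | right _ => projT1 (cid glue_inhabited)
  end.

Lemma glue_injE i x : A i x -> sval (glue_inj x) = gl_j x.
Proof.
move=> Ax; rewrite /glue_inj; case: pselect => // -[].
by exists i, x.
Qed.

Lemma glue_injP i k x y : A i x -> A k y ->
  glue_inj x = glue_inj y <-> gl_j x = gl_j y.
Proof.
move=> Ax Ay; split=> [E|E]; first by rewrite -glue_injE// -(glue_injE Ay) E.
by apply: glue_val_inj; rewrite !glue_injE.
Qed.

Lemma glue_inj_inj i x y : A i x -> A i y -> glue_inj x = glue_inj y -> x = y.
Proof. by move=> Ax Ay /glue_injP => /(_ Ax Ay); exact: gl_inj. Qed.

Lemma glue_cover (t : glue_space) : exists i (x : P i), A i x /\ glue_inj x = t.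
Proof.
have [i [x [Ax xt]]] := svalP t; exists i, x; split => //.
by apply: glue_val_inj; rewrite glue_injE.
Qed.

Definition glue_piece i : set glue_space := @glue_inj i @` A i.

Definition glue_proj i (t : glue_space) : P i :=
  match pselect (glue_piece i t) with
  | left e => projT1 (cid2 e)
  | right _ => projT1 (cid (hm_nonempty (P i)))
  end.

Lemma glue_projP i t : glue_piece i t -> A i (glue_proj i t) /\ glue_inj (glue_proj i t) = t.
Proof. by move=> it; rewrite /glue_proj; case: pselect => // e; case: cid2. Qed.

Lemma glue_projK i x : A i x -> glue_proj i (glue_inj x) = x.
Proof.
move=> Ax; have it : glue_piece i (glue_inj x) by exists x.
by have [Ap E] := glue_projP it; exact: glue_inj_inj E.
Qed.

Definition glue_overlap i k : set (P i) := A i `&` @glue_inj i @^-1` glue_piece k.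

Arguments glue_overlap : clear implicits.

Lemma glue_overlapE i k : glue_overlap i k =
  A i `&` [set x | exists2 y, A k y & gl_j y = gl_j x].
Proof.
apply/seteqP; split => x [Ax [y Ay E]]; split => //; exists y => //.
  exact/(glue_injP Ay Ax).
exact/(glue_injP Ay Ax).
Qed.

Lemma glue_transition i k : exists tau : P i -> P k,
  isom_on (glue_overlap i k) (glue_overlap k i) tau /\
  forall x, glue_overlap i k x -> glue_inj (tau x) = glue_inj x.
Proof.
have [tau /=] := gl_trans i k; rewrite -!glue_overlapE => -[_ _ It Et].
exists tau; split => // x ox; have [Ax _] := ox.
have [At _] := isom_fun It ox.
by apply/(glue_injP At Ax)/Et; move: ox; rewrite glue_overlapE.
Qed.

Lemma glue_overlap_open i k : open (glue_overlap i k).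
Proof. by have [tau /=] := gl_trans i k; rewrite -!glue_overlapE => -[]. Qed.

Lemma glue_overlap_inv i k : act_invariant (glue_overlap i k).
Proof. by have [tau /=] := gl_trans i k; rewrite -!glue_overlapE => -[]. Qed.

(** The final topology: the finest one for which all pieces map in continuously. *)
Definition glue_open (V : set glue_space) : Prop :=
  forall i, open (A i `&` @glue_inj i @^-1` V).

Lemma glue_openT : glue_open setT.
Proof. by move=> i; rewrite preimage_setT setIT; exact: gl_open. Qed.

Lemma glue_openI : setI_closed glue_open.
Proof.
move=> V W oV oW i; rewrite preimage_setI.
by rewrite -(setIid (A i)) setIACA; apply: openI; [exact: oV|exact: oW].
Qed.

Lemma glue_open_bigU (J : Type) (f : J -> set glue_space) :
  (forall j, glue_open (f j)) -> glue_open (\bigcup_j f j).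
Proof.
move=> of_ i; rewrite preimage_bigcup setI_bigcupr.
by apply: bigcup_open => j _; exact: of_.
Qed.

HB.instance Definition _ :=
  isOpenTopological.Build glue_space glue_openT glue_openI glue_open_bigU.

Lemma glue_openE (V : set glue_space) : open V = glue_open V.
Proof. by []. Qed.

(** Seen from another piece [k], the image of [W] is the preimage of [W] under the transition from
    [k] to [i], which is continuous. *)
Lemma glue_inj_open i (W : set (P i)) : open W -> W `<=` A i ->
  open (@glue_inj i @` W).
Proof.
move=> oW WA; rewrite glue_openE => k.
have [tau [It Et]] := glue_transition k i.
rewrite (_ : _ `&` _ = glue_overlap k i `&` tau @^-1` W).
  apply: smooth_map_preimage_open (isom_smooth It) oW.
  exact: glue_overlap_open.
apply/seteqP; split => x.
  move=> [Ax [y Wy yx]]; have ox : glue_overlap k i x by split => //; exists y => //; exact: WA.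
  split => //=; have [At _] := isom_fun It ox.
  suff -> : tau x = y by [].
  by apply: glue_inj_inj => //; [exact: WA|rewrite Et].
by move=> [ox Wt]; split; [case: ox|exists (tau x) => //; exact: Et].
Qed.

Lemma glue_piece_open i : open (glue_piece i).
Proof. by apply: glue_inj_open => //; exact: gl_open. Qed.

Lemma glue_inj_cont i x : A i x -> {for x, continuous (@glue_inj i)}.
Proof.
move=> Ax V; rewrite nbhsE => -[V' [oV' V'x] V'V].
have := oV'; rewrite glue_openE => /(_ i) oi.
apply: filterS (open_nbhs_nbhs (conj oi (conj Ax V'x))) => y [_ /V'V].
exact.
Qed.

Lemma glue_proj_cont i t : glue_piece i t -> {for t, continuous (glue_proj i)}.
Proof.
move=> it W; rewrite nbhsE => -[W' [oW' W't] W'W].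
have [Ap E] := glue_projP it.
have oV : open (@glue_inj i @` (A i `&` W')).
  by apply: glue_inj_open; [apply: openI => //; exact: gl_open|exact: subIsetl].
apply: filterS (open_nbhs_nbhs (conj oV _)).
  by move=> _ [y [Ay W'y] <-]; apply: W'W; rewrite glue_projK.
by exists (glue_proj i t).
Qed.

Definition glue_ham (t : glue_space) : R :=
  hm_ham (projT1 (cid (projT2 (cid (glue_cover t))))).

Lemma glue_pieces_agree i k x y : A i x -> A k y -> glue_inj x = glue_inj y ->
  exists tau : P i -> P k, [/\ isom_on (glue_overlap i k) (glue_overlap k i) tau,
    forall z, glue_overlap i k z -> glue_inj (tau z) = glue_inj z,
    glue_overlap i k x & tau x = y].
Proof.
move=> Ax Ay E; have [tau [It Et]] := glue_transition i k.
have ox : glue_overlap i k x by split => //; exists y.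
exists tau; split => //; have [At _] := isom_fun It ox.
by apply: glue_inj_inj => //; rewrite Et.
Qed.

Lemma glue_hamE i x : A i x -> glue_ham (glue_inj x) = hm_ham x.
Proof.
move=> Ax; rewrite /glue_ham; case: cid => k /= ex; case: cid => y /= [Ay E].
have [tau [It _ ox tx]] := glue_pieces_agree Ay Ax E.
by rewrite -tx (isom_ham It).
Qed.

Definition glue_act (s : R) (t : glue_space) : glue_space :=
  glue_inj (hm_act s (projT1 (cid (projT2 (cid (glue_cover t)))))).

Lemma glue_actE s i x : A i x -> glue_act s (glue_inj x) = glue_inj (hm_act s x).
Proof.
move=> Ax; rewrite /glue_act; case: cid => k /= ex; case: cid => y /= [Ay E].
have [tau [It Et oy tx]] := glue_pieces_agree Ay Ax E.
by rewrite -tx -(isom_equivariant It)// Et//; exact: glue_overlap_inv.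
Qed.

Lemma glue_ham_cont : continuous glue_ham.
Proof.
move=> t; have [i [x [Ax <-]]] := glue_cover t.
have it : glue_piece i (glue_inj x) by exists x.
rewrite /continuous_at glue_hamE//.
have H : ((@hm_ham _ _ (P i)) \o glue_proj i) @ (glue_inj x) --> hm_ham x.
  have := continuous_comp (glue_proj_cont it) (@ham_continuous _ _ (P i) _).
  by rewrite /prop_for /continuous_at /= glue_projK.
apply: cvg_trans H; apply: (@near_eq_cvg _ _ (nbhs (glue_inj x))); near=> u.
have iu : glue_piece i u.
  by near: u; apply: open_nbhs_nbhs; split => //; exact: glue_piece_open.
have [Ap E] := glue_projP iu.
by rewrite /= -{2}E glue_hamE.
Unshelve. all: by end_near. Qed.

Lemma glue_hausdorff : hausdorff_space glue_space.
Proof.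
rewrite open_hausdorff => s t st.
have [hst|hst] := eqVneq (glue_ham s) (glue_ham t).
  have [i [x [Ax xs]]] := glue_cover s; have [k [y [Ay yt]]] := glue_cover t.
  have hxy : hm_ham x = hm_ham y by rewrite -(glue_hamE Ax) -(glue_hamE Ay) xs yt.
  have [l [x' [y' [Ax' Ay' E1 E2]]]] := gl_sep Ax Ay hxy.
  have xs' : glue_inj x' = s by rewrite -xs; exact/glue_injP.
  have yt' : glue_inj y' = t by rewrite -yt; exact/glue_injP.
  have xy' : x' != y' by apply: contraNneq st => E; rewrite -xs' -yt' E.
  have := @mf_hausdorff _ _ (P l); rewrite open_hausdorff => /(_ _ _ xy').
  move=> [[V W] /= [xV yW] [oV oW VW]].
  exists (@glue_inj l @` (A l `&` V), @glue_inj l @` (A l `&` W)) => /=.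
    rewrite !inE in xV yW *.
    by split; [exists x'|exists y'].
  split.
  - by apply: glue_inj_open; [apply: openI => //; exact: gl_open|exact: subIsetl].
  - by apply: glue_inj_open; [apply: openI => //; exact: gl_open|exact: subIsetl].
  - apply/eqP/seteqP; split => // _ [[z [Az Vz] <-] [z' [Az' Wz']]].
    move/(glue_inj_inj Az' Az) => zz; move/eqP/seteqP: VW => [/(_ z) + _].
    by apply; split => //; rewrite -zz.
have sep (a b : R) : a < b -> forall s t, glue_ham s = a -> glue_ham t = b ->
    exists2 AB : set glue_space * set glue_space, (s \in AB.1 /\ t \in AB.2) &
      [/\ open AB.1, open AB.2 & AB.1 `&` AB.2 == set0].
  move=> ab s' t' sa tb; pose c := (a + b) / 2.
  exists (glue_ham @^-1` [set x | x < c], glue_ham @^-1` [set x | c < x]) => /=.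
    by rewrite !inE /= sa tb /c; split; lra.
  split.
  - by apply: open_comp; [move=> ? _; exact: glue_ham_cont|exact: open_lt].
  - by apply: open_comp; [move=> ? _; exact: glue_ham_cont|exact: open_gt].
  - by apply/eqP/seteqP; split => // z [/= z1 z2]; have := lt_trans z1 z2; rewrite ltxx.
have [lt|lt|E] := ltgtP (glue_ham s) (glue_ham t).
- exact: sep lt _ _ erefl erefl.
- have [[V W] /= [tV sW] [oV oW VW]] := sep _ _ lt _ _ erefl erefl.
  by exists (W, V) => /=; split => //; rewrite setIC.
- by rewrite E eqxx in hst.
Qed.

Lemma glue_countable : @second_countable glue_space.
Proof.
pose B i := projT1 (cid2 (@mf_countable _ _ (P i))).
have cB i : countable (B i) by rewrite /B; case: cid2.
have bB i : basis (B i) by rewrite /B; case: cid2.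
exists (\bigcup_i ((fun b => @glue_inj i @` (A i `&` b)) @` B i)).
  apply: bigcup_countable; first exact: countableP.
  by move=> i _; apply: card_le_trans (cB i); exact: card_image_le.
split=> [_ [i _ [b Bb <-]]|t V].
  apply: glue_inj_open; last exact: subIsetl.
  by apply: openI; [exact: gl_open|exact: (bB i).1].
have [i [x [Ax <-]]] := glue_cover t => nV.
have nW : nbhs x (A i `&` @glue_inj i @^-1` V).
  apply: filterI; first by apply: open_nbhs_nbhs; split => //; exact: gl_open.
  exact: glue_inj_cont nV.
have [b [Bb bx] bW] := (bB i).2 x _ nW.
exists (@glue_inj i @` (A i `&` b)).
  by split; [exists i => //; exists b|exists x].
by move=> _ [y [Ay By] <-]; have [] := bW y By.
Qed.

Definition glue_chart i (c : chart R n.*2 (P i)) : chart R n.*2 glue_space :=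
  Chart (@glue_inj i @` (A i `&` chart_dom c)) (c \o glue_proj i)
        (@glue_inj i \o chart_inv c).

Definition glue_atlas : set (chart R n.*2 glue_space) :=
  [set d | exists i (c : chart R n.*2 (P i)), mf_atlas c /\ d = glue_chart c].

Lemma glue_chart_image i (c : chart R n.*2 (P i)) (V : set glue_space) :
  glue_chart c @` (chart_dom (glue_chart c) `&` V) =
  c @` (chart_dom c `&` (A i `&` @glue_inj i @^-1` V)).
Proof.
apply/seteqP; split => [_ [_ [[x [Ax dx] <-] Vx] <-]|_ [x [dx [Ax Vx]] <-]].
  by exists x => //=; rewrite glue_projK.
by exists (glue_inj x) => //=; [split => //; exists x|rewrite glue_projK].
Qed.

Lemma glue_chart_img i (c : chart R n.*2 (P i)) :
  chart_img (glue_chart c) = c @` (chart_dom c `&` A i).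
Proof. by rewrite /chart_img -[chart_dom _]setIT glue_chart_image preimage_setT setIT. Qed.

Lemma glue_is_chart d : glue_atlas d -> is_chart d.
Proof.
move=> [i [c [ac ->]]]; have cc := mf_is_chart ac.
have od : open (chart_dom (glue_chart c)).
  apply: glue_inj_open; last exact: subIsetl.
  by apply: openI; [exact: gl_open|exact: chart_dom_open].
have oi : open (chart_img (glue_chart c)).
  by rewrite glue_chart_img; apply: chart_image_open => //; exact: gl_open.
split => //.
- by move=> _ [x [Ax dx] <-] /=; rewrite glue_projK// (chartK cc).
- apply/(within_continuousE _ od) => _ [x [Ax dx] <-].
  apply: (@continuous_comp _ _ _ (glue_proj i) c).
    by apply: glue_proj_cont; exists x.
  by rewrite glue_projK//; exact: chart_cont cc _ dx.
- rewrite within_continuousE// glue_chart_img => _ [x [dx Ax] <-].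
  apply: (@continuous_comp _ _ _ (chart_inv c) (@glue_inj i)).
    by apply: chart_inv_cont => //; exists x.
  by rewrite (chartK cc)//; exact: glue_inj_cont.
Qed.

Lemma glue_atlas_cover t : exists2 d, glue_atlas d & chart_dom d t.
Proof.
have [i [x [Ax <-]]] := glue_cover t; have [c ac dx] := mf_cover x.
by exists (glue_chart c); [exists i, c|exists x].
Qed.

(** Passing from one piece to another through the glued space is the transition [tau]. This turns
    statements in the glued charts into statements about [tau] in charts of the pieces. *)
Lemma glue_rep_near i k (c : chart R n.*2 (P i)) (tau : P i -> P k) x :
  mf_atlas c -> chart_dom c x -> glue_overlap i k x ->
  isom_on (glue_overlap i k) (glue_overlap k i) tau ->
  (forall z, glue_overlap i k z -> glue_inj (tau z) = glue_inj z) ->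
  \forall u \near c x, glue_proj k (glue_inj (chart_inv c u)) = tau (chart_inv c u).
Proof.
move=> ac dx ox It Et; have cc := mf_is_chart ac.
have := chart_inv_near cc dx (open_nbhs_nbhs (conj (glue_overlap_open i k) ox)).
apply: filterS => u ou; have [At _] := isom_fun It ou.
by rewrite -Et// glue_projK.
Qed.

Lemma glue_chart_transition d d' : glue_atlas d -> glue_atlas d' ->
  smooth_on (d @` (chart_dom d `&` chart_dom d')) (d' \o chart_inv d).
Proof.
move=> [i [c [ac ->]]] [k [c' [ac' ->]]] m; rewrite glue_chart_image.
apply: ndiff_on_point => _ [x [dx [Ax [y [Ay dy] yx]]] <-].
have ox : glue_overlap i k x by split => //; exists y.
have [tau [It Et]] := glue_transition i k.
have [At _] := isom_fun It ox.
have tx : tau x = y by apply: glue_inj_inj => //; rewrite Et.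
apply: (@ndiff_on_near _ _ _ _ _ (local_rep c c' tau)).
  move=> _ ->; have := glue_rep_near ac dx ox It Et.
  by apply: filterS => u; rewrite /local_rep /= => ->.
apply: ndiff_on_sub ((isom_smooth It).2 _ _ ac ac' m) => _ ->.
by exists x => //; split => //=; rewrite tx.
Qed.

Definition glue_mf : manifold R n.*2 :=
  Manifold glue_hausdorff glue_countable glue_is_chart glue_atlas_cover
    glue_chart_transition.

End GlueTopology.

Arguments glue_overlap {R n G} i k _.

(** The action is smooth in time and point together; freezing the time is composition with the
    affine embedding of [u] as [(t, u)]. *)
Lemma act_smooth_map (R : realType) (n : nat) (M : ham_manifold R n) (B : set M) t :
  open B -> smooth_map B (@hm_act _ _ M t).
Proof.
move=> oB; split; first by rewrite within_continuousE// => x _; exact: act_cont.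
move=> c c' ac ac' k.
have lin : linear (fun u : 'rV[R]_n.*2 => (0, u) : R * 'rV[R]_n.*2).
  by move=> a u v; congr pair; rewrite /= scaler0 addr0.
pose lM := GRing.isLinear.Build _ _ _ _ _ lin.
pose l : {linear 'rV[R]_n.*2 -> (R * 'rV[R]_n.*2)%type} :=
  HB.pack (fun u : 'rV[R]_n.*2 => (0, u) : R * 'rV[R]_n.*2) lM.
have cl : continuous l.
  move=> u; exact: (@cvg_pair _ _ _ (nbhs u) (nbhs (0 : R)) (nbhs u) _ _ _
    (fun=> 0) id (cvg_cst _) cvg_id).
have E : local_rep c c' (@hm_act _ _ M t) =
    (fun u => (fun p : R * 'rV[R]_n.*2 => c' (hm_act p.1 (chart_inv c p.2))) (l u + (t, 0))).
  by apply/funext => u; rewrite /local_rep /= add0r addr0.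
rewrite E; apply: (ndiff_on_affine (b := (t, 0)) cl) (act_smooth (hm_action M) ac ac' k).
move=> _ [x [[dx Bx] dtx] <-]; rewrite /= add0r addr0 (chartK (mf_is_chart ac))//.
by split => //; exists x.
Qed.

(** * Form, action and Hamiltonian on the glued space *)

Section GlueHamiltonian.
Context (R : realType) (n : nat) (G : gluing R n).
Local Notation I := (gl_I G).
Local Notation P := (gl_P G).
Local Notation A := (gl_A G).
Local Notation T := (glue_mf G).

(** A chart of the glued space may arise from several pairs of a piece and a chart of it. One pair
    is selected, and the invariance of the forms under transitions makes the selection harmless. *)
Definition glue_form : form_data T := fun d =>
  match pselect (@glue_atlas R n G d) with
  | left e => @hm_form _ _ (P (projT1 (cid e))) (projT1 (cid (projT2 (cid e))))
  | right _ => fun=> 0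
  end.

Lemma glue_formP (d : chart R n.*2 T) : mf_atlas d ->
  exists i (c : chart R n.*2 (P i)),
    [/\ mf_atlas c, d = glue_chart c & glue_form d = @hm_form _ _ (P i) c].
Proof.
move=> ad; rewrite /glue_form; case: pselect => // e.
by case: cid => i /= ex; case: cid => c /= [ac E]; exists i, c.
Qed.

(** Stated for maps that act piece by piece, so as to serve twice: the identity gives compatibility
    of the form between charts, and [glue_act t] gives its invariance under the circle. *)
Lemma glue_pulls_back (F : T -> T) (f : forall i, P i -> P i) :
  (forall i x, A i x -> A i (f i x)) ->
  (forall i, smooth_map (A i) (f i)) ->
  (forall i, pulls_back (@hm_form _ _ (P i)) (@hm_form _ _ (P i)) (A i) (f i)) ->
  (forall i x, A i x -> F (glue_inj x) = glue_inj (f i x)) ->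
  pulls_back glue_form glue_form setT F.
Proof.
move=> fA sf pf FE d d' t ad ad' _.
have [i [c [ac dE fdE]]] := glue_formP ad.
have [k [c' [ac' dE' fdE']]] := glue_formP ad'.
rewrite /eval_form {}fdE {}fdE' {}dE {}dE'.
move=> [x [Ax dx] <-] [y [Ay dy] yF] v w; rewrite FE// in yF *.
have ofx : glue_overlap i k (f i x) by split; [exact: fA|exists y].
have [tau [It Et]] := glue_transition i k.
have [At _] := isom_fun It ofx.
have tx : tau (f i x) = y by apply: glue_inj_inj => //; rewrite Et.
pose B := A i `&` f i @^-1` glue_overlap i k.
have oO := @glue_overlap_open _ _ G i k.
have oB : open B by apply: smooth_map_preimage_open (sf i) oO; exact: gl_open.
have oA := @gl_open _ _ G i.
have BA : B `<=` A i by exact: subIsetl.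
have sB := smooth_map_sub oB oA BA (sf i).
have Bx : B x by [].
have BO z : B z -> glue_overlap i k (f i z) by case.
have := pulls_back_comp oB BO sB (isom_smooth It) (pulls_back_sub BA (pf i)) (isom_form It).
move=> /(_ c c' x ac ac' Bx dx); rewrite /= tx => /(_ dy v w).
rewrite /eval_form => E; rewrite /= -yF (glue_projK Ax) (glue_projK Ay) -E.

have E' : \forall u \near c x, local_rep c c' (tau \o f i) u =
    local_rep (glue_chart c) (glue_chart c') F u.
  have := chart_inv_near (mf_is_chart ac) dx (open_nbhs_nbhs (conj oB Bx)).
  apply: filterS => u [Au ou]; rewrite /local_rep /= FE//.
  have [Atu _] := isom_fun It ou.
  by rewrite -Et// glue_projK.
by rewrite !(near_eq_derive _ E').
Qed.

Lemma glue_symplectic : Defs.is_symplectic glue_form.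
Proof.
split.
- apply: (@glue_pulls_back id (fun i => id)) => // i.
    by apply: smooth_map_id; exact: gl_open.
  exact: pulls_back_sub (symp_compat (hm_symplectic (P i))).
- move=> d ad; have [i [c [ac -> ->]]] := glue_formP ad.
  apply: smooth_on_sub (symp_smooth (hm_symplectic (P i)) ac).
  by rewrite glue_chart_img => _ [x [dx _] <-]; exists x.
- move=> d u ad; have [i [c [ac dE fE]]] := glue_formP ad.
  rewrite /eval_form {}fE {}dE glue_chart_img => -[x [dx Ax] <-] v.
  by apply: (symp_alt (hm_symplectic (P i)) ac); exists x.
- move=> d u ad; have [i [c [ac dE fE]]] := glue_formP ad.
  rewrite /eval_form {}fE {}dE glue_chart_img => -[x [dx Ax] <-] v.
  by apply: (symp_nondeg (hm_symplectic (P i)) ac); exists x.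
- move=> d u ad; have [i [c [ac dE fE]]] := glue_formP ad.
  rewrite /eval_form {}fE {}dE glue_chart_img => -[x [dx Ax] <-] v1 v2 v3.
  by apply: (symp_closed (hm_symplectic (P i)) ac); exists x.
Qed.

Lemma glue_act_cont : continuous (fun p : R * T => glue_act p.1 p.2).
Proof.
move=> [s t] /=; have [i [x [Ax <-]]] := glue_cover t.
have it : glue_piece i (glue_inj x) by exists x.
rewrite /continuous_at /= glue_actE//.
have As : A i (hm_act s x) by exact: gl_inv.
have H : (fun p : R * T => glue_inj (hm_act p.1 (glue_proj i p.2))) @
    (s, (glue_inj x : T)) --> glue_inj (hm_act s x).
  apply: (@cvg_comp _ _ _ (fun p : R * T => hm_act p.1 (glue_proj i p.2))
     (@glue_inj _ _ G i) _ (nbhs (hm_act s x))); last exact: glue_inj_cont.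
  rewrite -[X in hm_act s X](glue_projK Ax).
  apply: (@cvg_comp _ _ _ (fun p : R * T => (p.1, glue_proj i p.2))
     (fun q : R * P i => hm_act q.1 q.2) _ _ _ _
     (@act_continuous _ _ _ _ (hm_action (P i)) (s, glue_proj i (glue_inj x)))).
  apply: (@cvg_pair _ _ _ _ (nbhs s) (nbhs (glue_proj i (glue_inj x))) _ _ _
     (fun p : R * T => p.1) (fun p : R * T => glue_proj i p.2)).
    exact: cvg_fst.
  apply: (@cvg_comp _ _ _ snd (glue_proj i)); first exact: cvg_snd.
  exact: glue_proj_cont it.
apply: cvg_trans H; apply: (@near_eq_cvg _ _ (nbhs (s, (glue_inj x : T)))).
have Hn : \forall p \near (s, (glue_inj x : T)), glue_piece i p.2.
  apply: (@cvg_snd _ _ (nbhs s) (nbhs (glue_inj x : T))).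
  by apply: open_nbhs_nbhs; split => //; exact: glue_piece_open.
apply: filterS Hn => p ip; have [Ap E] := glue_projP ip.
by rewrite -{2}E glue_actE.
Qed.

Lemma glue_act_smooth (d d' : chart R n.*2 T) : mf_atlas d -> mf_atlas d' ->
  smooth_on [set p : R * 'rV[R]_n.*2 | chart_img d p.2 /\
               chart_dom d' (glue_act p.1 (chart_inv d p.2))]
            (fun p => d' (glue_act p.1 (chart_inv d p.2))).
Proof.
move=> [i [c [ac ->]]] [k [c' [ac' ->]]] m.
apply: ndiff_on_point => -[s u]; rewrite /= glue_chart_img => -[[x [dx Ax] xu] [z [Az dz] zs]].
subst u; rewrite (chartK (mf_is_chart ac))// glue_actE// in zs.
have cc := mf_is_chart ac.
have As : A i (hm_act s x) by exact: gl_inv.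
have [tau [It Et]] := glue_transition i k.
pose O := glue_overlap i k.
have oO : open O by exact: glue_overlap_open.
have os : O (hm_act s x) by split => //; exists z.
have [At _] := isom_fun It os.
have tx : tau (hm_act s x) = z by apply: glue_inj_inj => //; rewrite Et.
(* A third chart, around the moved point: the action leads from [c] to it inside the piece [i], and
   [tau] leads from it to [c']. *)
have [c'' ac'' dy] := mf_cover (hm_act s x); have cc'' := mf_is_chart ac''.
have cc' := mf_is_chart ac'.
pose V := chart_dom c'' `&` (O `&` tau @^-1` chart_dom c').
have oV : open V.
  apply: openI; first exact: chart_dom_open.
  by apply: smooth_map_preimage_open (isom_smooth It) _ => //; exact: chart_dom_open.
pose act2 (p : R * 'rV[R]_n.*2) : P i := hm_act p.1 (chart_inv c p.2).
pose D := [set p : R * 'rV[R]_n.*2 | (c @` (chart_dom c `&` A i)) p.2].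
have oD : open D.
  apply: open_comp; first by move=> p _; exact: cvg_snd.
  by apply: chart_image_open => //; exact: gl_open.
have Dimg p : D p -> chart_img c p.2 by move=> [y [dy' _] <-]; exists y.
have act2_cont p : D p -> {for p, continuous act2}.
  move=> Dp; apply: (@continuous_comp _ _ _ (fun p : R * 'rV[R]_n.*2 => (p.1, chart_inv c p.2))
     (fun q : R * P i => hm_act q.1 q.2)); last exact: act_continuous (hm_action (P i)) _.
  apply: (@cvg_pair _ _ _ (nbhs p) (nbhs p.1) (nbhs (chart_inv c p.2)) _ _ _
     (fun p : R * 'rV[R]_n.*2 => p.1) (fun p : R * 'rV[R]_n.*2 => chart_inv c p.2)).
    exact: cvg_fst.
  apply: (@cvg_comp _ _ _ snd (chart_inv c)); first exact: cvg_snd.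
  exact: chart_inv_cont (Dimg p Dp).
pose W := D `&` act2 @^-1` V.
have oW : open W by exact: open_continuous_preimage.
have act2E : act2 (s, c x) = hm_act s x by rewrite /act2 /= (chartK cc).
have Wx : W (s, c x).
  split; first by exists x.
  by rewrite /= act2E; split => //; split => //=; rewrite tx.
have H : ndiff_on m W (local_rep c'' c' tau \o (c'' \o act2)).
  apply: (@ndiff_on_comp _ _ _ _ _ W (c'' @` (chart_dom c'' `&` O `&` tau @^-1` chart_dom c'))) => //.
  - by move=> p [Dp [d1 [d2 d3]]]; exists (act2 p).
  - apply: ndiff_on_sub (act_smooth (hm_action (P i)) ac ac'' m) => p [Dp [d1 _]].
    by split; [exact: Dimg|].
  - exact: (isom_smooth It).2 _ _ ac'' ac' m.
apply: (@ndiff_on_near _ _ _ _ _ (local_rep c'' c' tau \o (c'' \o act2))); last first.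
  by apply: ndiff_on_sub H => _ ->.
move=> _ ->; apply: filterS (open_nbhs_nbhs (conj oW Wx)) => p [[y [dy' Ay] yp] [d1 [d2 d3]]].
have yE : chart_inv c p.2 = y by rewrite -yp (chartK cc).
rewrite /local_rep /= (chartK cc'')//.
have aE : act2 p = hm_act p.1 y by rewrite /act2 yE.
rewrite yE glue_actE// -aE -Et//.
by have [Atu _] := isom_fun It d2; rewrite glue_projK.
Qed.

Lemma glue_action : is_smooth_circle_action (@glue_act _ _ G : R -> T -> T).
Proof.
split.
- move=> t; have [i [x [Ax <-]]] := glue_cover t.
  by rewrite glue_actE// (act_zero (hm_action (P i))).
- move=> r s t; have [i [x [Ax <-]]] := glue_cover t.
  rewrite !glue_actE ?(act_add (hm_action (P i)))//; exact: gl_inv.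
- move=> t; have [i [x [Ax <-]]] := glue_cover t.
  by rewrite glue_actE// (act_period (hm_action (P i))).
- exact: glue_act_cont.
- exact: glue_act_smooth.
Qed.

Lemma glue_act_symplectic t : pulls_back glue_form glue_form setT (glue_act t).
Proof.
apply: (@glue_pulls_back (glue_act t) (fun i => @hm_act _ _ (P i) t)).
- by move=> i x; exact: gl_inv.
- by move=> i; apply: act_smooth_map; exact: gl_open.
- move=> i; apply: (@pulls_back_sub _ _ _ _ _ _ _ setT) => //.
  exact: hm_act_symplectic.
- by move=> i x Ax; rewrite glue_actE.
Qed.

Lemma glue_semifree t (x : T) : glue_act t x = x ->
  trivial_elt t \/ fixed_point (@glue_act _ _ G : R -> T -> T) x.
Proof.
have [i [y [Ay <-]]] := glue_cover x; rewrite glue_actE// => E.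
have Aty : A i (hm_act t y) by exact: gl_inv.
have /hm_semifree[] := glue_inj_inj Aty Ay E; first by left.
by move=> fy; right=> s; rewrite glue_actE// fy.
Qed.

Lemma glue_ham_rep i (c : chart R n.*2 (P i)) u :
  (c @` (chart_dom c `&` A i)) u -> mf_atlas c ->
  \forall v \near u, (@hm_ham _ _ (P i) \o chart_inv c) v =
    (@glue_ham _ _ G \o chart_inv (glue_chart c)) v.
Proof.
move=> [x [dx Ax] <-] ac.
have := chart_inv_near (mf_is_chart ac) dx (open_nbhs_nbhs (conj (@gl_open _ _ G i) Ax)).
by apply: filterS => v Av; rewrite /= glue_hamE.
Qed.

Lemma glue_ham_smooth : smooth_fun (@glue_ham _ _ G : T -> R).
Proof.
move=> d ad; have [i [c [ac -> _]]] := glue_formP ad => m.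
rewrite glue_chart_img.
apply: (@ndiff_on_near _ _ _ _ _ (@hm_ham _ _ (P i) \o chart_inv c)).
  by move=> u cu; exact: glue_ham_rep.
apply: ndiff_on_sub (hm_ham_smooth ac m) => _ [x [dx _] <-].
by exists x.
Qed.

Lemma glue_moment (d : chart R n.*2 T) (t : T) : mf_atlas d -> chart_dom d t ->
  forall v, eval_form glue_form d (d t) (gen_field (@glue_act _ _ G : R -> T -> T) d t) v =
    - 'D_v (@glue_ham _ _ G \o chart_inv d) (d t).
Proof.
move=> ad; have [i [c [ac dE fE]]] := glue_formP ad.
rewrite /eval_form fE {}dE => -[x [Ax dx] <-] v.
rewrite /= glue_projK//.
have cx : (c @` (chart_dom c `&` A i)) (c x).
  exact: (ex_intro2 _ _ x (conj dx Ax) erefl).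
have E := near_eq_derive v (glue_ham_rep cx ac).
transitivity (- 'D_v (@hm_ham _ _ (P i) \o chart_inv c) (c x)); last by rewrite E.
rewrite -(hm_moment ac dx) /eval_form.
have EF : (fun s : R => glue_chart c (glue_act s (glue_inj x))) =
    (fun s => c (hm_act s x)).
  apply/funext => s; rewrite glue_actE// /glue_chart /= glue_projK//; exact: gl_inv.
have Eg : gen_field (@glue_act _ _ G : R -> T -> T) (glue_chart c) (glue_inj x) =
    gen_field (@hm_act _ _ (P i)) c x by rewrite /gen_field EF.
by rewrite Eg.
Qed.

(** Connectedness and properness depend on how the pieces fit together, and are supplied separately
    for each use of the construction. *)
Hypothesis conn : connected [set: T].
Hypothesis prop : forall K : set R,
  compact K -> K `<=` range (@glue_ham _ _ G) -> compact (@glue_ham _ _ G @^-1` K : set T).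

Lemma glue_mf_nonempty : [set: T] !=set0.
Proof. by have [t _] := glue_inhabited G; exists t. Qed.

Definition glue_hm : ham_manifold R n :=
  HamManifold conn glue_mf_nonempty glue_symplectic glue_action
    glue_act_symplectic glue_semifree glue_ham_smooth glue_moment prop.

Lemma glue_inj_rep i (c : chart R n.*2 (P i)) k (c' : chart R n.*2 (P k)) x y :
  mf_atlas c -> mf_atlas c' -> A i x -> A k y -> glue_inj x = glue_inj y ->
  chart_dom c x -> chart_dom c' y -> exists tau : P i -> P k,
  [/\ isom_on (glue_overlap i k) (glue_overlap k i) tau, glue_overlap i k x,
      tau x = y &
      \forall u \near c x, glue_proj k (glue_inj (chart_inv c u)) = tau (chart_inv c u)].
Proof.
move=> ac ac' Ax Ay xy dx dy.
have [tau [It Et ox tx]] := glue_pieces_agree Ax Ay xy.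
by exists tau; split => //; exact: glue_rep_near It Et.
Qed.

Lemma glue_inj_smooth i : smooth_map (A i) (@glue_inj _ _ G i : P i -> glue_hm).
Proof.
split.
  by rewrite within_continuousE//; [move=> x; exact: glue_inj_cont|exact: gl_open].
move=> c d ac [k [c' [ac' ->]]] m.
apply: ndiff_on_point => _ [x [[dx Ax] [y [Ay dy] yx]] <-].
have [tau [It ox tx E]] := glue_inj_rep ac ac' Ax Ay (esym yx) dx dy.
apply: (@ndiff_on_near _ _ _ _ _ (local_rep c c' tau)).
  by move=> _ ->; apply: filterS E => u E; rewrite /local_rep /= E.
apply: ndiff_on_sub ((isom_smooth It).2 _ _ ac ac' m) => _ ->.
by exists x => //; split => //=; rewrite tx.
Qed.

Lemma glue_proj_smooth i : smooth_map (glue_piece i : set glue_hm) (@glue_proj _ _ G i).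
Proof.
split.
  by rewrite within_continuousE//; [move=> x; exact: glue_proj_cont|exact: glue_piece_open].
move=> d c [k [c' [ac' ->]]] ac m.
apply: ndiff_on_point => _ [t [[[x [Ax dx] <-] [y Ay yx]] dy] <-] /=.
have dy' : chart_dom c y by move: dy; rewrite /= -yx glue_projK.
have [tau [It ox tx E]] := glue_inj_rep ac' ac Ax Ay (esym yx) dx dy'.
rewrite glue_projK//.
apply: (@ndiff_on_near _ _ _ _ _ (local_rep c' c tau)).
  by move=> _ ->; apply: filterS E => u E; rewrite /local_rep /= E.
apply: ndiff_on_sub ((isom_smooth It).2 _ _ ac' ac m) => _ ->.
by exists x => //; split => //=; rewrite tx.
Qed.

Lemma glue_inj_isom i :
  isom_on (A i) (glue_piece i : set glue_hm) (@glue_inj _ _ G i).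
Proof.
split.
- apply: (@set_bijI _ _ (P i) glue_hm) => [x Ax|x y Ax Ay|t it]; first by exists x.
    exact: glue_inj_inj.
  by have [Ap E] := glue_projP it; exists (glue_proj i t).
- exact: glue_inj_smooth.
- exists (@glue_proj _ _ G i); last exact: glue_proj_smooth.
  by move=> x; rewrite inE => Ax; exact: glue_projK.
- by move=> t x Ax; rewrite -[RHS]/(glue_act t (glue_inj x)) glue_actE.
- move=> c d x ac ad Ax dx.
  have [k [c' [ac' dE fdE]]] := glue_formP ad.
  rewrite {2}/eval_form {1}/hm_form /= /eval_form fdE {}dE => -[y Ay yx] v w.
  have [Ay' dy] := Ay.
  have [tau [It ox tx E]] := glue_inj_rep ac ac' Ax Ay' (esym yx) dx dy.
  have E' : \forall u \near c x, local_rep c c' tau u =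
      local_rep c (glue_chart c') (@glue_inj _ _ G i) u.
    by apply: filterS E => u E; rewrite /local_rep /= E.
  rewrite -!(near_eq_derive _ E') -yx /= glue_projK// -tx.
  by apply: (isom_form It ac ac' ox dx); rewrite tx.
- by move=> x Ax; exact: glue_hamE.
Qed.

End GlueHamiltonian.

(** * Connected subsets and fixed points *)

Section ConnectedIn.
Context (T : topologicalType).
Implicit Types (X Y C : set T) (x y z : T).

(** Connected sets rather than paths: pieces of a manifold, which are given as connected spaces, and
    paths in charts or along orbits are then handled alike. *)
Definition conn_in X x y := exists C, [/\ connected C, C `<=` X, C x & C y].

Lemma conn_in_refl X x : X x -> conn_in X x x.
Proof. by move=> Xx; exists [set x]; split => //; [exact: connected1|move=> _ ->]. Qed.

Lemma conn_in_sym X x y : conn_in X x y -> conn_in X y x.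
Proof. by move=> [C [cC CX Cx Cy]]; exists C. Qed.

Lemma conn_in_trans X y x z : conn_in X x y -> conn_in X y z -> conn_in X x z.
Proof.
move=> [C [cC CX Cx Cy]] [D [cD DX Dy Dz]]; exists (C `|` D); split.
- by apply: connectedU => //; exists y.
- by move=> w [/CX|/DX].
- by left.
- by right.
Qed.

Lemma conn_in_sub X Y x y : X `<=` Y -> conn_in X x y -> conn_in Y x y.
Proof.
by move=> XY [C [cC CX Cx Cy]]; exists C; split => //; exact: subset_trans XY.
Qed.

Lemma conn_in_connected X x : (forall y, X y -> conn_in X x y) -> X x -> connected X.
Proof.
move=> H Xx.
pose F y := if pselect (X y) is left e then projT1 (cid (H y e)) else [set x].
have FP y : [/\ connected (F y), F y `<=` X & F y x].
  rewrite /F; case: pselect => [e|_]; last by split => //; [exact: connected1|move=> _ ->].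
  by case: cid => C [].
have -> : X = \bigcup_(y in X) F y.
  apply/seteqP; split=> [y Xy|y [z Xz Fy]]; last by have [_ + _] := FP z; exact.
  by exists y => //; rewrite /F; case: pselect => // e; case: cid => C [].
by apply: bigcup_connected; [exists x => y _; have [] := FP y|move=> y _; have [] := FP y].
Qed.

End ConnectedIn.

Section FixedPoints.
Context (R : realType) (n : nat).
Implicit Types M : ham_manifold R n.

Lemma act_isom M t : isom_on setT setT (@hm_act _ _ M t).
Proof.
split => //.
- apply: set_bijI => // [x y _ _ E|y _]; first by rewrite -(actK t x) E actK.
  by exists (hm_act (- t) y) => //; exact: actNK.
- exact/act_smooth_map/openT.
- exists (@hm_act _ _ M (- t)); last exact/act_smooth_map/openT.
  by move=> x _; exact: actK.
- by move=> s x _; rewrite -!(act_add (hm_action M)) addrC.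
- exact: hm_act_symplectic.
- by move=> x _; exact: ham_invariant.
Qed.

Lemma critical_act M (x : M) t : critical_point x -> critical_point (hm_act t x).
Proof.
move=> crx; apply: (isom_critical _ _ (@act_invariantT _ _ M) (act_isom M t)) => //;
  exact: openT.
Qed.

Lemma critical_gen_field M (c : chart R n.*2 M) x : mf_atlas c -> chart_dom c x ->
  critical_point x -> gen_field (@hm_act _ _ M) c x = 0.
Proof.
move=> ac dx crx; apply: (symp_nondeg (hm_symplectic M) ac (chart_imgP dx)) => v.
by rewrite hm_moment// crx// oppr0.
Qed.

Lemma orbit_is_derive_at M (c : chart R n.*2 M) x (s : R) :
  mf_atlas c -> chart_dom c (hm_act s x) ->
  is_derive s 1 (fun t => c (hm_act t x)) (gen_field (@hm_act _ _ M) c (hm_act s x)).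
Proof.
move=> ac ds; have H := orbit_is_derive ac ds.
pose F (t : R) := c (hm_act t (hm_act s x)).
have dF : differentiable F (s *: 1 + - s).
  by rewrite /GRing.scale /= mulr1 subrr; apply/derivable1_diffP; exact: ex_derive.
have := @is_derive_line R R 'rV[R]_n.*2 F (- s) 1 s dF.
rewrite {2}/GRing.scale /= mulr1 subrr (@derive_val _ _ _ _ _ _ _ H).
have -> // : (fun t : R => F (t *: 1 - s)) = (fun t => c (hm_act t x)).
apply/funext => t; rewrite /F -(act_add (hm_action M)) /GRing.scale /= mulr1.
by rewrite subrK.
Qed.

(** The orbit of a critical point consists of critical points, where the generating field vanishes.
    So the orbit is stationary while it stays in the chart, that is for times below [r] in absolute
    value, and every time is a sum of finitely many such times. *)
Lemma critical_fixed M (x : M) : critical_point x -> fixed_point (@hm_act _ _ M) x.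
Proof.
move=> crx; have [c ac dx] := mf_cover x; have cc := mf_is_chart ac.
have [r /= r0 Hr] : nbhs_ball (0 : R) [set s | chart_dom c (hm_act s x)].
  apply/nbhs_ballP; apply: (@act_orbit_cont _ _ M x 0).
  rewrite (act_zero (hm_action M)); apply: open_nbhs_nbhs; split => //.
  exact: chart_dom_open.
have loc s : `|s| < r -> hm_act s x = x.
  move=> sr.
  have inr (t : R) : `|t - 0| < r -> chart_dom c (hm_act t x).
    by rewrite subr0 => tr; apply: Hr; rewrite /ball /= sub0r normrN.
  have E : c (hm_act s x) = c x.
    apply/rowP => i.
    have D (t : R) : `|t - 0| < r -> is_derive t (1 : R) (fun t => c (hm_act t x) 0 i) 0.
      move=> tr; have H := orbit_is_derive_at ac (inr t tr).
      have := @critical_gen_field M c _ ac (inr t tr) (@critical_act M x t crx).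
      move=> X0; have dF : differentiable (fun t : R => c (hm_act t x)) t.
        by apply/derivable1_diffP; exact: ex_derive.
      split; last by rewrite derive_coord// (@derive_val _ _ _ _ _ _ _ H) X0 mxE.
      apply: diff_derivable.
      apply: (@differentiable_comp _ _ _ _ (fun t => c (hm_act t x)) (fun M : 'rV[R]_n.*2 => M 0 i)) => //.
      exact: differentiable_coord.
    rewrite (zero_derive_locally_const D) ?subr0//.
    by rewrite (act_zero (hm_action M)).
  have ds : chart_dom c (hm_act s x) by apply: inr; rewrite subr0.
  by rewrite -(chartK cc ds) E (chartK cc).
have iter k s : `|s| < r -> hm_act (s *+ k) x = x.
  move=> sr; elim: k => [|k IH]; first by rewrite mulr0n (act_zero (hm_action M)).
  by rewrite mulrS (act_add (hm_action M)) IH loc.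
move=> t; pose N := (Num.truncn (`|t| / r)).+1.
have N0 : 0 < N%:R :> R by rewrite ltr0n.
rewrite -(@divfK _ N%:R _ t) ?gt_eqF// mulr_natr iter//.
rewrite normrM normfV (ger0_norm (ltW N0)) ltr_pdivrMr// mulrC -ltr_pdivrMr//.
exact: truncnS_gt.
Qed.

Lemma pi_not_trivial : ~ trivial_elt (pi : R).
Proof.
move=> [k E]; have p0 : pi != 0 :> R by rewrite gt_eqF// pi_gt0.
have {E} : 1 = (k * 2)%:~R :> R.
  apply: (mulIf p0); rewrite mul1r {1}E intrM; ring.
move=> E; have : (1 : int)%:~R = (k * 2)%:~R :> R by [].
move/intr_inj => /(congr1 (fun z : int => (z %% 2)%Z)).
by rewrite modzMl.
Qed.

(** The half turn is not trivial, so semi-freeness makes its fixed points fixed by the whole circle.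
    The critical points thereby become the fixed points of an involution. *)
Lemma fixed_pi M (x : M) : hm_act pi x = x -> fixed_point (@hm_act _ _ M) x.
Proof. by move=> /hm_semifree[/pi_not_trivial|]. Qed.

Lemma fixed_critical M (x : M) : fixed_point (@hm_act _ _ M) x -> critical_point x.
Proof.
move=> fx c ac dx v; rewrite -[LHS]opprK -hm_moment//.
rewrite /gen_field (_ : (fun t => c (hm_act t x)) = cst (c x)).
  by rewrite derive1_cst /eval_form !mul0mx mxE oppr0.
by apply/funext => t; rewrite fx.
Qed.

End FixedPoints.

(** * Existence *)

Section ExistenceGluing.
Context (R : realType) (n : nat) (L : local_data R n).
Local Notation l := (ld_level L).
Local Notation eps := (ld_eps L).
Local Notation s := (ld_s L).

Definition ex_P (k : nat + nat) : ham_manifold R n :=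
  match k with inl i => ld_germ L i | inr j => ld_slice L j end.

Definition ex_rel (k : nat + nat) : bool :=
  match k with inl i => (i <= s.+1)%N | inr j => (j <= s)%N end.

(** The index type is infinite; pieces with an irrelevant index are made empty. *)
Definition ex_A k : set (ex_P k) := [set _ | ex_rel k].

Definition ex_U : Type := {k : nat + nat & ex_P k}.

(* A point of a germ off its level is represented in the adjacent slice. *)
Definition ex_j k : ex_P k -> ex_U :=
  match k as k0 return ex_P k0 -> ex_U with
  | inl i => match i as i0 return ld_germ L i0 -> ex_U with
    | 0%N => fun y => if hm_ham y == l 0 then existT ex_P (inl 0%N) y
                      else existT ex_P (inr 0%N) (ld_up y)
    | i'.+1 => fun y => if hm_ham y == l i'.+1 then existT ex_P (inl i'.+1) y
                        else if l i'.+1 < hm_ham y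
                          then existT ex_P (inr i'.+1) (ld_up y)
                          else existT ex_P (inr i') (ld_down y)
    end
  | inr j => fun z => existT ex_P (inr j) z
  end.

Lemma germ_ham_range i (y : ld_germ L i) : (i <= s.+1)%N ->
  l i - eps i < hm_ham y < l i + eps i.
Proof.
have ry : range (@hm_ham _ _ (ld_germ L i)) (hm_ham y) by exists y.
case: i y ry => [|i] y ry iS.
  by have [e0 rY _] := ld_min L; move: ry; rewrite rY /= in_itv /=; lra.
move: iS; rewrite ltnS leq_eqVlt => /orP[/eqP E|iS].
  have e0 : 0 < eps i.+1 by rewrite E; case: (ld_max L).
  have rY : range (@hm_ham _ _ (ld_germ L i.+1)) = `]l i.+1 - eps i.+1, l i.+1]%classic.
    by rewrite E; case: (ld_max L).
  by move: ry; rewrite rY /= in_itv /=; lra.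
by have [e0 rY _] := @ld_crit _ _ L i.+1 iS; move: ry; rewrite rY /= in_itv.
Qed.

Lemma germ_min_ham (y : ld_germ L 0) : l 0 <= hm_ham y.
Proof.
have [e0 rY _] := ld_min L.
have : range (@hm_ham _ _ (ld_germ L 0)) (hm_ham y) by exists y.
by rewrite rY /= in_itv /=; lra.
Qed.

Lemma germ_max_ham (y : ld_germ L s.+1) : hm_ham y <= l s.+1.
Proof.
have [e0 rY _] := ld_max L.
have : range (@hm_ham _ _ (ld_germ L s.+1)) (hm_ham y) by exists y.
by rewrite rY /= in_itv /=; lra.
Qed.

Lemma ex_j_level i (y : ld_germ L i) : hm_ham y = l i ->
  @ex_j (inl i) y = existT ex_P (inl i) y.
Proof. by case: i y => [|i] y E; rewrite /= E eqxx. Qed.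

Lemma ex_j_up i (y : ld_germ L i) : l i < hm_ham y ->
  @ex_j (inl i) y = existT ex_P (inr i) (ld_up y).
Proof. by case: i y => [|i] y E /=; rewrite gt_eqF// E. Qed.

Lemma ex_j_down i (y : ld_germ L i.+1) : hm_ham y < l i.+1 ->
  @ex_j (inl i.+1) y = existT ex_P (inr i) (ld_down y).
Proof. by move=> E /=; rewrite lt_eqF// ltNge ltW. Qed.

Lemma germ_cases i (y : ld_germ L i) : (i <= s.+1)%N ->
  [\/ hm_ham y = l i, (i <= s)%N /\ l i < hm_ham y |
      exists2 i', i = i'.+1 & hm_ham y < l i].
Proof.
move=> iS; case: (ltgtP (hm_ham y) (l i)) => H; [apply: Or33|apply: Or32|exact: Or31].
  case: i y iS H => [|i] y iS H; last by exists i.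
  by have := germ_min_ham y; lra.
split => //; move: iS; rewrite leq_eqVlt ltnS => /orP[/eqP E|//].
by move: y H; rewrite E => y H; have := germ_max_ham y; lra.
Qed.

Lemma up_band i (y : ld_germ L i) : (i <= s)%N -> l i < hm_ham y ->
  between (l i) (l i + eps i) y.
Proof.
by move=> iS H; have := germ_ham_range y (leqW iS); rewrite /between /= H => /andP[].
Qed.

Lemma down_band i (y : ld_germ L i.+1) : (i <= s)%N -> hm_ham y < l i.+1 ->
  between (l i.+1 - eps i.+1) (l i.+1) y.
Proof.
move=> iS H; have /(_ iS) := @germ_ham_range i.+1 y; rewrite /between /= H.
by move=> /andP[->].
Qed.

Definition ex_ham (u : ex_U) : R := hm_ham (projT2 u).

Lemma ex_j_ham k (x : ex_P k) : ex_rel k -> ex_ham (ex_j x) = hm_ham x.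
Proof.
case: k x => [i|j] x iS; last by [].
have [E|[iS' H]|[i' E H]] := germ_cases x iS.
- by rewrite (ex_j_level E).
- by rewrite (ex_j_up H) /ex_ham /= (isom_ham (ld_upP iS') (up_band iS' H)).
- subst i; rewrite (ex_j_down H) /ex_ham /=.
  by rewrite (isom_ham (ld_downP iS) (down_band iS H)).
Qed.

Lemma ex_j_normal k (x : ex_P k) : ex_rel k ->
  (exists i (y : ld_germ L i), [/\ (i <= s.+1)%N, hm_ham y = l i &
     ex_j x = @ex_j (inl i) y]) \/
  (exists j (z : ld_slice L j), (j <= s)%N /\ ex_j x = @ex_j (inr j) z).
Proof.
case: k x => [i|j] x kS; last by right; exists j, x.
have [E|[iS' H]|[i' E H]] := germ_cases x kS.
- by left; exists i, x.
- by right; exists i, (ld_up x); split => //; exact: ex_j_up.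
- by subst i; right; exists i', (ld_down x); split => //; exact: ex_j_down.
Qed.

Lemma ex_j_inj k (x y : ex_P k) : ex_A x -> ex_A y -> ex_j x = ex_j y -> x = y.
Proof.
case: k x y => [i|j] x y kS _ E; last exact: existT_inj2 E.
have hxy : hm_ham x = hm_ham y.
  by rewrite -(@ex_j_ham (inl i) x kS) -(@ex_j_ham (inl i) y kS) E.
have [H|[iS' H]|[i' Ei H]] := germ_cases x kS.
- move: E; rewrite (ex_j_level H) ex_j_level -?hxy// => E.
  exact: existT_inj2 E.
- move: E; rewrite (ex_j_up H) ex_j_up -?hxy// => E0; have {}E0 := existT_inj2 E0.
  by apply: (isom_inj (ld_upP iS')) => //; apply: up_band => //; rewrite -hxy.
- subst i; move: E; rewrite (ex_j_down H) ex_j_down -?hxy// => E0; have {}E0 := existT_inj2 E0.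
  by apply: (isom_inj (ld_downP kS)) => //; apply: down_band => //; rewrite -hxy.
Qed.

(** Every overlap is a band in H, so a transition is recorded with the end points of its band; for
    an empty overlap they are in the wrong order. *)
Definition ex_trans k k' := exists tau : ex_P k -> ex_P k', exists a b : R,
  [/\ isom_on (between a b) (between a b) tau,
      (forall x, ex_A x -> forall y, ex_A y -> @ex_j k' y = @ex_j k x -> between a b x) &
      (forall x, between a b x -> [/\ ex_A x, ex_A (tau x) & ex_j (tau x) = ex_j x])].

Lemma between_empty (M : ham_manifold R n) (a b : R) : b <= a ->
  @between _ _ M a b = set0.
Proof. by move=> ba; apply/seteqP; split => // x; rewrite /between /=; lra. Qed.

Lemma ex_trans_empty k k' :
  (forall x, ex_A x -> forall y, ex_A y -> @ex_j k' y = @ex_j k x -> False) ->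
  ex_trans k k'.
Proof.
move=> H; have [y0 _] := hm_nonempty (ex_P k').
exists (fun=> y0), 1, 0; have le01 : (0 : R) <= 1 by lra.
rewrite !between_empty//; split => [|x Ax y Ay E|x []]; first exact: isom_set0.
by case: (H x Ax y Ay E).
Qed.

Lemma ex_trans_sym k k' : ex_trans k k' -> ex_trans k' k.
Proof.
move=> [tau [a [b [It H1 H2]]]]; have [tau' [It' K K']] := band_iso_inv It.
exists tau', a, b; split => // [y Ay x Ax E|y yb].
  have := H1 x Ax y Ay (esym E); rewrite /between /=.
  by rewrite -(ex_j_ham x) -?(ex_j_ham y)// E.
have xb := isom_fun It' yb; have [A1 A2 E] := H2 _ xb.
by rewrite K' in A2 E.
Qed.

Lemma full_band k : ex_rel k -> exists a b, forall x : ex_P k, between a b x.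
Proof.
case: k => [i|j] kS; first by exists (l i - eps i), (l i + eps i) => x; exact: germ_ham_range.
by exists (l j), (l j.+1) => x; exact: slice_ham.
Qed.

Lemma ex_trans_refl k : ex_trans k k.
Proof.
have [kS|kS] := boolP (ex_rel k); last first.
  by apply: ex_trans_empty => x Ax; rewrite /ex_A /= (negbTE kS) in Ax.
have [a [b Hab]] := full_band kS; exists id, a, b; split => //.
by apply: isom_id; exact: between_open.
Qed.

(** By [gap_up] and [gap_down] the band of a germ does not reach past the neighbouring levels. *)
Lemma band_slice_adjacent i j (v : R) : (i <= s.+1)%N -> (j <= s)%N ->
  l i - eps i < v < l i + eps i -> l j < v < l j.+1 -> i = j \/ i = j.+1.
Proof.
move=> iS js vi vj.
have [|ij] := eqVneq i j; first by left.
have [|ij'] := eqVneq i j.+1; first by right.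
exfalso; case: (ltngtP i j) => [lt|lt|E]; last by rewrite E eqxx in ij.
  have := gap_up (ltnW (leq_trans lt js)).
  have := level_le (@ld_level_lt _ _ L) (i := i.+1) (k := j).
  by rewrite lt (leqW js) => /(_ isT); lra.
case: i iS ij ij' lt vi => // i iS ij ij' lt vi.
have := gap_down (j := i) iS.
have := level_le (@ld_level_lt _ _ L) (i := j.+1) (k := i).
have -> : (j.+1 <= i <= s.+1)%N.
  by rewrite (ltnW iS) andbT ltn_neqAle -ltnS lt andbT; apply: contraNneq ij' => ->.
by move=> /(_ isT); lra.
Qed.

Lemma ex_trans_germ_slice i j : (i <= s.+1)%N -> (j <= s)%N ->
  ex_trans (inl i) (inr j).
Proof.
move=> iS js.
have hE (x : ld_germ L i) (z : ld_slice L j) : @ex_j (inr j) z = @ex_j (inl i) x ->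
    hm_ham z = hm_ham x.
  by move=> E; rewrite -(@ex_j_ham (inr j) z js) E (@ex_j_ham (inl i) x iS).
have [E|ij] := eqVneq i j.
  subst j; exists (@ld_up _ _ L i), (l i), (l i + eps i); split.
  - exact: ld_upP.
  - move=> x _ z _ /hE h; have := slice_ham z js; have := germ_ham_range x iS.
    by rewrite /between /= h; lra.
  - by move=> x /andP[xi _]; split => //; rewrite (ex_j_up xi).
have [E|ij'] := eqVneq i j.+1.
  subst i; exists (@ld_down _ _ L j), (l j.+1 - eps j.+1), (l j.+1); split.
  - exact: ld_downP.
  - move=> x _ z _ /hE h; have := slice_ham z js; have := germ_ham_range x iS.
    by rewrite /between /= h; lra.
  - by move=> x /andP[_ xi]; split => //; rewrite (ex_j_down xi).
apply: ex_trans_empty => x _ z _ /hE h.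
have := slice_ham z js; have := germ_ham_range x iS; rewrite h.
move=> H1 H2; have [E|E] := band_slice_adjacent iS js H1 H2.
  by rewrite E eqxx in ij.
by rewrite E eqxx in ij'.
Qed.

(** The bands of consecutive germs may overlap inside the slice between them. The transition there
    enters the slice by [ld_up] and leaves it by the inverse of [ld_down]. *)
Lemma ex_trans_germs i i' : (i < i' <= s.+1)%N -> ex_trans (inl i) (inl i').
Proof.
move=> /andP[ii iS']; have iS : (i <= s)%N by rewrite -ltnS (leq_trans ii).
have hE (x : ld_germ L i) (y : ld_germ L i') : @ex_j (inl i') y = @ex_j (inl i) x ->
    hm_ham y = hm_ham x.
  by move=> E; rewrite -(@ex_j_ham (inl i') y iS') E (@ex_j_ham (inl i) x (leqW iS)).
have [E|ne] := eqVneq i' i.+1.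
  subst i'.
  have [dinv [Id Kd Kd']] := band_iso_inv (ld_downP iS).
  have gu := gap_up iS; have gd := gap_down iS.
  exists (dinv \o @ld_up _ _ L i), (l i.+1 - eps i.+1), (l i + eps i); split.
  - apply: band_iso_comp; first by apply: band_iso_sub (ld_upP iS) _ _ => //; lra.
    by apply: band_iso_sub Id _ _ => //; lra.
  - move=> x _ y _ /hE h; have := germ_ham_range x (leqW iS).
    by have := germ_ham_range y iS'; rewrite /between /= h; lra.
  - move=> x /andP[x1 x2]; split; [exact: leqW|exact: iS'|].
    have xu : l i < hm_ham x by lra.
    have hu : hm_ham (ld_up x) = hm_ham x by apply: (isom_ham (ld_upP iS)); exact: up_band.
    have ub : between (l i.+1 - eps i.+1) (l i.+1) (ld_up x).
      by rewrite /between /= hu; lra.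
    rewrite (ex_j_up xu) /= -/(@ex_j (inl i.+1) _) ex_j_down ?Kd'//.
    by rewrite (isom_ham Id ub) hu; lra.
apply: ex_trans_empty => x _ y _ /hE h.
have := germ_ham_range x (leqW iS); have := germ_ham_range y iS'; rewrite h.
have := gap_up iS.
case: i' iS' ii ne y hE h => // i' iS' ii ne y hE h.
have := gap_down (j := i') iS'.
have := level_le (@ld_level_lt _ _ L) (i := i.+1) (k := i').
have -> : (i.+1 <= i' <= s.+1)%N.
  by rewrite (ltnW iS') andbT ltn_neqAle -ltnS ii andbT; apply: contraNneq ne => <-.
by move=> /(_ isT); lra.
Qed.

Lemma ex_transP k k' : ex_trans k k'.
Proof.
have [kS|kS] := boolP (ex_rel k); last first.
  by apply: ex_trans_empty => x Ax; rewrite /ex_A /= (negbTE kS) in Ax.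
have [kS'|kS'] := boolP (ex_rel k'); last first.
  by apply: ex_trans_empty => x _ y Ay; rewrite /ex_A /= (negbTE kS') in Ay.
case: k k' kS kS' => [i|j] [i'|j'] /= kS kS'.
- case: (ltngtP i i') => [lt|lt|<-]; last exact: ex_trans_refl.
    by apply: ex_trans_germs; rewrite lt.
  by apply: ex_trans_sym; apply: ex_trans_germs; rewrite lt.
- exact: ex_trans_germ_slice.
- by apply: ex_trans_sym; exact: ex_trans_germ_slice.
- have [<-|ne] := eqVneq j j'; first exact: ex_trans_refl.
  apply: ex_trans_empty => x _ y _ E.
  have : inr j' = inr j := existT_inj1 (E : existT ex_P (inr j') y = existT ex_P (inr j) x).
  by case=> E'; rewrite E' eqxx in ne.
Qed.

Lemma ex_nonempty : exists k, @ex_A k !=set0.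
Proof. by have [y _] := hm_nonempty (ld_germ L 0); exists (inl 0%N), y. Qed.

Lemma ex_open k : open (@ex_A k).
Proof.
case: (boolP (ex_rel k)) => kS.
  by rewrite (_ : @ex_A k = setT); [exact: openT|apply/seteqP; split].
rewrite (_ : @ex_A k = set0); first exact: open0.
by apply/seteqP; split => // x; rewrite /ex_A /= (negbTE kS).
Qed.

Lemma ex_gl_trans k k' : exists tau : ex_P k -> ex_P k',
  let B := @ex_A k `&` [set x | exists2 y, @ex_A k' y & ex_j y = ex_j x] in
  let B' := @ex_A k' `&` [set y | exists2 x, @ex_A k x & ex_j x = ex_j y] in
  [/\ open B, act_invariant B, isom_on B B' tau & forall x, B x -> ex_j (tau x) = ex_j x].
Proof.
have [tau [a [b [It H1 H2]]]] := ex_transP k k'; exists tau => B B'.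
have BE : B = between a b.
  apply/seteqP; split => x; first by move=> [Ax [y Ay E]]; exact: H1 Ay E.
  by move=> xb; have [Ax At E] := H2 x xb; split => //; exists (tau x).
have B'E : B' = between a b.
  apply/seteqP; split => y.
    move=> [Ay [x Ax E]]; have := H1 x Ax y Ay (esym E); rewrite /between /=.
    by rewrite -(ex_j_ham x)// -(ex_j_ham y)// E.
  move=> yb; have [x xb xy] := isom_surj It yb; have [Ax At E] := H2 x xb.
  by rewrite -xy; split => //; exists x.
rewrite BE B'E; split => //; [exact: between_open|exact: between_invariant|].
by move=> x /H2[].
Qed.

Lemma ex_gl_sep k k' (x : ex_P k) (y : ex_P k') : @ex_A k x -> @ex_A k' y ->
  hm_ham x = hm_ham y -> exists m (x' y' : ex_P m),
    [/\ @ex_A m x', @ex_A m y', ex_j x' = ex_j x & ex_j y' = ex_j y].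
Proof.
move=> kS kS' hxy.
have [[i [x' [iS xi Ex]]]|[j [x' [js Ex]]]] := ex_j_normal x kS;
have [[i' [y' [iS' yi Ey]]]|[j' [y' [js' Ey]]]] := ex_j_normal y kS'.
- have hx : hm_ham x = hm_ham x' by rewrite -(ex_j_ham x)// Ex (@ex_j_ham (inl i) x').
  have hy : hm_ham y = hm_ham y' by rewrite -(ex_j_ham y)// Ey (@ex_j_ham (inl i') y').
  have E : i = i'.
    by apply: (level_inj (@ld_level_lt _ _ L)) => //; rewrite -xi -yi -hx -hy.
  by subst i'; exists (inl i), x', y'.
- have hx : hm_ham x = hm_ham x' by rewrite -(ex_j_ham x)// Ex (@ex_j_ham (inl i) x').
  have hy : hm_ham y = hm_ham y' by rewrite -(ex_j_ham y)// Ey (@ex_j_ham (inr j') y').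
  have := gap_not_level (@ld_level_lt _ _ L) js' iS (slice_ham y' js').
  by rewrite -hy -hxy hx xi.
- have hx : hm_ham x = hm_ham x' by rewrite -(ex_j_ham x)// Ex (@ex_j_ham (inr j) x').
  have hy : hm_ham y = hm_ham y' by rewrite -(ex_j_ham y)// Ey (@ex_j_ham (inl i') y').
  have := gap_not_level (@ld_level_lt _ _ L) js iS' (slice_ham x' js).
  by rewrite -hx hxy hy yi.
- have hx : hm_ham x = hm_ham x' by rewrite -(ex_j_ham x)// Ex (@ex_j_ham (inr j) x').
  have hy : hm_ham y = hm_ham y' by rewrite -(ex_j_ham y)// Ey (@ex_j_ham (inr j') y').
  have E : j = j'.
    apply: (gap_uniq (@ld_level_lt _ _ L) js js' (slice_ham x' js)).
    by rewrite -hx hxy hy; exact: slice_ham.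
  by subst j'; exists (inr j), x', y'.
Qed.

Definition ex_gluing : gluing R n :=
  Gluing ex_nonempty ex_open (fun k t x Ax => Ax) ex_j_inj ex_gl_trans ex_gl_sep.

End ExistenceGluing.

(** * The glued manifold is closed and has the given local data *)

Section Existence.
Context (R : realType) (n : nat) (L : local_data R n).
Local Notation l := (ld_level L).
Local Notation eps := (ld_eps L).
Local Notation s := (ld_s L).
Local Notation G := (ex_gluing L).
Local Notation T := (glue_mf G).
Local Notation P := (ex_P L).

Definition ex_in (k : nat + nat) (x : P k) : T := @glue_inj R n G k x.

Lemma ex_inP k k' (x : P k) (y : P k') : ex_rel L k -> ex_rel L k' ->
  ex_in x = ex_in y <-> ex_j x = ex_j y.
Proof. by move=> kS kS'; apply: (@glue_injP R n G k k' x y). Qed.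

Lemma ex_in_up i (y : ld_germ L i) : (i <= s)%N -> l i < hm_ham y ->
  @ex_in (inl i) y = @ex_in (inr i) (ld_up y).
Proof. by move=> iS H; apply/ex_inP => //; [exact: leqW|exact: ex_j_up]. Qed.

Lemma ex_in_down i (y : ld_germ L i.+1) : (i <= s)%N -> hm_ham y < l i.+1 ->
  @ex_in (inl i.+1) y = @ex_in (inr i) (ld_down y).
Proof. by move=> iS H; apply/ex_inP => //; exact: ex_j_down. Qed.

Lemma ex_ham_in k (x : P k) : ex_rel L k -> glue_ham (ex_in x) = hm_ham x.
Proof. by move=> kS; exact: (@glue_hamE R n G k x). Qed.

Lemma ex_in_cont k : ex_rel L k -> continuous (@ex_in k).
Proof. by move=> kS x; exact: (@glue_inj_cont R n G k x). Qed.

Lemma ex_normal (t : T) :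
  (exists i (y : ld_germ L i), [/\ (i <= s.+1)%N, hm_ham y = l i & @ex_in (inl i) y = t]) \/
  (exists j (z : ld_slice L j), (j <= s)%N /\ @ex_in (inr j) z = t).
Proof.
have [k [x [kS <-]]] := glue_cover t.
have [[i [y [iS yi E]]]|[j [z [js E]]]] := ex_j_normal x kS.
  by left; exists i, y; split => //; apply/(ex_inP (k := inl i)).
by right; exists j, z; split => //; apply/(ex_inP (k := inr j)).
Qed.

Lemma ex_conn_piece k (x y : P k) : ex_rel L k ->
  conn_in [set: T] (ex_in x) (ex_in y).
Proof.
move=> kS; exists (@ex_in k @` setT); split; [|by []|by exists x|by exists y].
apply: connected_continuous_connected; first exact: hm_connected.
by apply: continuous_subspaceT; exact: ex_in_cont.
Qed.

Lemma ex_meet_up i : (i <= s)%N -> exists (y : ld_germ L i) (z : ld_slice L i),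
  @ex_in (inl i) y = @ex_in (inr i) z.
Proof.
move=> iS; have e0 := eps_gt0 (leqW iS).
have [|y yE] := @germ_above _ _ L i (l i + eps i / 2) iS; first by lra.
by exists y, (ld_up y); apply: ex_in_up => //; rewrite yE; lra.
Qed.

Lemma ex_meet_down i : (i <= s)%N -> exists (y : ld_germ L i.+1) (z : ld_slice L i),
  @ex_in (inl i.+1) y = @ex_in (inr i) z.
Proof.
move=> iS; have e0 := @eps_gt0 _ _ L i.+1 iS.
have [|y yE] := @germ_below _ _ L i (l i.+1 - eps i.+1 / 2) iS; first by lra.
by exists y, (ld_down y); apply: ex_in_down => //; rewrite yE; lra.
Qed.

(** Germs and slices alternate in a chain of connected pieces, and consecutive ones share a
    point. *)
Lemma ex_connected : connected [set: T].
Proof.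
have [y0 _] := hm_nonempty (ld_germ L 0).
pose t0 := @ex_in (inl 0%N) y0.
have Hslice j (z : ld_slice L j) : (j <= s)%N ->
    (forall y : ld_germ L j, conn_in setT t0 (@ex_in (inl j) y)) ->
    conn_in setT t0 (@ex_in (inr j) z).
  move=> js H; have [y [z' E]] := ex_meet_up js.
  by apply: conn_in_trans (H y) _; rewrite E; exact: ex_conn_piece.
have Hgerm i : (i <= s.+1)%N -> forall y : ld_germ L i, conn_in setT t0 (@ex_in (inl i) y).
  elim: i => [|i IH] iS y; first exact: ex_conn_piece.
  have [y' [z E]] := ex_meet_down iS.
  apply: conn_in_trans (Hslice _ z iS (IH (ltnW iS))) _.
  by rewrite -E; exact: ex_conn_piece.
apply: (@conn_in_connected _ _ t0) => // t _.
have [[i [y [iS _ <-]]]|[j [z [js <-]]]] := ex_normal t; first exact: Hgerm.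
by apply: Hslice => // y; apply: Hgerm; exact: leqW.
Qed.

(** Properness concerns compact subsets of the image, and the image of a germ is half-open at the
    extreme levels. In each of the three cases its intersection with the interval is again a closed
    interval. *)
Lemma germ_band_compact i : (i <= s.+1)%N ->
  compact [set y : ld_germ L i | l i - eps i / 2 <= hm_ham y <= l i + eps i / 2].
Proof.
move=> iS; have e0 := eps_gt0 iS.
pose S := range (@hm_ham _ _ (ld_germ L i)) `&` `[l i - eps i / 2, l i + eps i / 2]%classic.
have -> : [set y : ld_germ L i | l i - eps i / 2 <= hm_ham y <= l i + eps i / 2] =
    @hm_ham _ _ (ld_germ L i) @^-1` S.
  apply/seteqP; split => y; rewrite /S /= in_itv /=; last by case.
  by move=> H; split => //; exists y.
apply: hm_proper; last exact: subIsetl.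
suff [a [b ->]] : exists a b, S = `[a, b]%classic by exact: segment_compact.
case: (posnP i) => [E|i0].
  exists (l i), (l i + eps i / 2).
  have rE : range (@hm_ham _ _ (ld_germ L i)) = `[l i, l i + eps i[%classic.
    by rewrite E; case: (ld_min L).
  by rewrite /S rE; apply/seteqP; split => v; rewrite /= !in_itv /=; [case|];
    move=> *; [lra|split; lra].
have [E|ne] := eqVneq i s.+1.
  exists (l i - eps i / 2), (l i).
  have rE : range (@hm_ham _ _ (ld_germ L i)) = `]l i - eps i, l i]%classic.
    by rewrite E; case: (ld_max L).
  by rewrite /S rE; apply/seteqP; split => v; rewrite /= !in_itv /=; [case|];
    move=> *; [lra|split; lra].
have i1 : (1 <= i <= s)%N by rewrite i0 -ltnS ltn_neqAle ne.
exists (l i - eps i / 2), (l i + eps i / 2).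
have [_ rE _] := ld_crit i1.
by rewrite /S rE; apply/seteqP; split => v; rewrite /= !in_itv /=; [case|];
  move=> *; [lra|split; lra].
Qed.

Lemma slice_band_compact j : (j <= s)%N ->
  compact [set z : ld_slice L j |
    l j + eps j / 2 <= hm_ham z <= l j.+1 - eps j.+1 / 2].
Proof.
move=> js; have e0 := eps_gt0 (leqW js); have e1 := @eps_gt0 _ _ L j.+1 js.
have -> : [set z : ld_slice L j | l j + eps j / 2 <= hm_ham z <= l j.+1 - eps j.+1 / 2] =
    @hm_ham _ _ (ld_slice L j) @^-1` `[l j + eps j / 2, l j.+1 - eps j.+1 / 2]%classic.
  by apply/seteqP; split => z; rewrite /= in_itv.
apply: hm_proper; first exact: segment_compact.
have [-> _] := ld_regular js.
by move=> v; rewrite /= !in_itv /=; lra.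
Qed.

Lemma ex_compact : compact [set: T].
Proof.
(* All pieces are trimmed by half the widths: what a slice loses near its ends lies in the adjacent
   trimmed germs. *)
pose K (k : nat + nat) : set (P k) := match k with
  | inl i => [set y : ld_germ L i | l i - eps i / 2 <= hm_ham y <= l i + eps i / 2]
  | inr j => [set z : ld_slice L j | l j + eps j / 2 <= hm_ham z <= l j.+1 - eps j.+1 / 2]
  end.
have cK k : ex_rel L k -> compact (@ex_in k @` K k).
  move=> kS; apply: continuous_compact.
    by apply: continuous_subspaceT; exact: ex_in_cont.
  by case: k kS => [i|j] kS; [exact: germ_band_compact|exact: slice_band_compact].
have -> : [set: T] =
    (\big[setU/set0]_(i < s.+2) (@ex_in (inl (i : nat)) @` K (inl (i : nat)))) `|`
    (\big[setU/set0]_(j < s.+1) (@ex_in (inr (j : nat)) @` K (inr (j : nat)))).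
  apply/seteqP; split => // t _.
  have inG i (y : ld_germ L i) : (i <= s.+1)%N ->
      l i - eps i / 2 <= hm_ham y <= l i + eps i / 2 ->
      (\big[setU/set0]_(i < s.+2) (@ex_in (inl (i : nat)) @` K (inl (i : nat)))) (@ex_in (inl i) y).
    move=> iS yb; rewrite -(bigcup_mkord s.+2 (fun i => @ex_in (inl i) @` K (inl i))); exists i => //; by exists y.
  have [[i [y [iS yi <-]]]|[j [z [js <-]]]] := ex_normal t.
    by left; apply: inG => //; have := eps_gt0 iS; rewrite yi; lra.
  have e0 := eps_gt0 (leqW js); have e1 := @eps_gt0 _ _ L j.+1 js.
  have zj := slice_ham z js.
  have [lo|lo] := ltP (hm_ham z) (l j + eps j / 2).
    have zb : between (l j) (l j + eps j) z by rewrite /between /=; lra.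
    have [y yb yz] := isom_surj (ld_upP js) zb.
    have yE : hm_ham y = hm_ham z by rewrite -yz (isom_ham (ld_upP js)).
    left; rewrite -yz -ex_in_up//; last by rewrite yE; lra.
    by apply: inG; [exact: leqW|rewrite yE; lra].
  have [hi|hi] := ltP (l j.+1 - eps j.+1 / 2) (hm_ham z).
    have zb : between (l j.+1 - eps j.+1) (l j.+1) z by rewrite /between /=; lra.
    have [y yb yz] := isom_surj (ld_downP js) zb.
    have yE : hm_ham y = hm_ham z by rewrite -yz (isom_ham (ld_downP js)).
    left; rewrite -yz -ex_in_down//; last by rewrite yE; lra.
    by apply: inG; [exact: js|rewrite yE; lra].
  by right; rewrite -(bigcup_mkord s.+1 (fun j => @ex_in (inr j) @` K (inr j))); exists j => //; exists z => //; rewrite /K /= lo.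
apply: compactU; apply: bigsetU_compact => i _; apply: cK => /=.
  by rewrite -ltnS.
by rewrite -ltnS.
Qed.

Lemma ex_proper : forall S : set R, compact S -> S `<=` range (@glue_ham _ _ G) ->
  compact (@glue_ham _ _ G @^-1` S : set T).
Proof.
move=> S cS _; apply: (subclosed_compact _ ex_compact) => //.
apply: preimage_closed; first by move=> t _; exact: glue_ham_cont.
exact: compact_closed (@Rhausdorff R) cS.
Qed.

Definition ex_M : ham_manifold R n := glue_hm ex_connected ex_proper.

Lemma ex_A_T k : ex_rel L k -> @ex_A R n L k = setT.
Proof. by move=> kS; apply/seteqP; split. Qed.

Lemma ex_isom k : ex_rel L k ->
  isom_on [set: P k] (@ex_in k @` setT : set ex_M) (@ex_in k : P k -> ex_M).
Proof.
move=> kS; have := @glue_inj_isom R n G ex_connected ex_proper k.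
by rewrite /glue_piece -[gl_A G k]/(@ex_A R n L k) ex_A_T.
Qed.

Lemma ex_piece_open k : ex_rel L k -> open (@ex_in k @` setT : set ex_M).
Proof.
by move=> kS; have := @glue_piece_open R n G k; rewrite /glue_piece -[gl_A G k]/(@ex_A R n L k) ex_A_T.
Qed.

(** A point in normal form in a slice is brought back into the germ, since the gluing maps are onto
    the ends of the slice. *)
Lemma ex_band_in_piece i (t : ex_M) : (i <= s.+1)%N ->
  between (l i - eps i) (l i + eps i) t -> exists y : ld_germ L i, @ex_in (inl i) y = t.
Proof.
move=> iS; rewrite /between /=.
have [[k [y [kS yk <-]]]|[j [z [js <-]]]] := ex_normal t.
  rewrite (ex_ham_in (k := inl k))// yk => H.
  have E : k = i.
    case: (ltngtP k i) => // lt; exfalso.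
      case: i iS H lt => // i iS H lt; have := gap_down (j := i) iS.
      have := level_le (@ld_level_lt _ _ L) (i := k) (k := i).
      have ki : (k <= i <= s.+1)%N by rewrite -ltnS lt ltnW.
      by move=> /(_ ki); lra.
    have is_ : (i <= s)%N by rewrite -ltnS (leq_trans lt).
    have := gap_up is_.
    have := level_le (@ld_level_lt _ _ L) (i := i.+1) (k := k).
    by rewrite lt kS => /(_ isT); lra.
  by subst k; exists y.
rewrite (ex_ham_in (k := inr j))// => H; have zj := slice_ham z js.
have [E|E] := band_slice_adjacent iS js H zj; subst i.
  have zb : between (l j) (l j + eps j) z by rewrite /between /=; lra.
  have [y yb yz] := isom_surj (ld_upP js) zb.
  exists y; rewrite -yz; apply: ex_in_up => //.
  by rewrite -(isom_ham (ld_upP js) yb) yz; lra.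
have zb : between (l j.+1 - eps j.+1) (l j.+1) z by rewrite /between /=; lra.
have [y yb yz] := isom_surj (ld_downP js) zb.
exists y; rewrite -yz; apply: ex_in_down => //.
by rewrite -(isom_ham (ld_downP js) yb) yz; lra.
Qed.

Lemma ex_gap_piece j : (j <= s)%N ->
  (@ex_in (inr j) @` setT : set ex_M) = between (l j) (l j.+1).
Proof.
move=> js; apply/seteqP; split => t; rewrite /between /=.
  by move=> [z _ <-]; rewrite (ex_ham_in (k := inr j))//; exact: slice_ham.
have [[k [y [kS yk <-]]]|[k [z [ks <-]]]] := ex_normal t.
  rewrite (ex_ham_in (k := inl k))// yk => H.
  by case: (gap_not_level (@ld_level_lt _ _ L) js kS H).
rewrite (ex_ham_in (k := inr k))// => H.
have E := gap_uniq (@ld_level_lt _ _ L) js ks H (slice_ham z ks); subst k.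
by exists z.
Qed.

Lemma germ_critical_value i mu : (i <= s.+1)%N ->
  critical_value (ld_germ L i) mu <-> mu = l i.
Proof.
case: i => [|i] iS; first by case: (ld_min L).
have [E|ne] := eqVneq i s; first by rewrite E; case: (ld_max L).
by case: (@ld_crit _ _ L i.+1) => [|_ _]; [rewrite /= ltn_neqAle ne|].
Qed.

Lemma ex_critical_value mu : critical_value ex_M mu <->
  exists2 i, (i <= s.+1)%N & mu = l i.
Proof.
split=> [[t crt <-]|[i iS ->]].
  have [k [x [kS E]]] := glue_cover t.
  have {}E : ex_in x = t := E.
  have [||g [Ig gK _]] := isom_inv _ _ (@act_invariantT _ _ _) (ex_isom kS).
  - exact: openT.
  - exact: ex_piece_open.
  have pt : (@ex_in k @` setT : set ex_M) t by exists x.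
  have iP : act_invariant (@ex_in k @` setT : set ex_M).
    move=> r u [y _ <-]; exists (hm_act r y) => //.
    by rewrite (isom_equivariant (ex_isom kS)).
  have crx : critical_point x.
    rewrite -(gK x)// E; apply: (isom_critical _ _ iP Ig pt crt); last exact: openT.
    exact: ex_piece_open.
  have hx : hm_ham t = hm_ham x by rewrite -E; exact: (isom_ham (ex_isom kS)).
  case: k x kS E g Ig gK pt iP crx hx => [i|j] x kS E g Ig gK pt iP crx hx.
    by exists i => //; rewrite hx; apply/germ_critical_value => //; exists x.
  (* A critical point of a slice would be fixed by the half turn, against freeness. *)
  have [_ free] := ld_regular kS.
  have := free pi x (critical_fixed crx pi).
  by move/pi_not_trivial.
have [y cry yE] : critical_value (ld_germ L i) (l i) by apply/germ_critical_value.
have kS : ex_rel L (inl i) := iS.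
exists (@ex_in (inl i) y : ex_M); last first.
  by rewrite -yE; apply: (isom_ham (ex_isom kS)).
apply: (isom_critical _ _ (@act_invariantT _ _ _) (ex_isom kS) _ cry) => //.
  exact: openT.
exact: ex_piece_open.
Qed.

Lemma ex_has_local_data : has_local_data ex_M L.
Proof.
split; first exact: ex_critical_value.
exists (fun i => eps i / 2), (fun i => @ex_in (inl i) : ld_germ L i -> ex_M),
  (fun j => @ex_in (inr j) : ld_slice L j -> ex_M).
split.
- move=> i iS /=; have e0 := eps_gt0 iS; split; first by lra.
  have kS : ex_rel L (inl i) := iS.
  have hE := isom_ham (ex_isom kS).
  apply: (isom_sub _ _ _ _ _ _ _ (ex_isom kS)) => //; try exact: between_open.
  + exact: openT.
  + exact: ex_piece_open.
  + move=> t tb; have [|y <-] := @ex_band_in_piece i t iS; last by exists y.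
    by move: tb; rewrite /between /=; lra.
  + by move=> y _; have E := hE y I; rewrite /between; split => /=; rewrite [glue_ham _]E.
- move=> j js; have kS : ex_rel L (inr j) := js.
  by rewrite -ex_gap_piece//; exact: ex_isom kS.
- by move=> j js y /andP[yj _]; rewrite ex_in_up.
- by move=> j js y /andP[_ yj]; rewrite ex_in_down.
Qed.

Lemma ex_closed : closed_ham ex_M.
Proof.
have hE k (x : P k) : ex_rel L k -> hm_ham (ex_in x : ex_M) = hm_ham x.
  by move=> kS; exact: (isom_ham (ex_isom kS)).
have l0 := ld_level0 L.
have lge i : (i <= s.+1)%N -> 0 <= l i.
  by move=> iS; rewrite -l0; apply: (level_le (@ld_level_lt _ _ L)); rewrite /= iS.
split.
- exact: ex_compact.
- move=> t; have [[i [y [iS yi <-]]]|[j [z [js <-]]]] := ex_normal t.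
    by rewrite (hE (inl i))// yi lge.
  by rewrite (hE (inr j))//; have := slice_ham z js; have := lge j (leqW js); lra.
- have e0 := @eps_gt0 _ _ L 0 isT.
  have [|y yE] := @germ_above _ _ L 0 (l 0) isT; first by lra.
  by exists (@ex_in (inl 0%N) y); rewrite (hE (inl 0%N))// yE.
- have [z _] := hm_nonempty (ld_slice L 0); exists (@ex_in (inr 0%N) z) => fz.
  have kS : ex_rel L (inr 0%N) by [].
  have [_ free] := @ld_regular _ _ L 0 isT.
  have := fz pi; rewrite -(isom_equivariant (ex_isom kS))//.
  by move/(isom_inj (ex_isom kS)) => /(_ I I) /free /pi_not_trivial.
Qed.

End Existence.

(** * The Hamiltonian near a fixed point *)

Section MatrixBounds.
Context (R : realType) (m : nat).
Local Notation E := 'rV[R]_m.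

Lemma coord_norm_attained (v : E) : v != 0 -> exists i, `|v| <= `|v 0 i|.
Proof.
move=> v0; have [i0 vi0] : exists i, v 0 i != 0.
  apply/existsP; apply: contraR v0; rewrite negb_exists => /forallP H.
  by apply/eqP/rowP => i; rewrite mxE; apply/eqP; have := H i; rewrite negbK.
pose i := [arg max_(i > i0) `|v 0 i|]%O; exists i.
apply: norm_coord_le => // j; rewrite /i; case: Order.TotalTheory.arg_maxP => // k _; exact.
Qed.

Lemma mulmx_norm_le (w : E) (A : 'M[R]_m) (a : R) : 0 <= a ->
  (forall i j, `|A i j| <= a) -> `|w *m A| <= m%:R * (a * `|w|).
Proof.
move=> a0 H; apply: norm_coord_le => [|j]; first by rewrite mulr_ge0// mulr_ge0.
rewrite mxE (le_trans (ler_norm_sum _ _ _))//.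
apply: (@le_trans _ _ (\sum_(i < m) a * `|w|)).
  apply: ler_sum => i _; rewrite normrM mulrC ler_pM//; exact: coord_norm_le.
by rewrite sumr_const card_ord mulr_natl.
Qed.

(** Perturbation of an invertible matrix: [q] bounds the inverse at [p], and [e] is so small that
    replacing [om p] by [om u] costs at most half the norm of [w], which is absorbed on the left. *)
Lemma nondegenerate_near (om : E -> 'M[R]_m) (p : E) :
  {for p, continuous om} ->
  (forall v : E, (forall w : E, (v *m om p *m w^T) 0 0 = 0) -> v = 0) ->
  exists2 C, 0 < C & \forall u \near p, forall w : E, `|w| <= C * `|w *m om u|.
Proof.
move=> com nd.
have un : om p \in unitmx.
  rewrite -row_free_unit; apply/row_freeP; apply/row_freeP.
  rewrite -kermx_eq0; apply/rowV0P => v /sub_kermxP vA.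
  by apply: nd => w; rewrite vA mul0mx mxE.
pose B := invmx (om p).
pose K := \sum_i \sum_j `|B i j|.
have BK i j : `|B i j| <= K.
  rewrite /K (bigD1 i)//= (bigD1 j)//= -addrA lerDl addr_ge0// sumr_ge0// => k _.
  by rewrite sumr_ge0.
have K0 : 0 <= K by rewrite sumr_ge0// => i _; rewrite sumr_ge0.
pose q := m%:R * K; have q0 : 0 <= q by rewrite mulr_ge0.
pose e := (2 * (q * m%:R + 1))^-1.
have e0 : 0 < e by rewrite invr_gt0 mulr_gt0// ltr_wpDl// mulr_ge0.
exists (2 * (q + 1)); first by rewrite mulr_gt0// ltr_wpDl.
have : \forall u \near p, `|om p - om u| <= e.
  by have /cvgrPdist_le/(_ e e0) := com.
apply: filterS => u Hu w.
have Hij i j : `|(om p - om u) i j| <= e.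
  by apply: le_trans Hu; rewrite [leRHS]/Num.norm/= mx_normrE (le_trans _ (le_bigmax _ _ (i, j))).
have w1 : `|w| <= q * `|w *m om p|.
  rewrite -{1}(mulmxK un w) /q -mulrA; exact: mulmx_norm_le.
have w2 : `|w *m om p| <= `|w *m om u| + m%:R * (e * `|w|).
  rewrite -{1}(subrK (om u) (om p)) mulmxDr addrC (le_trans (ler_normD _ _))// lerD2l.
  by apply: mulmx_norm_le => //; exact: ltW.
have qe : q * m%:R * e <= 2^-1.
  rewrite /e invfM mulrCA -[leRHS]mulr1 ler_wpM2l// ?invr_ge0//.
  by rewrite ler_pdivrMr ?mul1r ?lerDl// ltr_wpDl// mulr_ge0.
have nw := normr_ge0 w; have nu := normr_ge0 (w *m om u).
move: w1 w2 qe q0 nw nu; move: (`|w|) (`|w *m om p|) (`|w *m om u|) => x y z.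
clearbody q e; move: (m%:R : R) => M'; clear; move=> w1 w2 qe q0 x0 z0.
have : q * y <= q * z + q * M' * e * x.
  by have := ler_wpM2l q0 w2; rewrite mulrDr !mulrA.
have := ler_wpM2r x0 qe; nra.
Qed.

End MatrixBounds.

Lemma field_bound_arith (R : realType) (y b N q : R) : 0 <= q * (N * y) -> 0 <= y ->
  q * (N * (b * y)) <= (q * (N * (b + 1)) + 1) * y.
Proof. by move=> h1 h2; lra. Qed.

(** * Displacement by the half turn against the generating field *)

Section FixedPointChart.
Context (R : realType) (n : nat) (M : ham_manifold R n).
Local Notation E := 'rV[R]_n.*2.
Context (c : chart R n.*2 M) (p : M).
Hypotheses (ac : mf_atlas c) (dp : chart_dom c p) (fp : fixed_point (@hm_act _ _ M) p).
Let cc : is_chart c := mf_is_chart ac.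

Definition flow_rep (z : R * E) : E := c (hm_act z.1 (chart_inv c z.2)).
Definition flow_dom : set (R * E) :=
  [set z | chart_img c z.2 /\ chart_dom c (hm_act z.1 (chart_inv c z.2))].

Lemma flow_dom_open : open flow_dom.
Proof.
pose D := [set z : R * E | chart_img c z.2].
have oD : open D.
  by apply: open_comp; [move=> z _; exact: cvg_snd|exact: chart_img_open].
apply: (open_continuous_preimage oD _ (chart_dom_open cc)) => z Dz.
apply: (@cvg_comp _ _ _ (fun q : R * E => (q.1, chart_inv c q.2))
  (fun q : R * M => hm_act q.1 q.2) _ _ _ _
  (@act_continuous _ _ _ _ (hm_action M) (z.1, chart_inv c z.2))).
apply: (@cvg_pair _ _ _ (nbhs z) (nbhs z.1) (nbhs (chart_inv c z.2)) _ _ _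
     (fun q : R * E => q.1) (fun q : R * E => chart_inv c q.2)).
  exact: cvg_fst.
apply: (@cvg_comp _ _ _ snd (chart_inv c)); first exact: cvg_snd.
exact: (chart_inv_cont cc Dz).
Qed.

Lemma flow_smooth : smooth_on flow_dom flow_rep.
Proof. exact: (act_smooth (hm_action M) ac ac). Qed.

Lemma flow_dom_fixed t : flow_dom (t, c p).
Proof. by split; [exists p|rewrite /= (chartK cc)// fp]. Qed.

Lemma flow_derivative_bound : exists B, \forall u \near c p,
  forall t, 0 <= t <= pi -> flow_dom (t, u) /\
    forall i, `|'D_(0, delta_mx 0 i) flow_rep (t, u)| <= B.
Proof.
(* The bound is a second variable, tending to infinity along with [u] tending to [c p]; compactness
   of the time interval then merges the local bounds [Ct] into one. *)
pose Q (z : E * R) (t : R) := flow_dom (t, z.1) /\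
  forall i, `|'D_(0, delta_mx 0 i) flow_rep (t, z.1)| <= z.2.
have H : \forall z \near filter_prod (nbhs (c p)) (+oo_R), `[0, pi]%classic `<=` Q z.
  have /compact_near_coveringP := @segment_compact R 0 pi; apply => t _.
  have nD : \forall y \near (t, c p), flow_dom y.
    by apply: open_nbhs_nbhs; split; [exact: flow_dom_open|exact: flow_dom_fixed].
  pose Ct := \sum_i `|'D_(0, delta_mx 0 i) flow_rep (t, c p)| + 1.
  have nB : \forall y \near (t, c p), forall i, `|'D_(0, delta_mx 0 i) flow_rep y| <= Ct.
    apply: (@filter_forall _ _ (fun i y => `|'D_(0, delta_mx 0 i) flow_rep y| <= Ct)
      (nbhs (t, c p))) => i.
    have := smooth_on_cont (smooth_on_D (0, delta_mx 0 i) flow_smooth) (flow_dom_fixed t).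
    move/cvgrPdist_le => /(_ 1 ltr01); apply: filterS => y /= Hy.
    have := ler_distD ('D_(0, delta_mx 0 i) flow_rep (t, c p)) ('D_(0, delta_mx 0 i) flow_rep y) 0.
    rewrite !subr0 distrC => /le_trans; apply; rewrite addrC /Ct lerD//.
    by rewrite (bigD1 i)//= lerDl sumr_ge0.
  have [[V1 V2] [/= nV1 nV2] HV] : nbhs (t, c p) [set y | flow_dom y /\
      forall i, `|'D_(0, delta_mx 0 i) flow_rep y| <= Ct] by exact: filterI nD nB.
  exists (V1, [set z : E * R | V2 z.1 /\ Ct <= z.2]); first split => //=.
    exists (V2, [set b | Ct <= b]); first by split => //=; exact: nbhs_pinfty_ge (num_real _).
    by move=> z [].
  move=> [t' [u b]] [/= Vt [Vu Cb]]; have [fd fb] := HV (t', u) (conj Vt Vu).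
  by split => // i; exact: le_trans (fb i) Cb.
have [[V1 V2] [/= nV1 nV2] HV] := H.
have [b Vb] : exists b, V2 b.
  have [b [_ Hb]] := nV2; exists (b + 1); apply: Hb; lra.
exists b; apply: filterS nV1 => u Vu t t01.
by apply: (HV (u, b) (conj Vu Vb)); rewrite /= in_itv.
Qed.

(** Differentiate [hm_act s (hm_act t x) = hm_act t (hm_act s x)] in [s] at 0: the action carries
    its generating field into itself. *)
Lemma gen_field_flow x t : chart_dom c x -> chart_dom c (hm_act t x) ->
  gen_field (@hm_act _ _ M) c (hm_act t x) =
  \sum_i gen_field (@hm_act _ _ M) c x 0 i *: 'D_(0, delta_mx 0 i) flow_rep (t, c x).
Proof.
move=> dx dtx.
pose X := gen_field (@hm_act _ _ M) c x.
have dF : differentiable (local_rep c c (@hm_act _ _ M t)) (c x).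
  by apply: smooth_map_rep (act_smooth_map t openT) ac ac _ dx dtx.
have H := orbit_is_derive ac dx.
have dO : differentiable (fun s => c (hm_act s x)) (0 : R).
  by apply/derivable1_diffP; exact: ex_derive.
have O0 : c (hm_act 0 x) = c x by rewrite (act_zero (hm_action M)).
have E1 : \forall s \near (0 : R), c (hm_act s (hm_act t x)) =
    (local_rep c c (@hm_act _ _ M t) \o (fun s => c (hm_act s x))) s.
  have : \forall s \near (0 : R), chart_dom c (hm_act s x).
    apply: (@act_orbit_cont _ _ M x 0); rewrite (act_zero (hm_action M)).
    by apply: open_nbhs_nbhs; split => //; exact: chart_dom_open.
  apply: filterS => s ds; rewrite /local_rep /= (chartK cc)//.
  by rewrite -!(act_add (hm_action M)) addrC.
have -> : gen_field (@hm_act _ _ M) c (hm_act t x) = 'D_X (local_rep c c (@hm_act _ _ M t)) (c x).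
  have D1 := near_eq_derive (1 : R) E1.
  have dF' : differentiable (local_rep c c (@hm_act _ _ M t)) (c (hm_act 0 x)) by rewrite O0.
  have D2 := derive_comp (1 : R) dO dF'.
  rewrite (@derive_val _ _ _ _ _ _ _ H) O0 in D2.
  rewrite -D2 -D1; exact: derive1E.
rewrite (derive_rV _ dF); apply: eq_bigr => i _; apply: (congr1 (fun v : E => X 0 i *: v)).
have lin : linear (fun u : E => (0, u) : R * E).
  by move=> a u v; congr pair; rewrite /= scaler0 addr0.
pose lM := GRing.isLinear.Build _ _ _ _ _ lin.
pose l : {linear E -> (R * E)%type} := HB.pack (fun u : E => (0, u) : R * E) lM.
have El : local_rep c c (@hm_act _ _ M t) = (fun u => flow_rep (l u + (t, 0))).
  by apply/funext => u; rewrite /local_rep /flow_rep /= add0r addr0.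
have lE : l (c x) + (t, 0) = (t, c x).
  by rewrite /= -[LHS]/(0 + t, c x + 0) add0r addr0.
have DA := derive_affine l (t, 0) flow_rep (delta_mx 0 i) (c x).
rewrite lE in DA; rewrite -[RHS]DA.
by rewrite El.
Qed.

(** By the mean value theorem a coordinate of the displacement is [pi] times that of the field at
    some point of the half orbit. That value is the field at the start, transported by the
    differential of the action, which is bounded. *)
Lemma displacement_le_field : exists2 C, 0 < C & \forall u \near c p,
  [/\ chart_img c u, chart_dom c (hm_act pi (chart_inv c u)) &
  `|flow_rep (pi, u) - u| <= C * `|gen_field (@hm_act _ _ M) c (chart_inv c u)|].
Proof.
have [B HB] := flow_derivative_bound.
have p0 : 0 < pi :> R := pi_gt0 R.
pose C := pi * (n.*2%:R * (`|B| + 1)) + 1.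
have C0 : 0 < C by rewrite ltr_wpDl// (mulr_ge0 (ltW p0))// mulr_ge0// addr_ge0.
exists C => //; apply: filterS HB => u Hu.
have pipi : 0 <= (pi : R) <= pi by rewrite lexx ltW.
have [[iu du] _] := Hu pi pipi.
split => //.
pose x := chart_inv c u; have dx : chart_dom c x by exact: chart_inv_dom.
have cx : c x = u by exact: chart_invK.
pose X := gen_field (@hm_act _ _ M) c x.
apply: norm_coord_le => [|i]; first by rewrite mulr_ge0// ltW.
have dom t : 0 <= t <= pi -> chart_dom c (hm_act t x) by move=> /Hu[[]].
pose f (t : R) := c (hm_act t x) 0 i.
pose df (t : R) := gen_field (@hm_act _ _ M) c (hm_act t x) 0 i.
have isd t : 0 <= t <= pi -> is_derive t (1 : R) f (df t).
  move=> tb; have H := orbit_is_derive_at ac (dom t tb).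
  have dF : differentiable (fun t : R => c (hm_act t x)) t.
    by apply/derivable1_diffP; exact: ex_derive.
  split; last by rewrite (derive_coord _ _ _ dF) (@derive_val _ _ _ _ _ _ _ H).
  apply: diff_derivable.
  apply: (@differentiable_comp _ _ _ _ (fun t : R => c (hm_act t x)) (fun M : E => M 0 i)) => //.
  exact: differentiable_coord.
have [||t tb Et] := @MVT R f df 0 pi p0.
- by move=> t; rewrite in_itv /= => /andP[t0 t1]; apply: isd; rewrite !ltW.
- apply: continuous_in_subspaceT => t; rewrite inE /= in_itv /= => tb.
  have ft := isd t tb; apply: differentiable_continuous; apply/derivable1_diffP.
  exact: ex_derive.
have {}tb : 0 <= t <= pi by move: tb; rewrite in_itv /= => /andP[t0 t1]; rewrite !ltW.
have fE : (flow_rep (pi, u) - u) 0 i = f pi - f 0.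
  by rewrite !mxE /flow_rep /f /= -/x (act_zero (hm_action M)) cx.
rewrite fE Et subr0 normrM mulrC (gtr0_norm p0).
have : `|df t| <= n.*2%:R * (`|B| * `|X|).
  rewrite /df (le_trans (coord_norm_le _ _))// gen_field_flow//; last exact: dom.
  rewrite (le_trans (ler_norm_sum _ _ _))//.
  apply: (@le_trans _ _ (\sum_(j < n.*2) `|B| * `|X|)).
    apply: ler_sum => j _; rewrite normrZ mulrC ler_pM//; last exact: coord_norm_le.
    by rewrite cx; apply: le_trans (ler_norm B); exact: (Hu t tb).2.
  by rewrite sumr_const card_ord mulr_natl.
move=> /(ler_wpM2l (ltW p0))/le_trans; apply.
rewrite /C -/X; have Y0 : 0 <= pi * (n.*2%:R * `|X|).
  by apply: mulr_ge0; [exact: ltW|rewrite mulr_ge0].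
move: Y0 (normr_ge0 X); move: (`|X|) (`|B|) (n.*2%:R : R) (pi : R) => y b N q.
exact: field_bound_arith.
Qed.

End FixedPointChart.

(** * The half turn and the Hamiltonian in a chart at a fixed point *)

Section FixedPointLocal.
Context (R : realType) (n : nat) (M : ham_manifold R n).
Local Notation E := 'rV[R]_n.*2.
Context (c : chart R n.*2 M) (p : M) (sig : R).
Hypotheses (ac : mf_atlas c) (dp : chart_dom c p) (fp : fixed_point (@hm_act _ _ M) p).
Hypothesis sig2 : sig * sig = 1.
Let cc : is_chart c := mf_is_chart ac.

Definition inv_rep (u : E) : E := c (hm_act pi (chart_inv c u)).
(** The sign [sig] is 1 or -1, so that H and -H are treated together. *)
Definition ham_rep (u : E) : R := sig * hm_ham (chart_inv c u).

Lemma sig_norm : `|sig| = 1.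
Proof.
have : `|sig| ^+ 2 = 1 by rewrite expr2 -normrM sig2 normr1.
by move/eqP; rewrite sqrf_eq1 => /orP[/eqP//|/eqP H]; have := normr_ge0 sig; rewrite H; lra.
Qed.

Lemma ham_rep_derive u v : chart_img c u ->
  'D_v ham_rep u = sig * 'D_v (@hm_ham _ _ M \o chart_inv c) u.
Proof.
move=> iu; rewrite -[RHS]/(sig *: _) -deriveZ//.
by apply: diff_derivable; exact: smooth_on_diff (hm_ham_smooth ac) iu.
Qed.

Lemma ham_rep_smooth : smooth_on (chart_img c) ham_rep.
Proof.
move=> k; apply: (@ndiff_onZ R E R k _ (cst sig) (@hm_ham _ _ M \o chart_inv c)).
- exact: chart_img_open.
- exact: ndiff_on_cst.
- exact: (hm_ham_smooth ac k).
Qed.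

(** Collects for the half turn what the study of local involutions assumes. The last clause chains
    two bounds, displacement by field and field by gradient; [i] is a coordinate at which the norm
    of the gradient is attained. *)
Lemma fixed_point_setup : exists U C,
  [/\ open U, U (c p), 0 < C, U `<=` chart_img c & smooth_on U inv_rep] /\
  [/\ inv_rep (c p) = c p,
      (forall u, U u -> chart_dom c (hm_act pi (chart_inv c u))),
      (forall u, U u -> inv_rep (inv_rep u) = u),
      (forall u, U u -> inv_rep u = u -> forall v, 'D_v ham_rep u = 0) &
      (forall u, U u -> inv_rep u <> u ->
         exists i, `|inv_rep u - u| <= C * `|'D_(delta_mx 0 i) ham_rep u|)].
Proof.
have [C1 C10 H1] := displacement_le_field ac dp fp.
have com : {for c p, continuous (@hm_form _ _ M c)}.
  by apply: smooth_on_cont (symp_smooth (hm_symplectic M) ac) _; exists p.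
have [C2 C20 H2] := nondegenerate_near com (symp_nondeg (hm_symplectic M) ac (chart_imgP dp)).
have [r /= r0 Hr] := (nbhs_ballP _ _).1 (filterI H1 H2).
exists (ball (c p) r), (C1 * C2).
have img u : ball (c p) r u -> chart_img c u by move=> /Hr [] [].
have dom u : ball (c p) r u -> chart_dom c (hm_act pi (chart_inv c u)) by move=> /Hr [] [].
have fixd u : ball (c p) r u -> inv_rep u = u ->
    fixed_point (@hm_act _ _ M) (chart_inv c u).
  move=> bu gu; apply: fixed_pi.
  by rewrite -[LHS](chartK cc (dom u bu)) -/(inv_rep u) gu.
split; split => //.
- exact: ball_open.
- exact: ballxx.
- exact: mulr_gt0.
- apply: smooth_on_sub ((act_smooth_map pi openT).2 _ _ ac ac) => u bu.
  exists (chart_inv c u); last exact: (chart_invK cc (img u bu)).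
  by split; [split => //; exact: (chart_inv_dom cc (img u bu))|exact: dom].
- by rewrite /inv_rep (chartK cc)// fp.
- move=> u bu; rewrite /inv_rep (chartK cc); last exact: dom.
  rewrite -(act_add (hm_action M)).
  have -> : pi + pi = 2 * pi :> R by ring.
  by rewrite (act_period (hm_action M)) (chart_invK cc)//; exact: img.
- move=> u bu gu v; rewrite ham_rep_derive; last exact: img.
  have fx := fixed_critical (fixd u bu gu).
  have := fx c ac (chart_inv_dom cc (img u bu)) v; rewrite (chart_invK cc); last exact: img.
  by move=> ->; rewrite mulr0.
- move=> u bu gu; have [[iu du Hu] Hw] := Hr _ bu.
  have dx := chart_inv_dom cc iu.
  pose X := gen_field (@hm_act _ _ M) c (chart_inv c u).
  have Y0 : X *m hm_form c u != 0.
    apply/eqP => Y0; apply: gu; apply/eqP; rewrite -subr_eq0 -normr_le0.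
    apply: le_trans Hu _; rewrite -/X pmulr_rle0//.
    by apply: le_trans (Hw X) _; rewrite Y0 normr0 mulr0.
  have [i Hi] := coord_norm_attained Y0; exists i.
  have E1 : (X *m hm_form c u) 0 i = - 'D_(delta_mx 0 i) (@hm_ham _ _ M \o chart_inv c) u.
    have := hm_moment ac dx (delta_mx 0 i); rewrite (chart_invK cc)// => <-.
    by rewrite /eval_form trmx_delta -colE [RHS]mxE.
  rewrite ham_rep_derive// normrM sig_norm mul1r -(normrN ('D_(delta_mx 0 i) (@hm_ham _ _ M \o chart_inv c) u)) -E1.
  apply: le_trans Hu _; rewrite -mulrA ler_pM2l//.
  by apply: le_trans (Hw X) _; rewrite ler_pM2l.
Qed.

Lemma ham_rep_invariant u : chart_dom c (hm_act pi (chart_inv c u)) ->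
  ham_rep (inv_rep u) = ham_rep u.
Proof. by move=> du; rewrite /ham_rep /inv_rep (chartK cc)// ham_invariant. Qed.

Lemma fixed_dichotomy : (\forall u \near c p, ham_rep (c p) <= ham_rep u) \/
  exists2 w, 'D_w inv_rep (c p) = - w & qf ham_rep (c p) w < 0.
Proof.
have [U [C [[oU Up C0 Uimg sg] [gp dom gg crit loj]]]] := fixed_point_setup.
have sh := smooth_on_sub Uimg ham_rep_smooth.
have hg u : U u -> ham_rep (inv_rep u) = ham_rep u.
  by move=> /dom; exact: ham_rep_invariant.
exact: (minimum_or_negative oU Up sg sh gp gg hg crit C0 loj).
Qed.

Lemma fixed_level : \forall u \near c p, inv_rep u = u -> ham_rep u = ham_rep (c p).
Proof.
have [U [C [[oU Up C0 Uimg sg] [gp dom gg crit loj]]]] := fixed_point_setup.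
have sh := smooth_on_sub Uimg ham_rep_smooth.
have [r [r0 Hr]] : exists r, 0 < r /\ forall u, ball (c p) r u -> inv_rep u = u ->
    ham_rep u = ham_rep (c p).
  near (0 : R)^'+ => r; exists r; split => //; near: r.
  exact: (fixed_point_level oU Up sg sh gp gg crit).
by apply/nbhs_ballP; exists r.
Unshelve. all: by end_near. Qed.

End FixedPointLocal.

Lemma critical_level_locally_constant (R : realType) (n : nat) (M : ham_manifold R n) (p : M) :
  critical_point p -> \forall y \near p, critical_point y -> hm_ham y = hm_ham p.
Proof.
move=> /critical_fixed fp; have [c ac dp] := mf_cover p.
have cc := mf_is_chart ac.
have := fixed_level ac dp fp (mul1r 1).
move=> H; have {}H : \forall y \near p, inv_rep c (c y) = c y -> ham_rep c 1 (c y) = ham_rep c 1 (c p).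
  exact: (chart_cont cc dp H).
have D : \forall y \near p, chart_dom c y.
  by apply: open_nbhs_nbhs; split => //; exact: chart_dom_open.
apply: filterS (filterI H D) => y /= [Hy dy] /critical_fixed fy.
move: Hy; rewrite /inv_rep /ham_rep !(chartK cc)// !mul1r; apply.
by rewrite fy.
Qed.

(** * Connectedness of bands *)

Section Descent.
Context (R : realType) (m : nat).
Local Notation E := 'rV[R]_m.
Context (h : E -> R) (U : set E) (p : E).
Hypotheses (oU : open U) (Up : U p) (sh : smooth_on U h).

Definition descends v s0 x := forall s : R, 0 < s <= s0 -> U (s *: v + x) /\ h (s *: v + x) < h p.

Lemma line_near (v : E) (V : set E) : nbhs p V -> exists2 d, 0 < d &
  forall (s : R) x, 0 <= s < d -> ball p d x -> V (s *: v + x).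
Proof.
move=> nV.
have : (fun z : R * E => z.1 *: v + z.2) @ ((0 : R), p) --> 0 *: v + p.
  by apply: cvgD; [apply: cvgZr_tmp; exact: cvg_fst|exact: cvg_snd].
rewrite scale0r add0r => /(_ _ nV)[[A B] [/= /nbhs_ballP[d1 /= d10 H1] /nbhs_ballP[d2 /= d20 H2]] H].
exists (Num.min d1 d2); first by rewrite lt_min d10.
move=> s x /andP[s0 sd] px; apply: (H (s, x)); split => /=.
  by apply: H1; rewrite -ball_normE /= sub0r normrN ger0_norm// (lt_le_trans sd)// ge_min lexx.
by apply: H2; apply: le_ball px; rewrite ge_min lexx orbT.
Qed.

(** In the second alternative [h] is concave along [v], so a nonpositive slope at the start
    suffices. *)
Lemma descent_step (v : E) (V : set E) (d s : R) x : open V -> V `<=` U ->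
  (forall s, 0 <= s < d -> V (s *: v + x)) -> 0 < s < d ->
  (forall y, V y -> 'D_v h y < 0) \/
  (forall y, V y -> qf h y v < 0) /\ 'D_v h x <= 0 ->
  h (s *: v + x) < h x.
Proof.
move=> oV VU seg /andP[s0 sd] H.
have seg' (t : R) : 0 <= t <= 1 -> V (t *: (s *: v) + x).
  move=> /andP[t0 t1]; rewrite scalerA; apply: seg.
  by rewrite mulr_ge0 ?(ltW s0)//= (le_lt_trans _ sd)// ler_piMl// ltW.
have b1 (b : R) : 0 < b < 1 -> V (b *: (s *: v) + x) by move=> /andP[b0 b1]; apply: seg'; rewrite !ltW.
case: H => [H|[H D]].
  have [t /seg' Vt|b /b1 Vb ->] := @mean_value _ _ h x (s *: v).
    exact: smooth_on_diff sh (VU _ Vt).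
  rewrite deriveZv; last exact: smooth_on_diff sh (VU _ Vb).
  by rewrite gtrDl pmulr_rlt0//; exact: H.
have [|b /b1 Vb ->] := @taylor2 _ _ h V x (s *: v) oV (ndiff_on_sub VU (sh 2)).
  exact: seg'.
rewrite deriveZv; last by apply: smooth_on_diff sh (VU _ _); have := seg' 0; rewrite scale0r add0r; apply; rewrite lexx ler01.
rewrite qfZ -addrA gtrDl.
have q0 := H _ Vb; have : s *: 'D_v h x <= 0 by rewrite pmulr_rle0.
have : s ^+ 2 * qf h (b *: (s *: v) + x) v < 0 by rewrite pmulr_rlt0// exprn_gt0.
lra.
Qed.

Lemma descent_end (v : E) (V : set E) s0 : nbhs p V -> U (s0 *: v + p) -> h (s0 *: v + p) < h p ->
  exists r, [/\ 0 < r, ball p r `<=` V & forall y, ball (s0 *: v + p) r y -> U y /\ h y < h p].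
Proof.
move=> /nbhs_ballP[r1 /= r10 H1] Us hs.
have c := smooth_on_cont sh Us.
have n1 : nbhs (s0 *: v + p) (U `&` [set y | h y < h p]).
  apply: filterI; first exact: open_nbhs_nbhs.
  by apply: (c [set a | a < h p]); exact: lt_nbhsl.
have /nbhs_ballP[r2 /= r20 H2] := n1.
exists (Num.min r1 r2); split; first by rewrite lt_min r10.
  by move=> x /(le_ball _) Hx; apply: H1; apply: Hx; rewrite ge_min lexx.
by move=> x /(le_ball _) Hx; apply: H2; apply: Hx; rewrite ge_min lexx orbT.
Qed.

Lemma regular_descent (v : E) : 'D_v h p < 0 ->
  exists s0 r, [/\ 0 < s0, 0 < r, ball p r `<=` U,
    (forall y, ball (s0 *: v + p) r y -> U y /\ h y < h p) &
    forall x, ball p r x -> h x <= h p -> descends v s0 x].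
Proof.
move=> Dp.
have cD := smooth_on_cont (smooth_on_D v sh) Up.
pose V := U `&` 'D_v h @^-1` [set a | a < 0].
have oV : open V.
  apply: (@open_continuous_preimage E R U [set a | a < 0] ('D_v h)) => //.
  by move=> x Ux; exact: smooth_on_cont (smooth_on_D v sh) Ux.
have nV : nbhs p V by exact: open_nbhs_nbhs.
have [d d0 Hd] := line_near v nV.
pose s0 := d / 2; have s00 : 0 < s0 < d by rewrite /s0; lra.
have [s0p s0d] := andP s00.
have desc x (s : R) : ball p d x -> 0 < s < d -> h (s *: v + x) < h x.
  move=> px sb; apply: (@descent_step v V d) => //.
  - by move=> ? [].
  - by move=> t tb; exact: Hd.
  - by left => y [].
have VU : V `<=` U by move=> ? [].
have Us : U (s0 *: v + p) by apply: VU; apply: Hd; [rewrite (ltW s0p)|exact: ballxx].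
have nb : nbhs p (ball p d `&` U).
  by apply: filterI; [exact: nbhsx_ballx|exact: open_nbhs_nbhs].
have [r [r0 rd Hr]] := descent_end nb Us (desc _ _ (ballxx _ d0) s00).
exists s0, r; split => // [x /rd[]//|x /rd[px Ux] hx s /andP[sp ss0]].
have sd := le_lt_trans ss0 s0d; split.
  by apply: VU; apply: Hd => //; rewrite (ltW sp).
by apply: lt_le_trans hx; apply: desc => //; rewrite sp.
Qed.

(** Near [p] the function is strictly concave along [w], so from any [x] it decreases along [w] or
    along [- w], according to the sign of the slope at [x]. *)
Lemma negative_descent (w : E) : (forall v, 'D_v h p = 0) -> qf h p w < 0 ->
  exists2 d, 0 < d & forall s0, 0 < s0 < d -> exists r,
  [/\ 0 < r, ball p r `<=` U,
    (forall v, v = w \/ v = - w -> forall y, ball (s0 *: v + p) r y -> U y /\ h y < h p) &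
    forall x, ball p r x -> h x <= h p -> descends w s0 x \/ descends (- w) s0 x].
Proof.
move=> cr qp.
have qN y : qf h y (- w) = qf h y w by rewrite -scaleN1r qfZ sqrrN expr1n mul1r.
have cq y : U y -> {for y, continuous (fun y => qf h y w)}.
  move=> Uy.
  apply: (@cvg_comp _ _ _ (fun y => (y, w)) (fun z : E * E => qf h z.1 z.2) _ _ _ _
    (qf_joint_continuous (v := w) sh Uy)).
  apply: (@cvg_pair _ _ _ (nbhs y) (nbhs y) (nbhs w) _ _ _ (fun y => y) (fun _ => w)).
    exact: cvg_id.
  exact: cvg_cst.
pose V := U `&` (fun y => qf h y w) @^-1` [set a | a < 0].
have oV : open V.
  apply: (@open_continuous_preimage E R U [set a | a < 0] (fun y => qf h y w)) => //.
have nV : nbhs p V by exact: open_nbhs_nbhs.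
have VU : V `<=` U by move=> ? [].
have [d1 d10 Hd1] := line_near w nV.
have [d2 d20 Hd2] := line_near (- w) nV.
pose d := Num.min d1 d2.
have d0 : 0 < d by rewrite lt_min d10.
have Hd v x (s : R) : v = w \/ v = - w -> ball p d x -> 0 <= s < d -> V (s *: v + x).
  move=> vw px /andP[s0]; rewrite lt_min => /andP[sd1 sd2].
  by case: vw => ->; [apply: Hd1|apply: Hd2]; rewrite ?s0//; apply: le_ball px;
    rewrite ge_min lexx ?orbT.
have desc v x (s : R) : v = w \/ v = - w -> ball p d x -> 'D_v h x <= 0 -> 0 < s < d ->
    h (s *: v + x) < h x.
  move=> vw px Dx sb; apply: (@descent_step v V d s x oV VU (fun t => @Hd v x t vw px) sb).
  right; split; last exact: Dx.
  by move=> y [_ /= qy]; case: vw => ->; rewrite ?qN.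
exists d => // s0 s0b; have [s0p s0d] := andP s0b.
have ends v : v = w \/ v = - w -> exists r, [/\ 0 < r, ball p r `<=` ball p d `&` U &
    forall y, ball (s0 *: v + p) r y -> U y /\ h y < h p].
  move=> vw; apply: descent_end.
  - by apply: filterI; [exact: nbhsx_ballx|exact: open_nbhs_nbhs].
  - by apply: VU; apply: Hd => //; [exact: ballxx|rewrite (ltW s0p)].
  - by apply: desc => //; [exact: ballxx|rewrite cr].
have [r1 [r10 rd1 Hr1]] := ends w (or_introl erefl).
have [r2 [r20 rd2 Hr2]] := ends (- w) (or_intror erefl).
exists (Num.min r1 r2).
have m1 q : ball q (Num.min r1 r2) `<=` ball q r1 by apply: le_ball; rewrite ge_min lexx.
have m2 q : ball q (Num.min r1 r2) `<=` ball q r2 by apply: le_ball; rewrite ge_min lexx orbT.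
split.
- by rewrite lt_min r10.
- by move=> x /m1/rd1[].
- by move=> v [] -> y; [move=> /m1; exact: Hr1|move=> /m2; exact: Hr2].
- move=> x /m1/rd1[px Ux] hx.
  have main v : v = w \/ v = - w -> 'D_v h x <= 0 -> descends v s0 x.
    move=> vw Dv s /andP[sp ss0]; have sd := le_lt_trans ss0 s0d; split.
      by apply: VU; apply: Hd => //; rewrite (ltW sp).
    by apply: lt_le_trans hx; apply: desc => //; rewrite sp.
  have [D|D] := leP ('D_w h x) 0; first by left; apply: main => //; left.
  right; apply: main; first by right.
  rewrite -scaleN1r deriveZv; last exact: smooth_on_diff sh Ux.
  by rewrite scaleN1r oppr_le0 ltW.
Qed.

End Descent.

Lemma conn_in_path (R : realType) (T : topologicalType) (X : set T) (f : R -> T) (a : R) :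
  0 <= a -> {in `[0, a]%classic, continuous f} -> (forall t, 0 <= t <= a -> X (f t)) ->
  conn_in X (f 0) (f a).
Proof.
move=> a0 cf Xf; exists (f @` `[0, a]%classic); split.
- apply: connected_continuous_connected; first exact: segment_connected.
  by apply: continuous_in_subspaceT.
- by move=> _ [t /= ta <-]; apply: Xf; move: ta; rewrite in_itv.
- by exists 0 => //=; rewrite in_itv /= lexx.
- by exists a => //=; rewrite in_itv /= lexx andbT.
Qed.

Section LocalSublevels.
Context (R : realType) (n : nat) (M : ham_manifold R n).
Local Notation E := 'rV[R]_n.*2.

Lemma conn_in_segment (c : chart R n.*2 M) (X : set M) (a b : E) : mf_atlas c ->
  (forall t : R, 0 <= t <= 1 -> chart_img c (t *: (b - a) + a) /\
     X (chart_inv c (t *: (b - a) + a))) ->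
  conn_in X (chart_inv c a) (chart_inv c b).
Proof.
move=> ac H; pose f (t : R) := chart_inv c (t *: (b - a) + a).
have -> : chart_inv c a = f 0 by rewrite /f scale0r add0r.
have -> : chart_inv c b = f 1 by rewrite /f scale1r subrK.
apply: conn_in_path => // [t|t /H[]//].
rewrite inE /= in_itv /= => /H[it _].
apply: (@cvg_comp _ _ _ (fun t : R => t *: (b - a) + a) (chart_inv c)); last first.
  exact: (chart_inv_cont (mf_is_chart ac) it).
by apply: cvgD; [exact: scalel_continuous|exact: cvg_cst].
Qed.

Lemma conn_in_orbit (X : set M) x (a : R) : 0 <= a ->
  (forall t, 0 <= t <= a -> X (hm_act t x)) -> conn_in X x (hm_act a x).
Proof.
move=> a0 H; rewrite -{1}(act_zero (hm_action M) x).
apply: (conn_in_path (f := fun t => hm_act t x)) => // t _.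
exact: act_orbit_cont.
Qed.

Lemma fixed_orbit_near (p : M) (N : set M) : fixed_point (@hm_act _ _ M) p -> nbhs p N ->
  \forall y \near p, forall t, 0 <= t <= pi -> N (hm_act t y).
Proof.
move=> fp nN.
have H : \forall y \near nbhs p, `[0, pi]%classic `<=` (fun t : R => N (hm_act t y)).
  have /compact_near_coveringP := @segment_compact R 0 pi; apply => t _.
  have cv : (fun z : R * M => hm_act z.1 z.2) @ (t, p) --> hm_act t p.
    exact: (@act_continuous _ _ _ _ (hm_action M) (t, p)).
  rewrite fp in cv; have [[V1 V2] [/= nV1 nV2] HV] := cv _ nN.
  by exists (V1, V2) => // -[t' y] [/= H1 H2]; exact: (HV (t', y)).
by apply: filterS H => y Hy t t01; apply: Hy; rewrite /= in_itv.
Qed.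

Context (sig : R).
Hypothesis sig2 : sig * sig = 1.
Local Notation K := (fun x : M => sig * hm_ham x).

(** What crossing the level of [p] requires: nearby lower points lie in one component of the
    sublevel set of [N], and nearby points of the level are limits of lower points, hence adherent
    to that component. *)
Definition sublevel_local (p : M) (N : set M) := exists V, [/\ nbhs p V,
  (forall x y, V x -> V y -> K x < K p -> K y < K p ->
     conn_in (N `&` [set z | K z < K p]) x y) &
  (forall x, V x -> K x = K p -> forall B, nbhs x B -> exists2 z, B z & K z < K p)].

Section Chart.
Context (c : chart R n.*2 M) (p : M) (N : set M).
Hypotheses (ac : mf_atlas c) (dp : chart_dom c p) (oN : open N) (Np : N p).
Let cc : is_chart c := mf_is_chart ac.
Local Notation h := (ham_rep c sig).

Definition chart_nbhd : set E := chart_img c `&` chart_inv c @^-1` N.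
Local Notation U := chart_nbhd.
Local Notation X := (N `&` [set z | K z < K p]).

Lemma chart_nbhd_open : open U.
Proof. by rewrite /chart_nbhd -chart_imageE//; exact: chart_image_open. Qed.

Lemma chart_nbhd_mem : U (c p).
Proof. by split; [exact: chart_imgP|rewrite /preimage /= chartK]. Qed.

Lemma chart_nbhd_smooth : smooth_on U h.
Proof. by apply: smooth_on_sub (ham_rep_smooth sig ac) => u []. Qed.

Lemma ham_repE x : chart_dom c x -> h (c x) = K x.
Proof. by move=> dx; rewrite /ham_rep (chartK cc). Qed.

(** [W] holds the directions of descent. A low point near [p] descends by [s0] along one of them and
    then moves straight to the end point that belongs to [p]; only the end points of different
    directions remain to be joined. *)
Lemma sublevel_local_descent (W : set E) (s0 r : R) : 0 < s0 -> 0 < r -> ball (c p) r `<=` U ->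
  (forall v, W v -> forall y, ball (s0 *: v + c p) r y -> U y /\ h y < h (c p)) ->
  (forall u, ball (c p) r u -> h u <= h (c p) -> exists2 v, W v & descends h U (c p) v s0 u) ->
  (forall v v', W v -> W v' ->
     conn_in X (chart_inv c (s0 *: v + c p)) (chart_inv c (s0 *: v' + c p))) ->
  sublevel_local p N.
Proof.
move=> s00 r0 rU ends desc joined.
have XU u : U u -> h u < h (c p) -> X (chart_inv c u).
  by move=> [_ Nu] hu; split => //=; move: hu; rewrite (ham_repE dp).
exists (chart_dom c `&` c @^-1` ball (c p) r); split.
- apply: filterI; first by apply: open_nbhs_nbhs; split => //; exact: chart_dom_open.
  by apply: (chart_cont cc dp); exact: nbhsx_ballx.
- have reach x : chart_dom c x -> ball (c p) r (c x) -> K x < K p ->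
      exists2 v, W v & conn_in X x (chart_inv c (s0 *: v + c p)).
    move=> dx bx Kx; have hx : h (c x) < h (c p) by rewrite !ham_repE.
    have [v Wv Hv] := desc _ bx (ltW hx); exists v => //.
    apply: (@conn_in_trans _ _ (chart_inv c (s0 *: v + c x))).
      rewrite -{1}(chartK cc dx); apply: conn_in_segment => // t /andP[t0 t1].
      rewrite addrK scalerA; have [->|tn0] := eqVneq t 0.
        rewrite mul0r scale0r add0r; split; first exact: chart_imgP.
        by apply: XU => //; exact: rU.
      have [|Ut ht] := Hv (t * s0).
        have tp : 0 < t by rewrite lt_def tn0.
        by rewrite mulr_gt0//= ler_piMl// ltW.
      by split; [case: Ut|exact: XU].
    apply: conn_in_segment => // t t01.
    have [|Ut ht] := ends v Wv (t *: (s0 *: v + c p - (s0 *: v + c x)) + (s0 *: v + c x)).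
      apply: ball_segment => //; last exact: ballxx.
      by move: bx; rewrite -!ball_normE /= opprD addrACA subrr add0r.
    by split; [case: Ut|exact: XU].
  move=> x y [dx bx] [dy by_] Kx Ky.
  have [v Wv Hv] := reach x dx bx Kx; have [v' Wv' Hv'] := reach y dy by_ Ky.
  exact: conn_in_trans Hv (conn_in_trans (joined _ _ Wv Wv') (conn_in_sym Hv')).
- move=> x [dx bx] Kx B nB.
  have [|v Wv Hv] := desc _ bx; first by rewrite !ham_repE// Kx.
  have nB' := chart_inv_near cc dx nB.
  have [d d0 Hd] := line_near v nB'.
  pose s := Num.min (d / 2) s0.
  have sb : 0 < s <= s0 by rewrite /s lt_min s00 ge_min lexx orbT divr_gt0.
  have [_ hs] := Hv s sb.
  exists (chart_inv c (s *: v + c x)); last by move: hs; rewrite (ham_repE dp).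
  apply: Hd; last exact: ballxx.
  have [s_gt0 _] := andP sb; rewrite (ltW s_gt0) /= /s gt_min; apply/orP; left; lra.
Qed.

Lemma sublevel_local_regular v : 'D_v h (c p) < 0 -> sublevel_local p N.
Proof.
move=> Dv.
have [s0 [r [s00 r0 rU ends desc]]] :=
  regular_descent chart_nbhd_open chart_nbhd_mem chart_nbhd_smooth Dv.
apply: (@sublevel_local_descent [set v] s0 r) => //.
- by move=> _ -> y; exact: ends.
- by move=> u bu hu; exists v => //; exact: desc.
- move=> _ _ -> ->; apply: conn_in_refl.
  have [[_ Nu] hu] := ends _ (ballxx _ r0).
  by split => //=; move: hu; rewrite (ham_repE dp).
Qed.

Lemma segment_arith (t d0 s : R) (a b q w : E) : 0 <= t <= 1 -> b - q = s *: - w ->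
  `|a - q - s *: - w| <= d0 * s -> `|t *: (b - a) + a - q - s *: - w| <= d0 * s.
Proof.
move=> /andP[t0 t1] Eb H.
have -> : t *: (b - a) + a - q - s *: - w = (1 - t) *: (a - q - s *: - w).
  have -> : b = s *: - w + q by rewrite -Eb subrK.
  by apply/rowP => i; rewrite !mxE; ring.
rewrite normrZ ger0_norm ?subr_ge0//; apply: le_trans H.
by rewrite ler_piMl// lerBlDr lerDl.
Qed.

(* The half orbit t in [0, pi] leads from p + sw to a point close to p - sw
   inside a level set. *)
Lemma opposite_joined (w : E) : fixed_point (@hm_act _ _ M) p ->
  'D_w (inv_rep c) (c p) = - w -> qf h (c p) w < 0 ->
  exists2 d, 0 < d & forall s, 0 < s < d -> h (s *: w + c p) < h (c p) ->
    conn_in X (chart_inv c (s *: w + c p)) (chart_inv c (s *: - w + c p)).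
Proof.
move=> fp Dw qw.
have [U' [C [[oU' U'p _ _ sg] [gp _ _ crit _]]]] := fixed_point_setup ac dp fp sig2.
have {}crit := crit _ U'p gp.
have qN : qf h (c p) (- w) = qf h (c p) w by rewrite -scaleN1r qfZ sqrrN expr1n mul1r.
(* Half the form plus this error is a quarter of the form, still negative. *)
pose e := - qf h (c p) w / 4.
have e0 : 0 < e by rewrite /e; lra.
have [d1 d10 Hd1] := critical_expansion (- w) chart_nbhd_open chart_nbhd_smooth
  chart_nbhd_mem crit e0.
have [d2 d20 Hd2] := first_order w (smooth_on_diff sg U'p) d10.
have /nbhs_ballP[r1 /= r10 Hr1] : nbhs (c p) U.
  by apply: open_nbhs_nbhs; split; [exact: chart_nbhd_open|exact: chart_nbhd_mem].
have tube : \forall u \near c p, forall t, 0 <= t <= pi ->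
    N (hm_act t (chart_inv c u)) /\ chart_dom c (hm_act t (chart_inv c u)).
  have ND : nbhs p (N `&` chart_dom c).
    by apply: filterI; apply: open_nbhs_nbhs; split => //; exact: chart_dom_open.
  exact: (chart_inv_near cc dp (fixed_orbit_near fp ND)).
have [d3 d30 Hd3] := line_near w (filterI tube (chart_dom_near cc dp)).
pose d4 := r1 / (d1 + `|w| + 1).
have c0 : 0 < d1 + `|w| + 1 by rewrite ltr_wpDl// addr_ge0// ltW.
exists (Num.min (Num.min d1 d2) (Num.min d3 d4)).
  by rewrite !lt_min d10 d20 d30 divr_gt0.
move=> s /andP[s0]; rewrite !lt_min => /andP[/andP[sd1 sd2] /andP[sd3 sd4]] hs.
have [Hor iu] := Hd3 s (c p) (introT andP (conj (ltW s0) sd3)) (ballxx _ d30).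
have pi0 : 0 <= pi :> R by exact: (ltW (pi_gt0 R)).
pose x := chart_inv c (s *: w + c p).
apply: (@conn_in_trans _ _ (hm_act pi x)).
  apply: conn_in_orbit => // t t01; have [Nt _] := Hor t t01; split => //=.
  rewrite ham_invariant; move: hs.
  by rewrite (ham_repE dp) /ham_rep.
have [_ dpi] := Hor pi (introT andP (conj pi0 (lexx _))).
have H1 := Hd2 s (introT andP (conj s0 sd2)); rewrite gp Dw in H1.
rewrite -(chartK cc dpi) -/(inv_rep c (s *: w + c p)).
apply: conn_in_segment => // t t01.
(* Along the segment the deviation from [s *: - w] only shrinks, so the second order expansion
   applies to all of it. *)
set a := inv_rep c _ in H1 *; set z := t *: _ + a.
have Hz : `|(z - c p) - s *: - w| <= d1 * s.
  by apply: segment_arith => //; rewrite addrK.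
have nz : `|z - c p| < r1.
  have : `|z - c p| <= d1 * s + s * `|w|.
    rewrite -(subrK (s *: - w) (z - c p)) (le_trans (ler_normD _ _))// lerD//.
    by rewrite normrZ normrN (gtr0_norm s0).
  move=> /le_lt_trans; apply; rewrite (mulrC s) -mulrDl.
  move: sd4; rewrite /d4 ltr_pdivlMr//; move: s0; move: (`|w|) => W s0; nra.
have Uz : U z by apply: Hr1; rewrite -ball_normE /= distrC.
split; first by case: Uz.
split; first by case: Uz.
have := Hd1 s (z - c p) (introT andP (conj s0 sd1)) Hz; rewrite subrK qN => Hh.
have : h z < h (c p).
  have s2 : 0 < s ^+ 2 by rewrite exprn_gt0.
  have := mulr_gt0 s2 e0; rewrite /e.
  move: Hh; rewrite /e ler_norml => /andP[_]; clear; move: (h z) (h (c p)) (qf _ _ _) => A B Q; lra.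
by rewrite (ham_repE dp).
Qed.

Lemma sublevel_local_fixed : fixed_point (@hm_act _ _ M) p ->
  (\forall y \near p, K p <= K y) \/ sublevel_local p N.
Proof.
move=> fp; have [Hm|[w Dw qw]] := fixed_dichotomy ac dp fp sig2.
  left; have {}Hm : \forall y \near p, h (c p) <= h (c y) by exact: (chart_cont cc dp Hm).
  have D : \forall y \near p, chart_dom c y.
    by apply: open_nbhs_nbhs; split => //; exact: chart_dom_open.
  by apply: filterS (filterI Hm D) => y [Hy dy]; move: Hy; rewrite !ham_repE.
right.
have [U' [C [[oU' U'p _ _ sg] [gp _ _ crit _]]]] := fixed_point_setup ac dp fp sig2.
have {}crit := crit _ U'p gp.
have [d1 d10 Hd1] := negative_descent chart_nbhd_open chart_nbhd_mem chart_nbhd_smooth crit qw.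
have [d2 d20 Hd2] := opposite_joined fp Dw qw.
pose s0 := Num.min d1 d2 / 2.
have m0 : 0 < Num.min d1 d2 by rewrite lt_min d10.
have s00 : 0 < s0 by rewrite divr_gt0.
have sm : s0 < Num.min d1 d2 by rewrite /s0; move: m0; move: (Num.min _ _) => a; lra.
move: sm; rewrite lt_min => /andP[sd1 sd2].
have [r [r0 rU ends desc]] := Hd1 s0 (introT andP (conj s00 sd1)).
have hw := ends w (or_introl erefl) _ (ballxx _ r0).
have J := Hd2 s0 (introT andP (conj s00 sd2)) hw.2.
have XU u : U u /\ h u < h (c p) -> X (chart_inv c u).
  by move=> [[_ Nu] hu]; split => //=; move: hu; rewrite (ham_repE dp).
apply: (@sublevel_local_descent [set v | v = w \/ v = - w] s0 r) => //.
- move=> u bu hu; have [H|H] := desc u bu hu; first by exists w => //; left.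
  by exists (- w) => //; right.
- move=> v v' [->|->] [->|->] //.
  + by apply: conn_in_refl; exact: XU.
  + exact: conn_in_sym.
  + by apply: conn_in_refl; apply: XU; apply: (ends (- w)); [right|exact: ballxx].
Qed.

End Chart.

(** At a regular point one of [v] and [- v] descends; a critical point is fixed, and is a local
    minimum or has a negative direction that the half turn reverses. *)
Lemma sublevel_dichotomy p N : open N -> N p ->
  (\forall y \near p, K p <= K y) \/ sublevel_local p N.
Proof.
move=> oN Np; have [cp|ncp] := pselect (critical_point p).
  have [c ac dp] := mf_cover p.
  exact: (sublevel_local_fixed ac dp oN Np (critical_fixed cp)).
move/existsNP: ncp => [c /not_implyP[ac /not_implyP[dp /existsNP[v Dv]]]]; right.
have Dh := ham_rep_derive sig ac v (chart_imgP dp).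
have s0 : sig != 0 by apply/eqP => s0; move: sig2; rewrite s0 mul0r => /eqP; rewrite eq_sym oner_eq0.
have [D|D|D] := ltgtP ('D_v (ham_rep c sig) (c p)) 0.
- exact: (sublevel_local_regular ac dp oN Np D).
- apply: (@sublevel_local_regular _ _ _ ac dp oN Np (- v)).
  rewrite -scaleN1r deriveZv; first by rewrite scaleN1r oppr_lt0.
  exact: smooth_on_diff (ham_rep_smooth sig ac) (chart_imgP dp).
- by case: Dv; move: D; rewrite Dh => /eqP; rewrite mulf_eq0 (negbTE s0) => /eqP.
Qed.

End LocalSublevels.

Lemma connected_locally_constant (T : topologicalType) (C : set T) (P : T -> Prop) x y :
  connected C -> (forall z, C z -> \forall z' \near z, P z <-> P z') ->
  C x -> C y -> P x -> P y.
Proof.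
move=> cC H Cx Cy Px.
suff E : C `&` [set z | P z] = C by have [] : (C `&` [set z | P z]) y by rewrite E.
apply: cC; first by exists x.
- exists [set z | P z]°; first exact: open_interior.
  apply/seteqP; split => z [Cz Pz]; split => //.
    by apply: filterS (H z Cz) => z' [+ _]; apply.
  exact: nbhs_singleton Pz.
- exists (~` [set z | ~ P z]°); first by apply: open_closedC; exact: open_interior.
  apply/seteqP; split => z [Cz Pz]; split => //.
    by move=> /nbhs_singleton; apply.
  apply: contrapT => nP; apply: Pz; apply: filterS (H z Cz) => z' [_ h] /= Pz'.
  by apply: nP; exact: h.
Qed.

(** * Connectedness of sublevel sets *)

Section Sublevels.
Context (R : realType) (n : nat) (M : ham_manifold R n) (sig : R).
Hypothesis sig2 : sig * sig = 1.
Hypothesis compM : compact [set: M].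
Context (X : set M).
Hypothesis oX : open X.
Local Notation K := (fun x : M => sig * hm_ham x).
Local Notation J c := (conn_in (X `&` [set z | K z < c])).

Lemma level_continuous : continuous K.
Proof. by move=> x; apply: cvgM; [exact: cvg_cst|exact: ham_continuous]. Qed.

Lemma sublevel_near z c : K z < c -> \forall z' \near z, K z' < c.
Proof. by move=> /lt_nbhsl h; exact: (level_continuous h). Qed.

Lemma sublevel_open c : open (X `&` [set z | K z < c]).
Proof.
rewrite openE => z [Xz Kz]; apply: filterI; first exact: open_nbhs_nbhs.
exact: sublevel_near.
Qed.

Lemma conn_in_near (Y : set M) z : open Y -> Y z -> \forall z' \near z, conn_in Y z z'.
Proof.
move=> oY Yz; have [c ac dz] := mf_cover z; have cc := mf_is_chart ac.
have nU : nbhs (c z) (chart_nbhd c Y).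
  by apply: open_nbhs_nbhs; split; [exact: chart_nbhd_open|exact: chart_nbhd_mem].
have /nbhs_ballP[r /= r0 Hr] := nU.
have nz : \forall z' \near z, chart_dom c z' /\ ball (c z) r (c z').
  apply: filterI; first by apply: open_nbhs_nbhs; split => //; exact: chart_dom_open.
  by apply: (chart_cont cc dz); exact: nbhsx_ballx.
apply: filterS nz => z' [dz' bz'].
rewrite -(chartK cc dz) -(chartK cc dz'); apply: conn_in_segment => // t t01.
by apply: Hr; apply: ball_segment => //; exact: ballxx.
Qed.

(** Each point of the connecting set [C] has room below [c], so being joined to [x] at some lower
    level is a locally constant condition on [C]. *)
Lemma sublevel_limit c x y : J c x y -> exists2 c', c' < c & J c' x y.
Proof.
move=> [C [cC CX Cx Cy]].
have loc z : C z -> \forall z' \near z, exists2 c', c' < c & J c' z z'.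
  move=> /CX[Xz /= Kz]; pose c' := (K z + c) / 2.
  have Kc' : K z < c' by rewrite /c'; lra.
  have c'c : c' < c by rewrite /c'; lra.
  have := @conn_in_near _ z (sublevel_open c') (conj Xz Kc').
  by apply: filterS => z' Hz'; exists c'.
have up c1 c2 a b : c1 <= c2 -> J c1 a b -> J c2 a b.
  move=> c12; apply: conn_in_sub => z [Xz /= Kz]; split => //=; exact: lt_le_trans c12.
have trans a b d : (exists2 c', c' < c & J c' a b) -> (exists2 c', c' < c & J c' b d) ->
    exists2 c', c' < c & J c' a d.
  move=> [c1 h1 H1] [c2 h2 H2]; exists (Num.max c1 c2); first by rewrite gt_max h1.
  by apply: (@conn_in_trans _ _ b); [apply: up H1|apply: up H2]; rewrite le_max lexx ?orbT.
apply: (@connected_locally_constant _ C (fun z => exists2 c', c' < c & J c' x z) x y) => //.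
- move=> z Cz; apply: filterS (loc z Cz) => z' Hz'; split => Hz; first exact: trans Hz Hz'.
  by have [c' h1 H1] := Hz'; apply: trans Hz _; exists c' => //; exact: conn_in_sym.
- have := loc x Cx => /nbhs_singleton[c' h1 H1]; by exists c'.
Qed.

(* Otherwise the sublevel set has a clopen partition separating x from y. By
   the local dichotomy it extends to the compact level set c, and then to the
   sublevel sets slightly above c, where x and y are joined. *)
Lemma sublevel_jump c x y : (forall z, K z = c -> X z) -> X x -> X y -> K x < c -> K y < c ->
  (forall c', c < c' -> J c' x y) -> J c x y.
Proof.
move=> cX Xx Xy Kx Ky H; apply: contrapT => nJ.
pose A z := [/\ X z, K z < c & J c x z].
pose B z := [/\ X z, K z < c & ~ J c x z].
have AB z : A z -> B z -> False by move=> [_ _ h] [_ _ /(_ h)].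
have step z : X z -> K z < c -> \forall z' \near z, J c z z' /\ X z' /\ K z' < c.
  move=> Xz Kz; apply: filterI; first exact: (conn_in_near (sublevel_open c) (conj Xz Kz)).
  exact: open_nbhs_nbhs (conj (sublevel_open c) (conj Xz Kz)).
have nearA z : A z -> \forall z' \near z, A z'.
  move=> [Xz Kz Jz].
  by apply: filterS (step z Xz Kz) => z' [Jz' [Xz' Kz']]; split => //; exact: conn_in_trans Jz Jz'.
have nearB z : B z -> \forall z' \near z, B z'.
  move=> [Xz Kz Jz].
  apply: filterS (step z Xz Kz) => z' [Jz' [Xz' Kz']]; split => // xz'; apply: Jz.
  exact: conn_in_trans xz' (conn_in_sym Jz').
pose SA := [set p | \forall z \near p, K z < c -> A z]°.
pose SB := [set p | \forall z \near p, K z < c -> B z]°.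
have SAP p : (\forall z \near p, K z < c -> A z) -> SA p.
  by move=> h; exact: (nbhs_interior h).
have SBP p : (\forall z \near p, K z < c -> B z) -> SB p.
  by move=> h; exact: (nbhs_interior h).
have SAE p : SA p -> \forall z \near p, K z < c -> A z by move=> /nbhs_singleton.
have SBE p : SB p -> \forall z \near p, K z < c -> B z by move=> /nbhs_singleton.
(* A local minimum falls under [SA] vacuously, having no lower points near it. Elsewhere, a
   neighbourhood [V] without points of [A] excludes [SA] for all level points in its interior, as
   these are limits of lower points. *)
have loc p : K p = c -> SA p \/ [/\ SB p &
    exists2 V, nbhs p V & forall q, V q -> K q = c -> ~ SA q].
  move=> Kp; have [Hm|[V [nV HV Hcl]]] := sublevel_dichotomy sig2 oX (cX _ Kp).
    by left; apply: SAP; apply: filterS Hm => z; rewrite Kp => /le_lt_trans h /h; rewrite ltxx.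
  rewrite Kp in HV Hcl.
  have [[z0 [Vz0 Az0]]|nA] := pselect (exists z, V z /\ A z).
    left; apply: SAP; apply: filterS nV => z Vz Kz; have [Xz0 Kz0 Jz0] := Az0.
    have Jz := HV _ _ Vz0 Vz Kz0 Kz.
    have [C [_ CX _ /CX[Xz _]]] := Jz.
    by split => //; exact: conn_in_trans Jz0 Jz.
  have [HA|nSA] := pselect (SA p); [by left|right].
  have VB z : V z -> K z < c -> B z.
    move=> Vz Kz; have [C [_ CX /CX[Xz _] _]] := HV _ _ Vz Vz Kz Kz.
    by split => // Jz; apply: nA; exists z.
  split; first by apply: SBP; apply: filterS nV => z; exact: VB.
  exists V°; first exact: nbhs_interior.
  move=> q Vq Kq /SAE SAq.
  have [z [Vz SAz] Kz] := Hcl q (nbhs_singleton Vq) Kq _ (filterI Vq SAq).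
  exact: AB (SAz Kz) (VB z Vz Kz).
(* [LB] is closed because [SA] is open, [LA] because of [loc]; normality then separates the two
   parts of the level. *)
pose LA := [set p | K p = c] `&` SA.
pose LB := [set p | K p = c] `&` ~` SA.
have lvl : closed [set p | K p = c].
  rewrite (_ : [set p | K p = c] = K @^-1` [set c]) //.
  by apply: closed_comp => // z _; exact: level_continuous.
have cLB : closed LB by apply: closedI => //; apply: open_closedC; exact: open_interior.
have cLA : closed LA.
  move=> p clp; have Kp : K p = c by apply: lvl; apply: closure_subset clp => z [].
  split => //; have [//|] := loc p Kp; move=> [_ [V nV HV]].
  by have [q [[Kq SAq] Vq]] := clp _ nV; have /(_ SAq) := HV q Vq Kq.
have dis : LA `&` LB = set0 by apply/seteqP; split => // p [[_ h] [_ /(_ h)]].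
have /(@normal_openP R) nrm := compact_normal (@mf_hausdorff _ _ M) compM.
have [G1 [G2 [oG1 oG2 LG1 LG2 G12]]] := nrm LA LB cLA cLB dis.
have disj p : G1 p -> G2 p -> False by move=> h1 h2; have : (G1 `&` G2) p by []; rewrite G12.
pose OA := G1 `&` SA; pose OB := G2 `&` SB.
have oOA : open OA by apply: openI => //; exact: open_interior.
have oOB : open OB by apply: openI => //; exact: open_interior.
have lev p : K p = c -> (OA `|` OB) p.
  move=> Kp; have [h|h] := pselect (SA p); first by left; split => //; apply: LG1.
  by right; have [//|[SBp _]] := loc p Kp; split => //; exact: LG2.
(* On the compact set at or above [c] left uncovered by [OA] and [OB], [K] has a minimum, and it
   exceeds [c] since the level [c] is covered. *)
have [c' cc' Hc'] : exists2 c', c < c' & forall z, c <= K z < c' -> (OA `|` OB) z.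
  pose D := [set z | c <= K z] `&` ~` (OA `|` OB).
  have cD : closed D.
    apply: closedI; last by apply: open_closedC; exact: openU.
    rewrite (_ : [set z | c <= K z] = K @^-1` [set a | c <= a]) //.
    by apply: closed_comp => // z _; exact: level_continuous.
  have [D0|D0] := pselect (D !=set0); last first.
    exists (c + 1); first lra.
    move=> z /andP[cz _]; apply: contrapT => h; apply: D0.
    by exists z.
  have kD : compact D by apply: subclosed_compact compM _.
  have [p /set_mem [cp Dp] Hp] := compact_EVT_min D0 kD
    (continuous_subspaceT level_continuous).
  exists (K p).
    by rewrite lt_neqAle cp andbT; apply/eqP => E; apply: Dp; exact: lev.
  move=> z /andP[cz zp]; apply: contrapT => h.
  have := Hp z (mem_set (conj cz h)); by rewrite leNgt zp.
have [C [cC CX Cx Cy]] := H c' cc'.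
(* [A] continued above [c] by its side [OA]: locally constant on the connected set [C] and true at
   [x], hence true at [y], which is impossible. *)
pose P z := A z \/ c <= K z /\ OA z.
have : P y.
  apply: (@connected_locally_constant _ C P x y) => //.
    move=> z /CX[Xz /= Kz].
    have yes : (\forall z' \near z, P z') -> \forall z' \near z, P z <-> P z'.
      move=> h; have h0 := nbhs_singleton h; by apply: filterS h.
    have no : (\forall z' \near z, ~ P z') -> \forall z' \near z, P z <-> P z'.
      move=> h; have h0 := nbhs_singleton h; by apply: filterS h.
    have [Kc|cK] := ltP (K z) c.
      have [Jz|nJz] := pselect (J c x z).
        by apply: yes; apply: filterS (nearA z _) => // z' h; left.
      have zB : B z by [].
      apply: no; apply: filterS (nearB z zB) => z' h [/AB/(_ h)//|[]].
      by case: h => _ h _; rewrite leNgt h.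
    have [hA|hB] := Hc' z (introT andP (conj cK Kz)).
      apply: yes; apply: filterS (open_nbhs_nbhs (conj oOA hA)) => z' OAz'.
      have [Kz'|] := ltP (K z') c; last by right.
      by left; exact: (nbhs_singleton (SAE _ OAz'.2)).
    apply: no; apply: filterS (open_nbhs_nbhs (conj oOB hB)) => z' OBz'.
    move=> [Az'|[_ OAz']]; last exact: disj OAz'.1 OBz'.1.
    have [_ Kz' _] := Az'.
    exact: AB Az' (nbhs_singleton (SBE _ OBz'.2) Kz').
  by left; split => //; apply: conn_in_refl.
case=> [[_ _ //]|[cKy _]]; by rewrite leNgt Ky in cKy.
Qed.

(** Let [c0] be the infimum of the levels from [c] on at which [x] and [y] are joined. It is
    attained by [sublevel_jump], and [sublevel_limit] would lower it if it exceeded [c]. The second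
    hypothesis keeps the levels to be crossed inside [X]. *)
Lemma sublevel_connected c x y : connected X -> (forall z, c <= K z -> X z) ->
  X x -> X y -> K x < c -> K y < c -> J c x y.
Proof.
move=> cX cK Xx Xy Kx Ky.
have up c1 c2 : c1 <= c2 -> J c1 x y -> J c2 x y.
  move=> c12; apply: conn_in_sub => z [Xz /= Kz]; split => //=; exact: lt_le_trans c12.
pose S := [set c' | c <= c' /\ J c' x y].
have S0 : S !=set0.
  have [|b _ Hb] := compact_EVT_max _ compM (continuous_subspaceT level_continuous).
    by exists x.
  have cb : c <= Num.max c (K b + 1) by rewrite le_max lexx.
  exists (Num.max c (K b + 1)); split => //; exists X; split => // z Xz; split => //=.
  rewrite lt_max; apply/orP; right; have := Hb z (mem_set I); lra.
have lS : has_lbound S by exists c => c' [].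
pose c0 := inf S.
have cc0 : c <= c0 by apply: lb_le_inf => // c' [].
have Jc0 : J c0 x y.
  apply: sublevel_jump => //; try exact: lt_le_trans cc0.
    by move=> z Kz; apply: cK; rewrite Kz.
  move=> c' c0c'; have [c1 [_ J1] c1c'] : exists2 c1, S c1 & c1 < c'.
    by apply: inf_lt => //; split.
  exact: up (ltW c1c') J1.
have [<-//|cltc0] := eqVneq c0 c.
have [c' c'c0 Jc'] := sublevel_limit Jc0.
have : c0 <= Num.max c c'.
  apply: ge_inf => //; split; first by rewrite le_max lexx.
  by apply: up Jc'; rewrite le_max lexx orbT.
by rewrite leNgt gt_max c'c0 lt_neqAle cc0 eq_sym cltc0.
Qed.

End Sublevels.

(** * Bands are connected and carry Hamiltonian structures *)

Section Bands.
Context (R : realType) (n : nat) (M : ham_manifold R n).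

(** Two cuts: the whole manifold by [H < b], then the resulting connected open set by [- H < - a].
    The levels crossed in the second cut have height at most [a], hence lie inside the first. *)
Lemma band_connected (a b : R) : compact [set: M] -> connected (@between _ _ M a b).
Proof.
move=> cM; have [[x xb]|] := pselect (exists x : M, between a b x); last first.
  move=> h; rewrite (_ : between a b = set0); first exact: connected0.
  by apply/seteqP; split => // x xb; case: h; exists x.
pose X := [set z : M | hm_ham z < b].
have low y z : X y -> X z -> conn_in X y z.
  move=> /= yb zb; apply: (conn_in_sub (X := setT `&` [set z : M | 1 * hm_ham z < b])).
    by move=> t [_ /=]; rewrite mul1r.
  apply: (sublevel_connected (mul1r 1) cM) => //; rewrite ?mul1r//.
  - exact: openT.
  - exact: hm_connected.
have cX : connected X.
  have [ax xb'] := andP xb; apply: (conn_in_connected (x := x)) => // y yb; exact: low.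
have oX : open X.
  rewrite (_ : X = @hm_ham _ _ M @^-1` [set v | v < b])//.
  by apply: open_comp => // z _; exact: ham_continuous.
apply: (conn_in_connected (x := x)) => // y yb.
have [ax xb'] := andP xb; have [ay yb'] := andP yb.
apply: (conn_in_sub (X := X `&` [set z : M | -1 * hm_ham z < - a])).
  by move=> t [tb /=]; rewrite mulN1r ltrN2 /between /= => ->.
have m11 : -1 * -1 = 1 :> R by rewrite mulN1r opprK.
apply: (sublevel_connected m11 cM oX cX) => //; rewrite ?mulN1r ?ltrN2//.
by move=> z; rewrite mulN1r lerN2 => za; exact: le_lt_trans za (lt_trans ax xb').
Qed.

Context (a b : R).
Hypothesis cM : compact [set: M].
Hypothesis ne : (@between _ _ M a b) !=set0.
Local Notation A := (@between _ _ M a b).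

Lemma band_trans (i k : unit) : exists tau : M -> M,
  let B := A `&` [set x | exists2 y, A y & y = x] in
  let B' := A `&` [set y | exists2 x, A x & x = y] in
  [/\ open B, act_invariant B, isom_on B B' tau & forall x, B x -> tau x = x].
Proof.
have E : A `&` [set x | exists2 y, A y & y = x] = A.
  by apply/seteqP; split => [x []//|x Ax]; split => //; exists x.
exists id; rewrite /= E; split => //.
- exact: between_open.
- exact: between_invariant.
- by apply: isom_id; exact: between_open.
Qed.

Definition band_gluing : gluing R n := @Gluing R n unit (fun _ => M) (fun _ => A) M (fun _ x => x)
  (ex_intro (fun _ : unit => A !=set0) tt ne) (fun _ => @between_open _ _ M a b)
  (fun _ => @between_invariant _ _ M a b) (fun _ x y _ _ E => E) band_trans
  (fun _ _ x y Ax Ay _ => ex_intro _ tt (ex_intro _ x (ex_intro _ y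
     (And4 Ax Ay (erefl x) (erefl y))))).

Local Notation G := band_gluing.
Local Notation T := (glue_mf G).
Local Notation inj := (@glue_inj R n G tt : M -> T).

Lemma band_cover (t : T) : exists2 x : M, A x & inj x = t.
Proof. by have [[] [x [Ax xt]]] := glue_cover t; exists x. Qed.

Lemma band_inj_cont : {in A, continuous inj}.
Proof. by move=> x /set_mem Ax; exact: (@glue_inj_cont R n G tt x Ax). Qed.

Lemma band_glue_connected : connected [set: T].
Proof.
rewrite (_ : [set: T] = inj @` A); last first.
  by apply/seteqP; split => // t _; have [x Ax <-] := band_cover t; exists x.
apply: connected_continuous_connected; first exact: band_connected.
by apply: continuous_in_subspaceT; exact: band_inj_cont.
Qed.

(** The preimage is already the full preimage in [M], a closed subset of a compact space that is
    contained in the band. *)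
Lemma band_glue_proper (K : set R) : compact K -> K `<=` range (@glue_ham _ _ G) ->
  compact (@glue_ham _ _ G @^-1` K : set T).
Proof.
move=> cK Kr.
have hE x : A x -> glue_ham (inj x : T) = hm_ham x by move=> Ax; exact: (@glue_hamE R n G tt).
have KA x : K (hm_ham x) -> A x.
  move=> /Kr[t _]; have [y Ay <-] := band_cover t; rewrite hE// => E.
  by move: Ay; rewrite /between /= E.
rewrite (_ : (@glue_ham _ _ G) @^-1` K = inj @` (@hm_ham _ _ M @^-1` K)); last first.
  apply/seteqP; split => [t|_ [x Kx <-]].
    by have [x Ax <-] := band_cover t; rewrite /preimage /= hE// => Kx; exists x.
  by rewrite /preimage /= hE//; exact: KA.
apply: continuous_compact.
  by apply: continuous_in_subspaceT => x /set_mem Kx; apply: band_inj_cont; apply/mem_set/KA.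
apply: (subclosed_compact _ cM) => //.
apply: preimage_closed; first by move=> t _; exact: ham_continuous.
exact: compact_closed (@Rhausdorff R) cK.
Qed.

Lemma band_manifold : exists (B : ham_manifold R n) (f : B -> M) (g : M -> B),
  [/\ isom_on setT A f, isom_on A setT g & forall x, A x -> f (g x) = x].
Proof.
have isoG := @glue_inj_isom R n G band_glue_connected band_glue_proper tt.
pose B := glue_hm band_glue_connected band_glue_proper.
have E : (@glue_piece R n G tt : set B) = setT.
  by apply/seteqP; split => // t _; have [x Ax <-] := band_cover t; exists x.
rewrite E in isoG.
have [f [If fK _]] := isom_inv (@between_open _ _ M a b) openT
  (@between_invariant _ _ M a b) isoG.
by exists B, f, inj.
Qed.

End Bands.

(** * Local data of a closed manifold *)

Lemma compact_locally_finite (T : topologicalType) (V : Type) (P : set T) (h : T -> V) :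
  compact [set: T] -> (forall p, \forall y \near p, P y -> h y = h p) -> finite_set (h @` P).
Proof.
move=> cT loc.
(* Near-covering along the filter of the finite sets ordered by inclusion. *)
pose F := filter_from (@finite_set V) (fun S0 => [set S : set V | S0 `<=` S]).
have FF : Filter F.
  apply: filter_from_filter; first by exists set0; exact: finite_set0.
  move=> S S' fS fS'; exists (S `|` S'); first by rewrite finite_setU.
  by move=> S2 sub; split=> v Sv; apply: sub; [left|right].
have cov : \forall S \near F, [set: T] `<=` (fun y => P y -> S (h y)).
  have /compact_near_coveringP := cT; apply => p _.
  exists ([set y | P y -> h y = h p], [set S : set V | S (h p)]).
    split => /=; first exact: loc.
    by exists [set h p]; [exact: finite_set1|move=> S; exact].
  by move=> [y S] /= [Hy Sp] /Hy ->.
have [S fS /(_ S (fun _ x => x)) HS] := cov.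
by apply: sub_finite_set fS => _ [y Py <-]; exact: HS.
Qed.

Lemma finite_increasing_enum (R : realType) (A : set R) a b : finite_set A -> A a -> A b ->
  a < b -> exists s (l : nat -> R), (forall j, (j <= s)%N -> l j < l j.+1) /\
    forall v, A v <-> exists2 i, (i <= s.+1)%N & v = l i.
Proof.
move=> /finite_seqP[r ->] /= ra rb ab.
pose t := sort <=%R (undup r).
have tr v : (v \in t) = (v \in r) by rewrite mem_sort mem_undup.
have st : sorted <%R t by rewrite lt_sorted_uniq_le sort_uniq undup_uniq sort_le_sorted.
(* The two distinct elements [a] and [b] guarantee a least and a greatest level. *)
have [s Es] : exists s, size t = s.+2.
  have : a \in t by rewrite tr.
  have : b \in t by rewrite tr.
  case: t {tr st} => [//|u [|v t]] /=; last by exists (size t).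
  by rewrite !inE => /eqP bu /eqP au; move: ab; rewrite au bu ltxx.
exists s, (nth 0 t); split => [j js|v].
  by rewrite (lt_sorted_ltn_nth 0 st) ?inE ?Es ?ltnS// (leq_trans js).
rewrite /= -tr; split => [vt|[i iS ->]]; last by rewrite mem_nth// Es.
exists (index v t); last by rewrite nth_index.
by rewrite -ltnS -Es index_mem.
Qed.

Lemma min_gap (R : realType) (s : nat) (l : nat -> R) : (forall j, (j <= s)%N -> l j < l j.+1) ->
  exists2 e, 0 < e & forall j, (j <= s)%N -> e <= l j.+1 - l j.
Proof.
elim: s => [|s IH] H.
  by exists (l 1%N - l 0%N); [rewrite subr_gt0 H|move=> [|//] _].
have [|e e0 He] := IH; first by move=> j js; apply: H; exact: leqW.
exists (Num.min e (l s.+2 - l s.+1)); first by rewrite lt_min e0 subr_gt0 H.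
move=> j; rewrite leq_eqVlt => /orP[/eqP ->|js]; first by rewrite ge_min lexx orbT.
by rewrite ge_min He.
Qed.

Section ClosedLocalData.
Context (R : realType) (n : nat) (M : ham_manifold R n).
Hypothesis clM : closed_ham M.
Let cM : compact [set: M]. Proof. by case: clM. Qed.

(** Near a noncritical point some directional derivative stays nonzero, so local constancy on
    critical points is vacuous there. *)
Lemma critical_values_finite : finite_set (critical_value M).
Proof.
rewrite (_ : critical_value M = @hm_ham _ _ M @` (@critical_point _ _ M)) //.
apply: compact_locally_finite cM _ => p.
have [cp|ncp] := pselect (critical_point p); first exact: critical_level_locally_constant.
move/existsNP: ncp => [c /not_implyP[ac /not_implyP[dp /existsNP[v Dv]]]].
have cc := mf_is_chart ac; pose h := @hm_ham _ _ M \o chart_inv c.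
have sh : smooth_on (chart_img c) h by exact: hm_ham_smooth.
have cD := smooth_on_cont (smooth_on_D v sh) (chart_imgP dp).
have nz : \forall u \near c p, 'D_v h u != 0.
  have N : nbhs ('D_v h (c p)) [set a : R | a != 0].
    by apply: open_nbhs_nbhs; split; [exact: open_neq|exact/eqP].
  exact: (cD _ N).
have H : \forall y \near p, 'D_v h (c y) != 0 /\ chart_dom c y.
  apply: filterI; first exact: (chart_cont cc dp nz).
  by apply: open_nbhs_nbhs; split => //; exact: chart_dom_open.
by apply: filterS H => y [Dy dy] cy; rewrite (cy c ac dy v) eqxx in Dy.
Qed.

Lemma closed_max : exists xM : M, forall y : M, hm_ham y <= hm_ham xM.
Proof.
have [|b _ Hb] := compact_EVT_max _ cM (continuous_subspaceT (@ham_continuous _ _ M)).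
  exact: hm_nonempty.
by exists b => y; apply: Hb; exact: mem_set.
Qed.

Lemma closed_levels : exists s (l : nat -> R), [/\ l 0%N = 0,
  (forall j, (j <= s)%N -> l j < l j.+1),
  (forall mu, critical_value M mu <-> exists2 i, (i <= s.+1)%N & mu = l i) &
  forall v, l 0%N <= v <= l s.+1 <-> exists x : M, hm_ham x = v].
Proof.
have [_ ge0 [x0 hx0] [xf nf]] := clM.
have [xM HM] := closed_max.
have cr0 : critical_value M 0.
  by exists x0 => //; apply: extremum_critical; left => y; rewrite hx0.
have crM : critical_value M (hm_ham xM).
  by exists xM => //; apply: extremum_critical; right.
(* Were the maximum 0, H would be constant and every point critical, hence fixed, against the
   nontriviality of the action. *)
have M0 : 0 < hm_ham xM.
  rewrite lt_neqAle ge0 andbT; apply/eqP => E; apply: nf.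
  apply: critical_fixed; apply: extremum_critical; left => y.
  by apply: le_trans (ge0 y); rewrite E.
have [s [l [lS Hl]]] := finite_increasing_enum critical_values_finite cr0 crM M0.
have l0 : l 0%N = 0.
  apply/eqP; rewrite eq_le; apply/andP; split.
    have [i iS ->] := (Hl 0).1 cr0.
    by apply: (level_le lS); rewrite /= iS.
  have [x _ <-] : critical_value M (l 0%N) by apply/Hl; exists 0%N.
  exact: ge0.
have lM : l s.+1 = hm_ham xM.
  apply/eqP; rewrite eq_le; apply/andP; split.
    have [x _ <-] : critical_value M (l s.+1) by apply/Hl; exists s.+1.
    exact: HM.
  have [i iS ->] := (Hl _).1 crM.
  by apply: (level_le lS); rewrite iS leqnn.
exists s, l; split => // v; rewrite l0 lM; split => [vb|[x <-]]; last by rewrite ge0 HM.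
have : connected (@hm_ham _ _ M @` setT).
  apply: connected_continuous_connected; first exact: hm_connected.
  exact: (continuous_subspaceT (@ham_continuous _ _ M)).
move=> /connected_intervalP/(_ 0 (hm_ham xM)) H.
have [||x _ <-] := H _ _ v vb; [by exists x0|by exists xM|by exists x].
Qed.

End ClosedLocalData.

(** The properties are conditional because Hamiltonian manifolds are nonempty; for an empty band any
    manifold may stand in, which gives a family over all [a] and [b]. *)
Record band (R : realType) (n : nat) (M : ham_manifold R n) (a b : R) := Band {
  bd_M : ham_manifold R n;
  bd_in : bd_M -> M;
  bd_out : M -> bd_M;
  bd_P : @between _ _ M a b !=set0 ->
    [/\ isom_on setT (between a b) bd_in, isom_on (between a b) setT bd_out &
        forall x, between a b x -> bd_in (bd_out x) = x] }.

Section LocalDataOf.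
Context (R : realType) (n : nat) (M : ham_manifold R n).
Hypothesis cM : compact [set: M].

Lemma band_exists a b : exists B : band M a b, True.
Proof.
have [ne|ne] := pselect (@between _ _ M a b !=set0).
  have [B [f [g [If Ig fg]]]] := band_manifold cM ne.
  by exists (@Band _ _ M a b B f g (fun _ => And3 If Ig fg)).
by exists (@Band _ _ M a b M id id (fun h => False_ind _ (ne h))).
Qed.

Definition band_of a b : band M a b := projT1 (cid (band_exists a b)).
Local Notation bM a b := (bd_M (band_of a b)).

Lemma band_range (lo hi a b : R) : lo < hi -> a < hi -> lo < b -> a < b ->
  (forall v, lo <= v <= hi <-> exists x : M, hm_ham x = v) ->
  (@between _ _ M a b) !=set0 /\
  forall v, (exists y : bM a b, hm_ham y = v) <-> (a < v < b) && (lo <= v <= hi).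
Proof.
move=> lh ah lb ab rg.
have ne : (@between _ _ M a b) !=set0.
  (* The middle of the intersection of the band of heights with the range of H. *)
  pose v := (Num.max lo a + Num.min hi b) / 2.
  have mM : Num.max lo a < Num.min hi b by rewrite gt_max !lt_min lh lb ah ab.
  have v1 : Num.max lo a < v by rewrite /v; move: mM; move: (Num.max _ _) (Num.min _ _) => x y; lra.
  have v2 : v < Num.min hi b by rewrite /v; move: mM; move: (Num.max _ _) (Num.min _ _) => x y; lra.
  move: v1 v2; rewrite gt_max lt_min => /andP[v1 v2] /andP[v3 v4].
  have [|x xv] := (rg v).1; first by rewrite !ltW.
  by exists x; rewrite /between /= xv v2.
split => // v; have [If Ig fg] := bd_P (band_of a b) ne; split=> [[y <-]|/andP[vab vlh]].
  have := isom_fun If (I : setT y); rewrite /between /= (isom_ham If I) => -> /=.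
  by apply/rg; exists (bd_in y); exact: (isom_ham If I).
have [x xv] := (rg v).1 vlh; exists (bd_out (band_of a b) x).
by rewrite (isom_ham Ig)// /between /= xv.
Qed.

Lemma band_critical_value a b mu : (@between _ _ M a b) !=set0 ->
  critical_value (bM a b) mu <-> a < mu < b /\ critical_value M mu.
Proof.
move=> ne; have [If Ig fg] := bd_P (band_of a b) ne; split=> [[y cy <-]|[ab [x cx xmu]]].
  have := isom_fun If (I : setT y); rewrite /between /= (isom_ham If I) => yab; split => //.
  exists (bd_in y); last exact: (isom_ham If I).
  by apply: (isom_critical openT (@between_open _ _ M a b) (@act_invariantT _ _ _) If I cy).
have Ax : between a b x by rewrite /between /= xmu.
exists (bd_out (band_of a b) x); last by rewrite (isom_ham Ig).
exact: (isom_critical (@between_open _ _ M a b) openT (@between_invariant _ _ M a b) Ig Ax cx).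
Qed.

(** This is the identity of [M], read from one band manifold to another over a common subband. *)
Lemma band_overlap a b a' b' a1 b1 : (@between _ _ M a b) !=set0 ->
  (@between _ _ M a' b') !=set0 -> a <= a1 -> a' <= a1 -> b1 <= b -> b1 <= b' ->
  isom_on (between a1 b1) (between a1 b1)
    (bd_out (band_of a' b') \o @bd_in _ _ _ _ _ (band_of a b)).
Proof.
move=> ne ne' aa1 a'a1 b1b b1b'.
have [If _ _] := bd_P (band_of a b) ne; have [_ Ig _] := bd_P (band_of a' b') ne'.
apply: (isom_comp (B := between a1 b1)); try exact: between_open.
  apply: (isom_between_sub _ _ If) => //; [exact: openT|exact: between_open|].
  by move=> x /andP[x1 x2]; rewrite /between /= (le_lt_trans aa1)//= (lt_le_trans x2).
apply: (isom_between_sub _ _ Ig) => //; [exact: between_open|exact: openT|].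
by move=> x /andP[x1 x2]; rewrite /between /= (le_lt_trans a'a1)//= (lt_le_trans x2).
Qed.

Context (s : nat) (l : nat -> R) (e : R).
Hypothesis l0 : l 0%N = 0.
Hypothesis lS : forall j, (j <= s)%N -> l j < l j.+1.
Hypothesis crl : forall mu, critical_value M mu <-> exists2 i, (i <= s.+1)%N & mu = l i.
Hypothesis rgl : forall v, l 0%N <= v <= l s.+1 <-> exists x : M, hm_ham x = v.
Hypothesis e0 : 0 < e.
Hypothesis gap : forall j, (j <= s)%N -> e <= l j.+1 - l j.

Local Notation gband i := (band_of (l i - e) (l i + e)).
Local Notation sband j := (band_of (l j) (l j.+1)).

Lemma level_bounds i : (i <= s.+1)%N -> l 0%N <= l i <= l s.+1.
Proof. by move=> iS; rewrite !(level_le lS)//= ?iS ?leqnn. Qed.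

Lemma level_range : l 0%N < l s.+1.
Proof. by apply: (level_lt lS); rewrite /= leqnn. Qed.

Lemma level_near i v : (i <= s.+1)%N -> l i - e < v < l i + e ->
  (exists2 k, (k <= s.+1)%N & v = l k) -> v = l i.
Proof.
move=> iS vb [k kS vk]; rewrite vk in vb *.
case: (ltngtP k i) => [ki|ik|->//]; exfalso.
  case: i iS vb ki => // i iS vb ki; have := gap iS.
  have ki' : (k <= i <= s.+1)%N by rewrite -ltnS ki ltnW.
  have := level_le lS ki'; move: vb => /andP[v1 _]; lra.
case: k kS vk vb ik => // k kS vk vb ik; have := gap kS.
have ik' : (i <= k <= s.+1)%N by rewrite -ltnS ik ltnW.
have := level_le lS ik'; move: vb => /andP[_ v1]; lra.
Qed.

Lemma germ_band i : (i <= s.+1)%N -> (@between _ _ M (l i - e) (l i + e)) !=set0 /\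
  forall v, (exists y : bd_M (gband i), hm_ham y = v) <->
    (l i - e < v < l i + e) && (l 0%N <= v <= l s.+1).
Proof.
move=> iS; have /andP[h1 h2] := level_bounds iS; have r := level_range.
by apply: band_range => //; move: e0; lra.
Qed.

Lemma slice_band j : (j <= s)%N -> (@between _ _ M (l j) (l j.+1)) !=set0 /\
  forall v, (exists y : bd_M (sband j), hm_ham y = v) <->
    (l j < v < l j.+1) && (l 0%N <= v <= l s.+1).
Proof.
move=> js; have /andP[h1 h2] := level_bounds (leqW js).
have /andP[h3 h4] := @level_bounds j.+1 js; have r := level_range; have g := lS js.
by apply: band_range => //; lra.
Qed.

Lemma germ_band_critical i mu : (i <= s.+1)%N ->
  critical_value (bd_M (gband i)) mu <-> mu = l i.
Proof.
move=> iS; have [ne _] := germ_band iS; rewrite band_critical_value//; split.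
  by move=> [ab /crl]; exact: level_near.
by move=> ->; split; [move: e0; lra|apply/crl; exists i].
Qed.

Lemma range_set (B : ham_manifold R n) (S : set R) :
  (forall v, (exists y : B, hm_ham y = v) <-> S v) -> range (@hm_ham _ _ B) = S.
Proof.
move=> H; apply/seteqP; split => v; first by move=> [y _ yv]; apply/H; exists y.
by move=> /H[y yv]; exists y.
Qed.

Lemma min_band : min_cobordism (l 0%N) e (bd_M (gband 0)).
Proof.
split => // [|mu]; last exact: germ_band_critical.
have r := @gap 0 isT; have r' := @level_bounds 1 isT.
have [_ H] := @germ_band 0 isT; apply: range_set => v; rewrite H /= in_itv /=.
by split => [/andP[/andP[v1 v2] /andP[v3 v4]]|/andP[v1 v2]]; move: e0 r r'; lra.
Qed.

Lemma max_band : max_cobordism (l s.+1) e (bd_M (gband s.+1)).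
Proof.
split => // [|mu]; last exact: germ_band_critical.
have r := @gap s (leqnn s); have r' := @level_bounds s (leqnSn s).
have [_ H] := @germ_band s.+1 (leqnn _); apply: range_set => v; rewrite H /= in_itv /=.
by split => [/andP[/andP[v1 v2] /andP[v3 v4]]|/andP[v1 v2]]; move: e0 r r'; lra.
Qed.

Lemma interior_band i : (1 <= i <= s)%N -> cobordism (l i) e (bd_M (gband i)).
Proof.
case: i => // i /= iS; split => // [|mu]; last exact: germ_band_critical (leqW iS).
have r1 := @gap i (ltnW iS); have r2 := @gap i.+1 iS.
have r3 := @level_bounds i (leqW (ltnW iS)); have r4 := @level_bounds i.+2 iS.
have [_ H] := @germ_band i.+1 (leqW iS); apply: range_set => v; rewrite H /= in_itv /=.
by split => [/andP[]//|/andP[v1 v2]]; move: e0 r1 r2 r3 r4; lra.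
Qed.

(** A point with nontrivial stabiliser would be fixed, hence critical, at a height strictly between
    consecutive levels. *)
Lemma regular_band j : (j <= s)%N -> regular_slice (l j) (l j.+1) (bd_M (sband j)).
Proof.
move=> js; have [ne H] := slice_band js.
have [If _ _] := bd_P (sband j) ne; split.
  have r3 := @level_bounds j (leqW js); have r4 := @level_bounds j.+1 js.
  apply: range_set => v; rewrite H /= in_itv /=.
  by split => [/andP[]//|/andP[v1 v2]]; move: r3 r4; lra.
move=> t z tz; have := isom_fun If (I : setT z).
have : hm_act t (bd_in z) = bd_in z by rewrite -(isom_equivariant If)// tz.
move=> /hm_semifree[//|/fixed_critical cz] zb.
have /crl[i iS iz] : critical_value M (hm_ham (bd_in z)) by exists (bd_in z).
by case: (gap_not_level lS js iS zb).
Qed.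

(** All germs have the same width [e], at most the smallest gap between levels. The definition is
    transparent so that its components unfold when the data are compared with [M]. *)
Definition band_data : local_data R n.
Proof.
refine (@LocalData R n s l (fun=> e) (fun i => bd_M (gband i)) (fun j => bd_M (sband j))
  (fun j => bd_out (sband j) \o @bd_in _ _ _ _ _ (gband j))
  (fun j => bd_out (sband j) \o @bd_in _ _ _ _ _ (gband j.+1))
  l0 lS min_band interior_band max_band regular_band _ _).
- move=> j js; have [ne _] := germ_band (leqW js); have [ne' _] := slice_band js.
  by apply: band_overlap => //; move: e0 (gap js); lra.
- move=> j js; have [ne _] := @germ_band j.+1 js; have [ne' _] := slice_band js.
  by apply: band_overlap => //; move: e0 (gap js); lra.
Defined.

Lemma band_has_local_data : has_local_data M band_data.
Proof.
split; first exact: crl.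
exists (fun=> e / 2), (fun i => @bd_in _ _ _ _ _ (gband i)), (fun j => @bd_in _ _ _ _ _ (sband j)).
split => /=.
- move=> i iS; split; first by move: e0; lra.
  have [ne _] := germ_band iS; have [If _ _] := bd_P (gband i) ne.
  apply: (isom_between_sub _ _ If) => //; [exact: openT|exact: between_open|].
  by move=> x /andP[x1 x2]; rewrite /between /=; move: e0; lra.
- move=> j js; have [ne _] := slice_band js; by have [If _ _] := bd_P (sband j) ne.
- move=> j js y yb; have [ne _] := slice_band js; have [_ _ fg] := bd_P (sband j) ne.
  apply: fg; have [ne' _] := germ_band (leqW js); have [If _ _] := bd_P (gband j) ne'.
  move: yb; rewrite /between /= (isom_ham If I) => yb.
  by move: e0 (gap js); lra.
- move=> j js y yb; have [ne _] := slice_band js; have [_ _ fg] := bd_P (sband j) ne.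
  apply: fg; have [ne' _] := @germ_band j.+1 js; have [If _ _] := bd_P (gband j.+1) ne'.
  move: yb; rewrite /between /= (isom_ham If I) => yb.
  by move: e0 (gap js); lra.
Qed.

End LocalDataOf.

Lemma closed_has_local_data (R : realType) (n : nat) (M : ham_manifold R n) :
  closed_ham M -> exists L : local_data R n, has_local_data M L.
Proof.
move=> clM; have [cM _ _ _] := clM.
have [s [l [l0 lS crl rgl]]] := closed_levels clM.
have [e e0 gap] := min_gap lS.
by exists (band_data cM l0 lS crl rgl e0 gap); exact: band_has_local_data.
Qed.
Theorem theorem1p1 (R : realType) (n : nat) :
  (* existence, and uniqueness up to isomorphism *)
  (forall L : local_data R n,
     exists M : ham_manifold R n,
       (closed_ham M /\ has_local_data M L) /\
       (forall M' : ham_manifold R n,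
          closed_ham M' -> has_local_data M' L -> isomorphic M M')) /\
  (* L |-> M_L is well defined and injective on classes *)
  (forall (L L' : local_data R n) (M M' : ham_manifold R n),
     closed_ham M -> closed_ham M' ->
     has_local_data M L -> has_local_data M' L' ->
     (same_local_data L L' <-> isomorphic M M')) /\
  (* L |-> M_L is onto *)
  (forall M : ham_manifold R n, closed_ham M ->
     exists L : local_data R n, has_local_data M L) /\
  (* a closed Hamiltonian manifold is determined by its local data *)
  (forall (M M' : ham_manifold R n) (L : local_data R n),
     closed_ham M -> closed_ham M' ->
     has_local_data M L -> has_local_data M' L -> isomorphic M M').
Proof.
(* Uniqueness for one and the same [L] is the case of the identity isomorphism of local data. *)
have uniq (M M' : ham_manifold R n) (L : local_data R n) : closed_ham M -> closed_ham M' ->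
    has_local_data M L -> has_local_data M' L -> isomorphic M M'.
  move=> cM cM' ML ML'.
  exact: same_local_data_isomorphic cM cM' ML ML' (same_local_data_refl L).
split; [|split; [|split]].
- move=> L; exists (ex_M L); split; first by split; [exact: ex_closed|exact: ex_has_local_data].
  by move=> M' cM' ML'; apply: uniq cM' _ ML'; [exact: ex_closed|exact: ex_has_local_data].
- move=> L L' M M' cM cM' ML ML'; split; first exact: same_local_data_isomorphic.
  exact: isomorphic_same_local_data.
- exact: closed_has_local_data.
- exact: uniq.
Qed.
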